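(* Let $\rho:\mathcal Z\to\mathbb R$ be a law invariant coherent risk measure on $\mathcal Z=L_p(\Omega,\mathcal F,P)$, $p\in[1,\infty)$, where $(\Omega,\mathcal F,P)$ is $[0,1]$ with its Borel sigma-algebra and the uniform probability measure. Let $\mathfrak A\subset\mathcal Z^*$ be the dual set of $\rho$, let $\mathrm{Exp}(\mathfrak A)$ be its set of weak$^*$ exposed points, and let $\mathfrak U:=\mathfrak S\cap\mathrm{Exp}(\mathfrak A)$ be the set of exposed points that are spectral functions. Then the set $\mathfrak M:=\mathbb T^{-1}(\mathfrak U)$ is a Kusuoka set of $\rho$, and its closure satisfies $$\overline{\mathfrak M}=\overline{\mathbb T^{-1}(\mathfrak U)}=\mathbb T^{-1}(\overline{\mathfrak U}),$$ and $\overline{\mathfrak M}$ is the minimal Kusuoka set of $\rho$. Here $\overline{\mathfrak U}$ is the weak$^*$ closure of $\mathfrak U$ in $\mathcal Z^*$.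
   Context: $\mathcal Z^*=L_q(\Omega,\mathcal F,P)$, $1/p+1/q=1$, $\langle\zeta,Z\rangle=\int_0^1\zeta(\tau)Z(\tau)\,d\tau$. For $Z\in\mathcal Z$, $F_Z(z)=P(Z\le z)$ and $F_Z^{-1}(\tau)=\sup\{t:F_Z(t)\le\tau\}$. A coherent risk measure is a functional $\rho:\mathcal Z\to\mathbb R$ that is monotone ($Z\ge Z'$ a.e. implies $\rho(Z)\ge\rho(Z')$), convex, translation equivariant ($\rho(Z+a)=\rho(Z)+a$ for $a\in\mathbb R$) and positively homogeneous ($\rho(tZ)=t\rho(Z)$ for $t\ge0$). It is law invariant if $F_{Z_1}=F_{Z_2}$ implies $\rho(Z_1)=\rho(Z_2)$. The dual set $\mathfrak A\subset\mathcal Z^*$ of $\rho$ is the (unique) convex weakly$^*$ compact set of density functions with $\rho(Z)=\sup_{\zeta\in\mathfrak A}\langle\zeta,Z\rangle$ for all $Z\in\mathcal Z$. A point $\bar\zeta\in\mathfrak A$ is a weak$^*$ exposed point of $\mathfrak A$ if there is $Z\in\mathcal Z$ such that $\zeta\mapsto\langle\zeta,Z\rangle$ attains its maximum over $\mathfrak A$ at the unique point $\bar\zeta$. $\mathfrak S$ is the set of spectral functions: right-continuous, nondecreasing $\sigma:[0,1)\to[0,\infty)$ with $\int_0^1\sigma(t)\,dt=1$. An element of $\mathcal Z^*$ (an a.e.-equivalence class) is regarded as belonging to $\mathfrak S$ if it has a representative in $\mathfrak S$. $\mathfrak P$ is the set of probability measures on $[0,1]$ with zero mass at $1$, with the weak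 topology of probability measures; closedness and closures of sets of measures are taken in $\mathfrak P$. A measure $\mu$ is identified with its distribution function, and integrals $\int_0^\gamma\cdot\,d\mu$ include the mass at $0$. The map $\mathbb T:\mathfrak P\to\mathfrak S$, $(\mathbb T\mu)(\tau)=\int_0^\tau(1-\alpha)^{-1}d\mu(\alpha)$, $\tau\in[0,1)$, is a bijection with inverse $(\mathbb T^{-1}\sigma)(\alpha)=(1-\alpha)\sigma(\alpha)+\int_0^\alpha\sigma(\tau)\,d\tau$ (as distribution function). $\mathrm{AV@R}_\alpha(Z)=(1-\alpha)^{-1}\int_\alpha^1F_Z^{-1}(\tau)\,d\tau$, $\alpha\in[0,1)$. A set $\mathfrak M\subset\mathfrak P$ is a Kusuoka set of $\rho$ if $\rho(Z)=\sup_{\mu\in\mathfrak M}\int_0^1\mathrm{AV@R}_\alpha(Z)\,d\mu(\alpha)$ for all $Z\in\mathcal Z$. A Kusuoka set $\mathfrak M$ is minimal if it is closed and $\mathfrak M\subset\mathfrak M'$ for every closed Kusuoka set $\mathfrak M'$. *)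

(* Defs.v *)
From HB Require Import structures.
From mathcomp Require Import all_boot all_order all_algebra.
From mathcomp Require Import all_classical all_reals all_analysis.

Set Implicit Arguments.
Unset Strict Implicit.
Unset Printing Implicit Defensive.

Import Order.TTheory GRing.Theory Num.Theory.
Import numFieldTopology.Exports numFieldNormedType.Exports.

Local Open Scope classical_set_scope.
Local Open Scope ring_scope.

(* The sample space [0,1] is encoded by the Borel space R with the probability
   measure [unif01], which is carried by [0,1]: elements of L_p are classes of
   functions on R modulo [unif01]-a.e. equality, so their values outside [0,1]
   are irrelevant. *)
Definition unif01 (R : realType) : probability (measurableTypeR R) R :=
  uniform_prob (@ltr01 R).

(* [LspaceType] is the quotient by a.e. equality; its elements coerce to
   functions through a chosen representative. As the library does not provide
   the linear structure on it, the sum and scaling of classes are expressed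
   below by a.e. equations on representatives. *)
Definition Zspace (R : realType) (p : R) (p1 : (1 <= p%:E)%E) : Type :=
  LspaceType (unif01 R) p1.

(* L_q, where q is the Hoelder conjugate of p (q = +oo when p = 1) *)
Definition Zdual (R : realType) (p : R) (p1 : (1 <= p%:E)%E) : Type :=
  LspaceType (unif01 R) (hoelder_conj_ge1 p1).

Definition pairing (R : realType) (p : R) (p1 : (1 <= p%:E)%E)
    (z : Zdual p1) (Z : Zspace p1) : R :=
  \int[lebesgue_measure]_(t in `[0, 1]) (z t * Z t).

Section weak_star_topology.
Context (R : realType) (p : R) (p1 : (1 <= p%:E)%E).

HB.instance Definition _ := gen_eqMixin (Zspace p1).
HB.instance Definition _ := gen_choiceMixin (Zspace p1).
HB.instance Definition _ := gen_eqMixin (Zdual p1).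
HB.instance Definition _ := gen_choiceMixin (Zdual p1).

(* weak* topology: the coarsest one making every [pairing ^~ Z] continuous *)
HB.instance Definition _ := Topological.copy (Zdual p1)
  (initial_topology (@pairing R p p1 : Zdual p1 -> {ptws Zspace p1 -> R})).

End weak_star_topology.

Section risk_measures.
Context (R : realType) (p : R) (p1 : (1 <= p%:E)%E).
Local Notation P := (unif01 R).
Local Notation Z := (Zspace p1).
Local Notation Zs := (Zdual p1).

Record coherent (rho : Z -> R) : Prop := Coherent {
  coherent_monotone : forall X Y : Z,
    {ae P, forall w, Y w <= X w} -> rho Y <= rho X ;
  coherent_convex : forall (X Y W : Z) (t : R), 0 <= t <= 1 ->
    {ae P, forall w, W w = t * X w + (1 - t) * Y w} ->
    rho W <= t * rho X + (1 - t) * rho Y ;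
  coherent_translation : forall (X W : Z) (a : R),
    {ae P, forall w, W w = X w + a} -> rho W = rho X + a ;
  coherent_homogeneous : forall (X W : Z) (t : R), 0 <= t ->
    {ae P, forall w, W w = t * X w} -> rho W = t * rho X }.

(* [cdf] is stated for R with the default measurable display, whereas
   [LspaceType] is made of functions into [measurableTypeR R]. *)
Definition Zcdf (X : Z) (r : R) : \bar R := P [set w | X w <= r].

Definition law_invariant (rho : Z -> R) : Prop :=
  forall X Y : Z, (forall r, Zcdf X r = Zcdf Y r) -> rho X = rho Y.

Definition density (z : Zs) : Prop :=
  {ae P, forall w, 0 <= z w} /\
  (\int[lebesgue_measure]_(t in `[0%R, 1%R]) (z t)%:E = 1)%E.

Definition convex_subset (A : set Zs) : Prop :=
  forall (x y z : Zs) (t : R), A x -> A y -> 0 <= t <= 1 ->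
    {ae P, forall w, z w = t * x w + (1 - t) * y w} -> A z.

Definition dual_set (rho : Z -> R) (A : set Zs) : Prop :=
  [/\ convex_subset A, compact A, A `<=` density &
      forall X : Z, (rho X)%:E = ereal_sup [set (pairing z X)%:E | z in A]].

Definition exposed_points (A : set Zs) : set Zs :=
  [set z | A z /\ exists X : Z,
     (forall z', A z' -> pairing z' X <= pairing z X) /\
     (forall z', A z' -> pairing z' X = pairing z X -> z' = z)].

End risk_measures.

(* Only the values of [sigma] on [0,1[ matter. *)
Definition spectral (R : realType) (sigma : R -> R) : Prop :=
  [/\ forall t, t \in `[0, 1[ -> sigma x @[x --> t^'+] --> sigma t,
      {in `[0, 1[ &, {homo sigma : s t / s <= t}},
      {in `[0, 1[, forall t, 0 <= sigma t} &
      (\int[lebesgue_measure]_(t in `[0%R, 1%R[) (sigma t)%:E = 1)%E].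

Definition spectral_classes (R : realType) (p : R) (p1 : (1 <= p%:E)%E)
    : set (Zdual p1) :=
  [set z | exists2 sigma : R -> R, spectral sigma &
     {ae unif01 R, forall t, z t = sigma t}].
Arguments spectral_classes {R p} p1 _.

(* Probability measures on [0,1] without mass at 1, encoded as probability
   measures on R carried by [0,1[. *)
Definition Pspace (R : realType) : Type :=
  {mu : probability (measurableTypeR R) R | mu `[0%R, 1%R[%classic = 1%E}.

Definition C01 (R : realType) : Type :=
  {f : R -> R | {within `[0, 1], continuous f}}.

Definition Pintegral (R : realType) (mu : Pspace R) (f : C01 R) : R :=
  \int[sval mu]_(a in `[0, 1]) sval f a.

Section weak_topology_of_measures.
Context (R : realType).

HB.instance Definition _ := gen_eqMixin (C01 R).
HB.instance Definition _ := gen_choiceMixin (C01 R).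
HB.instance Definition _ := gen_eqMixin (Pspace R).
HB.instance Definition _ := gen_choiceMixin (Pspace R).

(* weak topology: the coarsest one making mu |-> \int f d mu continuous for
   every continuous f on [0,1]; [closure] and [closed] for sets in [Pspace R]
   are relative to the measures without mass at 1 *)
HB.instance Definition _ := Topological.copy (Pspace R)
  (initial_topology (@Pintegral R : Pspace R -> {ptws C01 R -> R})).

End weak_topology_of_measures.

(* Meaningful for tau in [0,1[; the closed interval includes the mass at 0. *)
Definition Tmap (R : realType) (mu : Pspace R) (tau : R) : R :=
  \int[sval mu]_(a in `[0, tau]) (1 - a)^-1.

(* T is a bijection from measures to spectral functions, so T^-1 (V) is the set
   of measures mu such that the a.e. class of T mu belongs to V. *)
Definition Tpreimage (R : realType) (p : R) (p1 : (1 <= p%:E)%E)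
    (V : set (Zdual p1)) : set (Pspace R) :=
  [set mu | exists2 z, V z & {ae unif01 R, forall t, z t = Tmap mu t}].

Section kusuoka.
Context (R : realType) (p : R) (p1 : (1 <= p%:E)%E).
Local Open Scope ereal_scope.

(* It may be -oo for tau = 0, and is +oo for tau = 1. *)
Definition quantile (X : Zspace p1) (tau : R) : \bar R :=
  ereal_sup [set t%:E | t in [set t : R | Zcdf X t <= tau%:E]].

Definition AVaR (alpha : R) (X : Zspace p1) : \bar R :=
  ((1 - alpha)^-1)%:E *
  \int[lebesgue_measure]_(tau in `[alpha, 1%R]) quantile X tau.

Definition kusuoka_set (rho : Zspace p1 -> R) (M : set (Pspace R)) : Prop :=
  forall X : Zspace p1, (rho X)%:E =
    ereal_sup [set \int[sval mu]_(a in `[0%R, 1%R[) AVaR a X | mu in M].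

Definition minimal_kusuoka_set (rho : Zspace p1 -> R) (M : set (Pspace R))
    : Prop :=
  [/\ kusuoka_set rho M, closed M &
      forall M' : set (Pspace R),
        kusuoka_set rho M' -> closed M' -> M `<=` M'].

End kusuoka.

(* Main.v *)
(* Exposed points are dense enough: for X in L_p and N large, a maximiser z0 over
   A of N <z, X> + 1/2 sum_k 2^-(k+1) m_k(z)^2, with m_k(z) = <z, t^k>, exists by
   compactness and is the unique maximiser over A of the linear form given by
   W = N X + sum_k 2^-(k+1) m_k(z0) t^k, and <z0, X> is within 1/(2N) of rho(X).
   If X is a nondecreasing rearrangement then so is W, and the Hardy-Littlewood
   inequality together with law invariance forces z0 to be nondecreasing, i.e.
   spectral; law invariance is used through f = (rearrangement of f) o (ranking
   of f), the ranking being uniform.  Since <T mu, X*> is the integral of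
   AV@R(X) against mu, X* being the rearrangement of X, this gives a Kusuoka set.

   The moments of mu are pairings of T mu with fixed polynomials, and moments
   control both weak convergence of measures on [0,1] and elements of the dual;
   with the compactness of A this exchanges closure and T^-1.

   For minimality, let z0 = T mu0 be exposed by X; then z0 is also exposed by X*.
   If measures mu_n of another Kusuoka set almost realise rho(X), then for
   bounded V, rho(X* + t V) <= rho(X) + t <z0, V> + o(t) on the one hand and
   rho(X* + t V) >= rho(X) - o(1) + t <T mu_n, V> on the other, so that the
   moments of mu_n converge to those of mu0. *)
Require Import Defs.
From HB Require Import structures.
From mathcomp Require Import all_boot all_order all_algebra.
From mathcomp Require Import all_classical all_reals all_analysis.
From mathcomp Require Import measurable_realfun ess_sup_inf ring lra.

Set Implicit Arguments.
Unset Strict Implicit.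
Unset Printing Implicit Defensive.

Import Order.TTheory GRing.Theory Num.Theory.
Import numFieldTopology.Exports numFieldNormedType.Exports.

Local Open Scope classical_set_scope.
Local Open Scope ring_scope.

(** Law invariance is a property of [rho] and has to be transferred to [A]. This works because [A]
    consists exactly of the densities dominated by [rho], so it is stable under equality in law.
    General theorems on exposed points give no control of the exposing variable; the quadratic
    perturbation does. Its gradient is a power series whose coefficients m_k(z0) are nonnegative, z0
    being a nonnegative function, and this is why W is nondecreasing. The weights 2^-(k+1) sum to 1
    and |m_k| <= 1 on densities, so the perturbation lies in [0, 1/2], whence the loss 1/(2N).

    Mass may escape to 1, so [Pspace] offers no compactness: limit points are found in [A] and
    identified through moments.

    In the minimality argument, T mu_n is not known to lie in the dual when mu_n comes from an
    arbitrary Kusuoka set, so averages over [a, 1] integrated against mu_n replace the pairing. Nor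
    is X* + tV nondecreasing; only the inequality between its averages and those of its
    rearrangement is available, and it points the right way. *)

Section ae_lemmas.
Context d (T : measurableType d) (R : realType) (mu : {measure set T -> \bar R}).
Implicit Types Q : T -> Prop.

Lemma aeS Q1 Q2 : (forall t, Q1 t -> Q2 t) ->
  {ae mu, forall t, Q1 t} -> {ae mu, forall t, Q2 t}.
Proof.
move=> Q12 [N [mN N0 sN]]; exists N; split=> //.
by move=> t /= nQ2; apply: sN => /= /Q12.
Qed.

Lemma aeI Q1 Q2 : {ae mu, forall t, Q1 t} -> {ae mu, forall t, Q2 t} ->
  {ae mu, forall t, Q1 t /\ Q2 t}.
Proof.
move=> [N1 [mN1 N10 sN1]] [N2 [mN2 N20 sN2]]; exists (N1 `|` N2); split.
- exact: measurableU.
- by apply: null_set_setU.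
- move=> t /= /not_andP[nQ|nQ]; [left; exact: sN1|right; exact: sN2].
Qed.

Lemma aeT Q : (forall t, Q t) -> {ae mu, forall t, Q t}.
Proof.
by move=> q; exists set0; split=> //; move=> t /= nq; exfalso; apply: nq.
Qed.

Lemma ae_le_measure (A B : set T) : measurable A -> measurable B ->
  {ae mu, forall t, A t -> B t} -> (mu A <= mu B)%E.
Proof.
move=> mA mB [N [mN N0 sN]]; apply: (@le_trans _ _ (mu (B `|` N))).
  apply: le_measure; rewrite ?inE//; first exact: measurableU.
  move=> t At; have [Bt|nBt] := pselect (B t); [by left|right].
  by apply: sN => /= /(_ At).
by rewrite measureU0.
Qed.

End ae_lemmas.

(** * The uniform law on [0, 1] and integrals against probabilities *)

Section unif01_basics.
Context (R : realType).
Local Notation mu := (@lebesgue_measure R).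
Local Notation P := (unif01 R).
Local Notation RT := (measurableTypeR R).

Lemma unif01E (A : set (measurableTypeR R)) : measurable A ->
  P A = mu (A `&` `[0, 1]).
Proof.
move=> mA; transitivity (\int[mu]_(x in A) (uniform_pdf 0 1 x)%:E)%E; first by [].
rewrite integral_uniform_pdf.
rewrite (eq_integral (fun=> 1%:E)); last first.
  move=> x /[!inE] -[_]; rewrite /= in_itv/= /uniform_pdf => ->.
  by rewrite subr0 invr1.
by rewrite integral_cst ?mul1e//; exact: measurableI.
Qed.

Lemma unif01_itvNyc (u : R) : 0 <= u <= 1 -> P `]-oo, u]%classic = u%:E.
Proof.
move=> /andP[u0 u1]; rewrite unif01E//.
rewrite (_ : _ `&` _ = `[0, u]%classic); last first.
  apply/seteqP; split=> x /=; rewrite !in_itv/=.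
    by move=> [-> /andP[-> _]].
  by move=> /andP[-> xu]; rewrite xu (le_trans xu).
rewrite lebesgue_measure_itv/= lte_fin; case: ltP => u0'.
  by rewrite -EFinB subr0.
by congr EFin; apply/eqP; rewrite eq_le u0 u0'.
Qed.

Lemma integral_unif01 (f : RT -> \bar R) : measurable_fun setT f ->
  (\int[P]_t f t = \int[mu]_(t in `[0%R, 1%R]) f t)%E.
Proof.
move=> mf; rewrite [LHS]integralE [RHS]integralE.
rewrite !integral_uniform//; [|exact: measurable_funeneg|exact: measurable_funepos].
by rewrite subr0 invr1 !mul1e.
Qed.

Lemma ae_unif01_itv : {ae P, forall t, t \in `]0%R, 1%R[}.
Proof.
exists (~` `]0, 1[%classic); split=> //; first exact: measurableC.
rewrite unif01E; last exact: measurableC.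
apply/eqP; rewrite eq_le measure_ge0 andbT.
apply: (@le_trans _ _ (mu [set 0; 1])).
  apply: le_measure; rewrite ?inE//.
  - by apply: measurableI => //; exact: measurableC.
  - by apply: measurableU; exact: measurable_set1.
  - move=> x /= [+]; rewrite !in_itv/= => xN /andP[x0 x1].
    have [->|x0'] := eqVneq x 0; [by left|right].
    apply/eqP; rewrite eq_le x1/= leNgt; apply/negP => x1'.
    by apply: xN; rewrite lt_neqAle eq_sym x0' x0 x1'.
rewrite countable_lebesgue_measure0//.
by apply: finite_set_countable; exact: finite_set2.
Qed.

Lemma ae_unif01 (Q : R -> Prop) : {ae mu, forall t, Q t} -> {ae P, forall t, Q t}.
Proof.
move=> [N [mN N0 sN]]; exists N; split=> //.
by have /null_content_dominatesP := dominates_uniform_prob (@ltr01 R); apply.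
Qed.

End unif01_basics.

Section probability_Rintegral.
Context d (T : measurableType d) (R : realType) (P : probability T R).
Implicit Types f g : T -> R.

Lemma integrable_bounded f (M : R) : measurable_fun setT f ->
  {ae P, forall t, `|f t| <= M} -> P.-integrable setT (EFin \o f).
Proof.
move=> mf fM; apply/integrableP; split; first exact/measurable_EFinP.
apply: (@le_lt_trans _ _ (\int[P]_t `|M|%:E)%E).
  apply: ae_ge0_le_integral => //.
  - by do 2 apply: measurableT_comp => //.
  - apply: aeS fM => t {}fM _; rewrite /= lee_fin (le_trans fM)//.
    exact: ler_norm.
by rewrite integral_cst//= probability_setT mule1 ltry.
Qed.

Lemma ae_eq_Rintegral f g : measurable_fun setT f -> measurable_fun setT g ->
  {ae P, forall t, f t = g t} -> \int[P]_t f t = \int[P]_t g t.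
Proof.
move=> mf mg fg; congr fine; apply: ae_eq_integral => //.
- exact/measurable_EFinP.
- exact/measurable_EFinP.
- by apply: aeS fg => t -> _.
Qed.

Lemma ae_le_Rintegral f g : P.-integrable setT (EFin \o f) ->
  P.-integrable setT (EFin \o g) ->
  {ae P, forall t, f t <= g t} -> \int[P]_t f t <= \int[P]_t g t.
Proof.
move=> mf mg fg.
have /measurable_EFinP mf' := measurable_int _ mf.
have /measurable_EFinP mg' := measurable_int _ mg.
rewrite -subr_ge0 -RintegralB//.
rewrite (@ae_eq_Rintegral _ (fun t => Num.max (g t - f t) 0)).
- by apply: Rintegral_ge0 => t _; rewrite le_max lexx orbT.
- exact: measurable_funB.
- by apply: measurable_maxr => //; exact: measurable_funB.
- by apply: aeS fg => t fg; rewrite max_l// subr_ge0.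
Qed.

Lemma ge0_Rintegral_eq0_ae f : P.-integrable setT (EFin \o f) ->
  {ae P, forall t, 0 <= f t} -> \int[P]_t f t <= 0 ->
  {ae P, forall t, f t = 0}.
Proof.
move=> fi f0 If; have mf := measurable_int _ fi.
have H : (\int[P]_t `|(EFin \o f) t| = 0)%E.
  rewrite (@ae_eq_integral _ _ _ P _ (EFin \o f))//.
  - rewrite -[LHS]fineK; last exact: integrable_fin_num.
    congr EFin; apply/eqP; rewrite eq_le If /=.
    have := @ae_le_Rintegral (cst 0) f _ fi f0.
    rewrite Rintegral_cst// mul0r; apply.
    exact: (@finite_measure_integrable_cst _ _ _ P setT 0).
  - exact: measurableT_comp.
  - by apply: aeS f0 => t {}f0 _ /=; rewrite ger0_norm.
have [/(_ H) + _] := ae_eq_integral_abs P measurableT mf.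
by apply: aeS => t /(_ I) /= [].
Qed.

End probability_Rintegral.

(** * Nondecreasing rearrangement *)

(** Preimages of rays under a monotone function are intervals. *)
Lemma measurable_fun_nondecreasing_in (R : realType) (i : interval R)
    (f : R -> R) : {in i &, {homo f : x y / x <= y}} -> measurable_fun [set` i] f.
Proof.
move=> f_nd.
apply: (measurability (@RGenCInfty.G R)) => [|/= _ [_] [r] -> <-].
  exact: RGenCInfty.measurableE.
apply: is_interval_measurable => s t [si fs] [ti ft] u /andP[su ut].
move: fs; rewrite /= in_itv/= andbT => fs.
have ui : u \in i by have := interval_is_interval si ti; apply; rewrite su ut.
by split; [move: ui; case: (i) => ? ?|rewrite /= in_itv/= andbT (le_trans fs)// f_nd].
Qed.

Section same_law.
Context (R : realType).
Local Notation P := (unif01 R).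
Local Notation RT := (measurableTypeR R).
Implicit Types f g : RT -> R.

(** Stated on all Borel sets, so that it passes at once to Borel images and to integrals; equality
    of distribution functions suffices to establish it, by [same_law_cdf]. *)
Definition same_law f g := forall B : set RT, measurable B ->
  P (f @^-1` B) = P (g @^-1` B).

Lemma measurable_le_cst f r : measurable_fun setT f -> measurable [set t | f t <= r].
Proof.
move=> mf; have := mf measurableT `]-oo, r]%classic (measurable_itv _).
by rewrite setTI; congr measurable; apply/seteqP; split=> x /=; rewrite in_itv.
Qed.

Lemma measurable_lt_cst f r : measurable_fun setT f -> measurable [set t | f t < r].
Proof.
move=> mf; have := mf measurableT `]-oo, r[%classic (measurable_itv _).
by rewrite setTI; congr measurable; apply/seteqP; split=> x /=; rewrite in_itv.
Qed.

Lemma same_law_cdf f g : measurable_fun setT f -> measurable_fun setT g ->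
  (forall r, P [set t | f t <= r] = P [set t | g t <= r]) -> same_law f g.
Proof.
move=> mf mg fg B mB.
have mf' : measurable_fun setT (f : RT -> RT) by exact: mf.
have mg' : measurable_fun setT (g : RT -> RT) by exact: mg.
pose X : {mfun RT >-> RT} := mfun_Sub (mem_set mf' : (f : RT -> RT) \in mfun).
pose Y : {mfun RT >-> RT} := mfun_Sub (mem_set mg' : (g : RT -> RT) \in mfun).
suff : distribution P X B = distribution P Y B by [].
apply: (@measure_unique _ R RT (@RGenOInfty.G R) (fun k => `]- k%:R, +oo[%classic)) => //.
- exact: RGenOInfty.measurableE.
- move=> _ _ [x ->] [y ->]; exists (Num.max x y); apply/seteqP; split => z /=;
  by rewrite !in_itv/= !andbT gt_max => /andP.
- by move=> k; exists (- k%:R).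
- apply/seteqP; split=> // x _; exists (Num.truncn `|x|).+1 => //=.
  rewrite in_itv/= andbT ltrNl (le_lt_trans (ler_norm _))// normrN.
  exact: truncnS_gt.
- move=> _ [x ->].
  have E (h : RT -> R) : measurable_fun setT h ->
      P (h @^-1` `]x, +oo[%classic) = (1 - P [set t | (h t <= x)%R])%E.
    move=> mh; rewrite -probability_setC; last exact: measurable_le_cst.
    by congr (P _); apply/seteqP; split=> z /=; rewrite in_itv/= andbT ltNge => /negP.
  transitivity (1 - P [set t | (f t <= x)%R])%E; first exact: E.
  by rewrite fg; exact/esym/E.
- move=> k; rewrite (le_lt_trans (probability_le1 _ _)) ?ltry//.
Qed.

Lemma same_law_comp f g (h : R -> R) : measurable_fun setT (h : RT -> RT) ->
  same_law f g -> same_law (h \o f) (h \o g).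
Proof.
move=> mh fg B mB; have mhB := mh measurableT B mB; rewrite setTI in mhB.
exact: (fg _ mhB).
Qed.

Lemma ge0_integral_same_law f g (h : RT -> \bar R) : measurable_fun setT f ->
  measurable_fun setT g -> same_law f g -> measurable_fun setT h ->
  (forall x, 0 <= h x)%E -> (\int[P]_t h (f t) = \int[P]_t h (g t))%E.
Proof.
move=> mf mg fg mh h0.
have mf' : measurable_fun setT (f : RT -> RT) by exact: mf.
have mg' : measurable_fun setT (g : RT -> RT) by exact: mg.
pose X : {mfun RT >-> RT} := mfun_Sub (mem_set mf' : (f : RT -> RT) \in mfun).
pose Y : {mfun RT >-> RT} := mfun_Sub (mem_set mg' : (g : RT -> RT) \in mfun).
rewrite -(@ge0_integral_distribution _ _ _ _ _ P X h)//.
rewrite -(@ge0_integral_distribution _ _ _ _ _ P Y h)//.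
by apply: eq_measure_integral => A mA _; exact: fg.
Qed.

Lemma integral_same_law f g (h : RT -> \bar R) : measurable_fun setT f ->
  measurable_fun setT g -> same_law f g -> measurable_fun setT h ->
  (\int[P]_t h (f t) = \int[P]_t h (g t))%E.
Proof.
move=> mf mg fg mh; rewrite [LHS]integralE [RHS]integralE.
have E k : (fun t => h (k t)) = h \o k :> (RT -> \bar R) by [].
rewrite !E (funepos_comp h f) (funepos_comp h g) (funeneg_comp h f) (funeneg_comp h g).
congr (_ - _)%E.
  apply: (ge0_integral_same_law mf mg fg (h := h^\+%E)) => //.
  exact: measurable_funepos.
apply: (ge0_integral_same_law mf mg fg (h := h^\-%E)) => //.
exact: measurable_funeneg.
Qed.

Lemma ae_same_law f g (Q : set R) : measurable_fun setT f ->
  measurable_fun setT g -> same_law f g -> measurable (Q : set RT) ->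
  {ae P, forall t, Q (f t)} -> {ae P, forall t, Q (g t)}.
Proof.
move=> mf mg fg mQ [N [mN N0 sN]].
exists (g @^-1` (~` Q)); split=> //.
- by rewrite -[X in measurable X]setTI; apply: mg => //; exact: measurableC.
- rewrite -fg; last exact: measurableC.
  apply: (subset_measure0 (B := N)) => //.
  by rewrite -[X in measurable X]setTI; apply: mf => //; exact: measurableC.
Qed.

Lemma finite_norm_same_law f g (p : \bar R) : (1 <= p)%E ->
  measurable_fun setT f -> measurable_fun setT g -> same_law f g ->
  finite_norm P p f -> finite_norm P p g.
Proof.
move=> p1 mf mg fg; rewrite /finite_norm; suff -> : Lnorm P p (EFin \o f) = Lnorm P p (EFin \o g) by [].
rewrite unlock /Lnorm; case: p p1 => [r r1| |//].
- congr (_ `^ _)%E.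
  apply: (ge0_integral_same_law mf mg fg (h := fun x => (`|x%:E| `^ r)%E)).
  + apply: (@measurableT_comp _ _ _ _ _ _ (@poweR R ^~ r)); first exact: measurable_poweR.
    by apply: measurableT_comp => //; exact: measurable_EFin.
  + by move=> x; exact: poweR_ge0.
- move=> _; case: ifPn => // _; rewrite !ess_supEae.
  congr ereal_inf; apply/seteqP; split => y /=.
  + apply: (ae_same_law mf mg fg (Q := [set x | `|x%:E| <= y]%E)).
    rewrite -[X in measurable X]setTI; apply: emeasurable_fun_le => //.
    by apply: measurableT_comp => //; exact: measurable_EFin.
  + apply: (ae_same_law mg mf _ (Q := [set x | `|x%:E| <= y]%E)); first by move=> B mB; rewrite fg.
    rewrite -[X in measurable X]setTI; apply: emeasurable_fun_le => //.
    by apply: measurableT_comp => //; exact: measurable_EFin.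
Qed.

(** [f] and [g] may fail to be integrable, so both are composed with [atan], bounded and strictly
    increasing: equal laws give equal integrals, and a nonnegative difference with zero integral
    vanishes a.e. *)
Lemma same_law_le_ae_eq f g : measurable_fun setT f -> measurable_fun setT g ->
  same_law f g -> {ae P, forall t, f t <= g t} -> {ae P, forall t, f t = g t}.
Proof.
move=> mf mg fg lefg.
have matan : measurable_fun setT (@atan R : RT -> R).
  by apply: continuous_measurable_fun => x; exact: continuous_atan.
have bnd (h : RT -> R) : measurable_fun setT h ->
    P.-integrable setT (EFin \o (@atan R \o h)).
  move=> mh; apply: (@integrable_bounded _ _ _ _ _ (pi / 2)).
    exact: measurableT_comp.
  by apply: aeT => t; rewrite ler_norml !ltW ?atan_gtNpi2 ?atan_ltpi2.
have := @ge0_Rintegral_eq0_ae _ _ _ P (fun t => atan (g t) - atan (f t)).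
have -> : \int[P]_t (atan (g t) - atan (f t)) = 0.
  rewrite (@RintegralB _ _ _ P setT (@atan R \o g) (@atan R \o f))//; [|exact: bnd..].
  apply/eqP; rewrite subr_eq0; apply/eqP; congr fine; apply/esym.
  apply: (integral_same_law mf mg fg (h := fun x => (atan x)%:E)).
  exact/measurable_EFinP.
move=> H; apply: aeS (H _ _ _) => //.
- move=> t /eqP; rewrite subr_eq0 => /eqP /(congr1 (@tan R)).
  by rewrite !atanK => ->.
- exact: (integrableB measurableT (bnd _ mg) (bnd _ mf)).
- by apply: aeS lefg => t; rewrite subr_ge0; exact: le_atan.
Qed.

End same_law.

Section rearrangement.
Context (R : realType).
Local Notation P := (unif01 R).
Local Notation RT := (measurableTypeR R).
Implicit Types f g : RT -> R.

Definition rcdf f (r : R) : R := fine (P [set t | f t <= r]).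

Definition qsup f (u : R) : R := sup [set r | rcdf f r <= u].

(** The upper quantile function, set to 0 outside []0, 1[]: at level 0 the set whose supremum is
    taken may be empty, and at level 1 it is the whole line. *)
Definition rearr f : RT -> R := qsup f \_ `]0, 1[.

Lemma rcdfE f r : measurable_fun setT f -> (rcdf f r)%:E = P [set t | f t <= r].
Proof. by move=> mf; rewrite fineK// fin_num_measure//; exact: measurable_le_cst. Qed.

Lemma rcdf_nd f : measurable_fun setT f -> {homo rcdf f : x y / x <= y}.
Proof.
move=> mf x y xy; rewrite -lee_fin !rcdfE//; apply: le_measure.
- by rewrite inE; exact: measurable_le_cst.
- by rewrite inE; exact: measurable_le_cst.
- by move=> t /= /le_trans; apply.
Qed.

Lemma rcdf_cvg f : measurable_fun setT f ->
  [/\ rcdf f @ -oo --> (0:R), rcdf f @ +oo --> (1:R) & right_continuous (rcdf f)].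
Proof.
move=> mf; pose X : {RV P >-> R} := mfun_Sub (mem_set mf : (f : RT -> R) \in mfun).
have E : rcdf f = fine \o cdf X.
  apply/funext => r; rewrite /rcdf /cdf /distribution /pushforward /=.
  by congr (fine (P _)); apply/seteqP; split => t /=; rewrite in_itv.
rewrite E; split.
- exact/fine_cvg/cvg_cdfNy0.
- exact/fine_cvg/cvg_cdfy1.
- move=> a; apply: fine_cvg.
  have := @cdf_right_continuous _ _ _ P X a.
  by rewrite [in X in _ -> X]/comp fineK// fin_num_measure.
Qed.

Lemma has_sup_rcdf f u : measurable_fun setT f -> 0 < u < 1 ->
  has_sup [set r | rcdf f r <= u].
Proof.
move=> mf /andP[u0 u1]; have [c0 c1 _] := rcdf_cvg mf; split.
- have [x xu] := filter_ex (cvgr_lt _ c0 _ u0); exists x; exact: ltW.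
- have [x xu] := filter_ex (cvgr_gt _ c1 _ u1).
  exists x => r /= ru; rewrite leNgt; apply/negP => /ltW /(rcdf_nd mf).
  by rewrite leNgt (le_lt_trans ru).
Qed.

Lemma le_qsup f u r : has_sup [set r | rcdf f r <= u] ->
  rcdf f r <= u -> r <= qsup f u.
Proof. by move=> [_ fu] ru; exact: ub_le_sup. Qed.

Lemma lt_qsup f u r : measurable_fun setT f -> has_sup [set r | rcdf f r <= u] ->
  r < qsup f u -> rcdf f r <= u.
Proof.
move=> mf [fn fu] /(sup_gt fn) [x xu rx].
by rewrite (le_trans _ xu)// rcdf_nd// ltW.
Qed.

Lemma qsup_le f u r : measurable_fun setT f -> has_sup [set r | rcdf f r <= u] ->
  u < rcdf f r -> qsup f u <= r.
Proof.
move=> mf fs ur; rewrite leNgt; apply/negP => /(lt_qsup mf fs).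
by rewrite leNgt ur.
Qed.

Lemma qsup_lt f u r : has_sup [set r | rcdf f r <= u] ->
  qsup f u < r -> u < rcdf f r.
Proof. by move=> fs; rewrite !ltNge; apply: contra => /(le_qsup fs). Qed.

Lemma le_qsup2 f u v : has_sup [set r | rcdf f r <= u] ->
  has_sup [set r | rcdf f r <= v] -> u <= v -> qsup f u <= qsup f v.
Proof.
move=> [un _] fv uv; apply: ge_sup => // r /= ru.
by apply: le_qsup => //; exact: le_trans uv.
Qed.

(** Right continuity of the distribution function, which exceeds u everywhere above [qsup f u]. *)
Lemma rcdf_qsup_ge f u : measurable_fun setT f -> has_sup [set r | rcdf f r <= u] ->
  u <= rcdf f (qsup f u).
Proof.
move=> mf fs; have [_ _ /(_ (qsup f u)) rc] := rcdf_cvg mf.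
rewrite leNgt; apply/negP => qu.
have H : \forall x \near (qsup f u)^'+, qsup f u < x by exact: nbhs_right_gt.
have H2 : \forall x \near (qsup f u)^'+, rcdf f x < u by exact: (cvgr_lt _ rc).
have [x [/= xu qx]] := @filter_ex _ _ (at_right_proper_filter (qsup f u)) _ (filterI H2 H).
by have := qsup_lt fs qx; rewrite ltNge ltW.
Qed.

Lemma unif01_lt_le f c u : measurable_fun setT f ->
  (forall r, r < c -> rcdf f r <= u) -> (P [set t | (f t < c)%R] <= u%:E)%E.
Proof.
move=> mf Hc; have -> : [set t | f t < c] = \bigcup_n [set t | f t <= c - n.+1%:R^-1].
  apply/seteqP; split => t /=.
    rewrite -subr_gt0 => /ltr_add_invr[k]; rewrite add0r => fk.
    by exists k => //=; rewrite lerBrDl -lerBrDr ltW.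
  by move=> [n _ /=] /le_lt_trans; apply; rewrite ltrBlDr ltrDl invr_gt0.
have mF n : measurable [set t | f t <= c - n.+1%:R^-1] by exact: measurable_le_cst.
have cvF : P [set t | f t <= c - n.+1%:R^-1] @[n --> \oo] -->
    P (\bigcup_n [set t | f t <= c - n.+1%:R^-1]).
  apply: nondecreasing_cvg_mu => //; first exact: bigcupT_measurable.
  move=> n m nm; apply/subsetPset => t /= /le_trans; apply.
  by rewrite lerD2l lerN2 lef_pV2 ?posrE// ler_nat.
apply: (cvge_le _ cvF); apply: nearW => n /=; rewrite -rcdfE// lee_fin Hc//.
by rewrite ltrBlDr ltrDl invr_gt0.
Qed.

Lemma rearr_nd f : measurable_fun setT f -> {in `]0, 1[ &, {homo rearr f : x y / x <= y}}.
Proof.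
move=> mf x y x01 y01 xy; rewrite /rearr !patchE !mem_set//.
by apply: le_qsup2 => //; apply: has_sup_rcdf => //; rewrite -in_itv.
Qed.

Lemma measurable_rearr f : measurable_fun setT f -> measurable_fun setT (rearr f).
Proof.
move=> mf; have mD : measurable (`]0, 1[%classic : set RT) by exact: measurable_itv.
suff H : {in `]0, 1[ &, {homo qsup f : x y / x <= y}}.
  by apply/(measurable_restrictT _ mD); exact: (measurable_fun_nondecreasing_in H).
move=> x y x01 y01 xy; by have := rearr_nd mf x01 y01 xy; rewrite /rearr !patchE !mem_set.
Qed.

Lemma in_itv01_has_sup f t : measurable_fun setT f -> t \in `]0, 1[ ->
  has_sup [set r | rcdf f r <= t].
Proof. by move=> mf t01; apply: has_sup_rcdf => //; rewrite -in_itv. Qed.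

Lemma rearrE f t : t \in `]0, 1[ -> rearr f t = qsup f t.
Proof. by move=> t01; rewrite /rearr patchE mem_set. Qed.

Lemma rcdf_ge0 f r : 0 <= rcdf f r.
Proof. by rewrite /rcdf fine_ge0. Qed.

Lemma rcdf_le1 f r : measurable_fun setT f -> rcdf f r <= 1.
Proof.
by move=> mf; rewrite -lee_fin rcdfE// probability_le1//; exact: measurable_le_cst.
Qed.

Lemma unif01_itvNyo (u : R) : 0 <= u <= 1 -> P `]-oo, u[%classic = u%:E.
Proof.
move=> u01; rewrite -(unif01_itvNyc u01) !unif01E//.
have -> : `]-oo, u] `&` `[0%R, 1%R] = (`]-oo, u[ `&` `[0%R, 1%R]) `|` [set u] :> set R.
  apply/seteqP; split => x /=; rewrite !in_itv/=.
    rewrite le_eqVlt => -[/orP[/eqP ->|xu] x01]; [by right|by left].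
  by move=> [[/ltW]|->].
rewrite measureU//.
- by rewrite [X in (_ + X)%E]lebesgue_measure_set1 adde0.
- by apply: measurableI.
- by apply/seteqP; split => // x /= [[+ _] xu]; rewrite in_itv/= xu ltxx.
Qed.

(** With F the distribution function and q the quantile, t < F(r) forces q(t) <= r, and q(t) <= r
    forces t <= F(q(t)) <= F(r); hence q <= r on a set of measure F(r). *)
Lemma same_law_rearr f : measurable_fun setT f -> same_law f (rearr f).
Proof.
move=> mf; apply: same_law_cdf => //; first exact: measurable_rearr.
move=> r; rewrite -rcdfE//; have mr := measurable_rearr mf.
have r01 : 0 <= rcdf f r <= 1 by rewrite rcdf_ge0 rcdf_le1.
have mfr : measurable [set t | rearr f t <= r] by exact: measurable_le_cst.
apply/eqP; rewrite eq_le; apply/andP; split.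
- rewrite -(unif01_itvNyo r01); apply: ae_le_measure => //.
  apply: aeS (ae_unif01_itv R) => t t01 /=; rewrite in_itv/= rearrE// => tr.
  by apply: qsup_le => //; exact: in_itv01_has_sup.
- rewrite -(unif01_itvNyc r01); apply: ae_le_measure => //.
  apply: aeS (ae_unif01_itv R) => t t01 /=; rewrite in_itv/= rearrE// => tr.
  have fs := in_itv01_has_sup mf t01.
  by rewrite (le_trans (rcdf_qsup_ge mf fs))// rcdf_nd.
Qed.

(** One inequality suffices, the laws being equal. If q(t) < f(t), a level r strictly between them
    has F(r) > t, while monotonicity puts the set where f <= r inside []-oo, t[] up to a null set,
    so that F(r) <= t. *)
Lemma nondecreasing_rearr f : measurable_fun setT f ->
  {in `]0, 1[ &, {homo f : x y / x <= y}} -> {ae P, forall t, f t = rearr f t}.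
Proof.
move=> mf f_nd; apply: same_law_le_ae_eq => //.
- exact: measurable_rearr.
- exact: same_law_rearr.
apply: aeS (ae_unif01_itv R) => t t01; rewrite rearrE//.
have fs := in_itv01_has_sup mf t01.
have t01' : 0 <= t <= 1 by move: t01; rewrite in_itv/= => /andP[/ltW-> /ltW->].
rewrite leNgt; apply/negP => qf.
pose r := (qsup f t + f t) / 2.
have /(qsup_lt fs) : qsup f t < r by rewrite /r; lra.
rewrite ltNge => /negP; apply.
rewrite -lee_fin rcdfE// -(unif01_itvNyo t01'); apply: ae_le_measure => //.
  exact: measurable_le_cst.
apply: aeS (ae_unif01_itv R) => s s01 /=; rewrite in_itv/= => fsr.
rewrite ltNge; apply/negP => /(f_nd _ _ t01 s01) fts.
by move: fsr; rewrite /r; lra.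
Qed.

(* Ties are broken by the position in [0,1], which makes [ranking f] uniformly
   distributed even when the law of [f] has atoms. *)
Definition ranking f (t : RT) : R :=
  fine (P [set s | (f s < f t) || ((f s == f t) && (s <= t))]).

End rearrangement.

(** * The ranking, a uniform variable through which a function factors *)

Section ranking.
Context (R : realType).
Local Notation P := (unif01 R).
Local Notation RT := (measurableTypeR R).
Implicit Types f g : RT -> R.

Lemma measurable_lex f : measurable_fun setT f ->
  measurable [set z : RT * RT | (f z.1 < f z.2) || ((f z.1 == f z.2) && (z.1 <= z.2))].
Proof.
move=> mf.
have m1 : measurable_fun setT (fun z : RT * RT => f z.1) by exact: measurableT_comp.
have m2 : measurable_fun setT (fun z : RT * RT => f z.2) by exact: measurableT_comp.
have m : measurable_fun setT (fun z : RT * RT =>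
    (f z.1 < f z.2) || ((f z.1 == f z.2) && (z.1 <= z.2))).
  apply: measurable_or; first exact: measurable_fun_ltr.
  apply: measurable_and; first exact: measurable_fun_eqr.
  apply: measurable_fun_ler; [exact: measurable_fst|exact: measurable_snd].
by have := m measurableT [set true] I; rewrite setTI.
Qed.

Lemma measurable_lex_section f t : measurable_fun setT f ->
  measurable [set s : RT | (f s < f t) || ((f s == f t) && (s <= t))].
Proof.
move=> mf; have := @measurable_ysection _ _ RT RT _ t (measurable_lex mf).
by congr measurable; apply/seteqP; split => s; rewrite /ysection/= inE.
Qed.

Lemma rankingE f t : measurable_fun setT f ->
  (ranking f t)%:E = P [set s | (f s < f t) || ((f s == f t) && (s <= t))].
Proof. by move=> mf; rewrite fineK// fin_num_measure//; exact: measurable_lex_section. Qed.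

Lemma measurable_ranking f : measurable_fun setT f -> measurable_fun setT (ranking f).
Proof.
move=> mf; apply/measurable_EFinP.
apply: eq_measurable_fun (@measurable_fun_ysection _ _ RT RT R P _ (measurable_lex mf)).
move=> t _ /=; rewrite rankingE//; congr (P _).
by apply/seteqP; split => s; rewrite /ysection/= inE.
Qed.

Lemma ranking_le f t : measurable_fun setT f -> ranking f t <= rcdf f (f t).
Proof.
move=> mf; rewrite -lee_fin rankingE// rcdfE//; apply: le_measure.
- by rewrite inE; exact: measurable_lex_section.
- by rewrite inE; exact: measurable_le_cst.
- by move=> s /= /orP[/ltW//|/andP[/eqP-> _]].
Qed.

Lemma ranking_ge f t : measurable_fun setT f -> (P [set s | (f s < f t)%R] <= (ranking f t)%:E)%E.
Proof.
move=> mf; rewrite rankingE//; apply: le_measure.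
- by rewrite inE; exact: measurable_lt_cst.
- by rewrite inE; exact: measurable_lex_section.
- by move=> s /= ->.
Qed.

(** Otherwise a level r strictly between the two sides would satisfy F(r) <= P(f < f t) <=
    [ranking f t], whereas any level above the quantile has F(r) > [ranking f t]. *)
Lemma le_qsup_ranking f t : measurable_fun setT f -> 0 < ranking f t < 1 ->
  f t <= qsup f (ranking f t).
Proof.
move=> mf V01; have fs := has_sup_rcdf mf V01.
rewrite leNgt; apply/negP => qf.
pose r := (qsup f (ranking f t) + f t) / 2.
have /(qsup_lt fs) : qsup f (ranking f t) < r by rewrite /r; lra.
rewrite ltNge => /negP; apply.
rewrite -lee_fin rcdfE// (le_trans _ (ranking_ge t mf))//; apply: le_measure.
- by rewrite inE; exact: measurable_le_cst.
- by rewrite inE; exact: measurable_lt_cst.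
- by move=> s /= /le_lt_trans; apply; rewrite /r; lra.
Qed.

Section split_level.
Variables (f : RT -> R) (u : R).
Hypothesis mf : measurable_fun setT f.
Hypothesis u01 : 0 < u < 1.
Let c := qsup f u.
Let E := [set s | f s = c].

Let mE : measurable E.
Proof. by have := mf measurableT (measurable_set1 c); rewrite setTI. Qed.

Let phi (w : R) := fine (P (E `&` `]-oo, w]%classic)).

Let phiE w : (phi w)%:E = P (E `&` `]-oo, w]%classic).
Proof. by rewrite fineK// fin_num_measure//; exact: measurableI. Qed.

Let phi_nd : {homo phi : x y / x <= y}.
Proof.
move=> x y xy; rewrite -lee_fin !phiE; apply: le_measure; rewrite ?inE; try exact: measurableI.
by apply: setIS => z /=; rewrite !in_itv/= => /le_trans; apply.
Qed.

Let phi_lip x y : x <= y -> phi y - phi x <= y - x.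
Proof.
move=> xy; rewrite lerBlDr -lee_fin EFinD phiE phiE.
apply: (@le_trans _ _ (P (`]x, y] `|` (E `&` `]-oo, x])))).
  apply: le_measure; rewrite ?inE.
  - exact: measurableI.
  - by apply: measurableU => //; exact: measurableI.
  - move=> z [Ez] /=; rewrite !in_itv/= => zy; case: (leP z x) => xz; [right|left] => //.
apply: (@le_trans _ _ (P `]x, y]%classic + P (E `&` `]-oo, x]))%E).
  by apply: measureU2 => //; exact: measurableI.
rewrite leeD2r// unif01E//.
apply: (@le_trans _ _ (lebesgue_measure (`]x, y]%classic : set R))).
  by apply: le_measure; rewrite ?inE//; apply: measurableI.
by rewrite lebesgue_measure_itv/= lte_fin; case: ifPn => // _; rewrite lee_fin subr_ge0.
Qed.

Let phi_cont : continuous phi.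
Proof.
move=> x; apply/cvgrPdist_le => e e0.
have : \forall y \near x, `|x - y| <= e.
  by move/cvgrPdist_le : (@cvg_id _ (nbhs x)); apply.
apply: filterS => y; apply: le_trans.
case: (leP x y) => [xy|/ltW yx].
  rewrite distrC [leRHS]distrC !ger0_norm ?subr_ge0//; last exact: phi_nd.
  exact: phi_lip.
by rewrite !ger0_norm ?subr_ge0//; [exact: phi_lip|exact: phi_nd].
Qed.

(** The level c satisfies P(f < c) <= u <= P(f <= c). The missing mass is taken from the level set
    [E] of c, from left to right: [phi] is 1-Lipschitz, and the intermediate value theorem yields
    the cutting point w. *)
Lemma exists_split : exists w : R,
  [/\ (0 <= w <= 1)%R & P [set s | (f s < c)%R] + P (E `&` `]-oo, w]%classic) = u%:E]%E.
Proof.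
have fs := has_sup_rcdf mf u01.
have mlt : measurable [set s | f s < c] by exact: measurable_lt_cst.
pose a := fine (P [set s | f s < c]).
have aE : a%:E = P [set s | f s < c] by rewrite fineK// fin_num_measure.
have au : a <= u.
  by rewrite -lee_fin aE; apply: unif01_lt_le => // r; exact: lt_qsup.
have phi0 : phi 0 = 0.
  apply/EFin_inj; rewrite phiE; apply/eqP; rewrite eq_le measure_ge0 andbT.
  apply: (@le_trans _ _ (P `]-oo, 0]%classic)); last by rewrite unif01_itvNyc// lexx ler01.
  by apply: le_measure; rewrite ?inE//; exact: measurableI.
have phi1 : u <= a + phi 1.
  apply: le_trans (rcdf_qsup_ge mf fs) _.
  rewrite -lee_fin rcdfE// EFinD aE phiE -measureU//.
  - apply: ae_le_measure.
    + exact: measurable_le_cst.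
    + by apply: measurableU => //; exact: measurableI.
    + apply: aeS (ae_unif01_itv R) => t; rewrite in_itv/= => /andP[_ t1].
      rewrite le_eqVlt => /orP[/eqP ft|ft]; [right|by left].
      by split=> //=; rewrite in_itv/= ltW.
  - exact: measurableI.
  - by apply/seteqP; split => // t /= [] + [Et _]; rewrite Et ltxx.
have [] := @IVT R phi 0 1 (u - a) ler01.
- exact: continuous_subspaceT.
- have phi10 : 0 <= phi 1 by rewrite -phi0; exact: phi_nd.
  by rewrite phi0 min_l// max_r// subr_ge0 au lerBlDl.
move=> w; rewrite in_itv/= => w01 pw; exists w; split=> //.
by rewrite -aE -phiE -EFinD pw subrKC.
Qed.

(** The set cut out by [exists_split] has mass u. Its points below level c have ranking at most F(f
    t) <= u, and its points at level c have only points of the cut ranked before them. *)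
Lemma unif01_ranking_ge : (u%:E <= P [set t | (ranking f t <= u)%R])%E.
Proof.
have [w [w01 wu]] := exists_split.
have mlt : measurable [set s | f s < c] by exact: measurable_lt_cst.
have mEw x : measurable (E `&` `]-oo, x]%classic) by exact: measurableI.
have dsj x : [set s | f s < c] `&` (E `&` `]-oo, x]%classic) = set0.
  by apply/seteqP; split => // t /= [] + [Et _]; rewrite Et ltxx.
have fs := has_sup_rcdf mf u01.
rewrite -wu -measureU//.
apply: le_measure; rewrite ?inE.
- exact: measurableU.
- by apply: measurable_le_cst; exact: measurable_ranking.
move=> t [/= ftc|[Et tw]] /=.
  by apply: le_trans (ranking_le t mf) _; exact: lt_qsup.
rewrite -lee_fin -wu rankingE// -measureU//; apply: le_measure; rewrite ?inE.
- exact: measurable_lex_section.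
- exact: measurableU.
move=> s /= /orP[fst|/andP[/eqP fst st]]; first by left; rewrite /= -Et.
right; split; first by rewrite /E/= fst.
by move: tw; rewrite /= !in_itv/=; exact: le_trans.
Qed.

(** A point outside the cut of [exists_split] is ranked after all of it, so its ranking is at least
    u. *)
Lemma unif01_ranking_le : (P [set t | (ranking f t < u)%R] <= u%:E)%E.
Proof.
have [w [w01 wu]] := exists_split.
have mlt : measurable [set s | f s < c] by exact: measurable_lt_cst.
have mEw x : measurable (E `&` `]-oo, x]%classic) by exact: measurableI.
have dsj x : [set s | f s < c] `&` (E `&` `]-oo, x]%classic) = set0.
  by apply/seteqP; split => // t /= [] + [Et _]; rewrite Et ltxx.
have fs := has_sup_rcdf mf u01.
rewrite -wu -measureU//.
apply: le_measure; rewrite ?inE.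
- by apply: measurable_lt_cst; exact: measurable_ranking.
- exact: measurableU.
move=> t /= Vu; case: (ltgtP (f t) c) => [ftc|ftc|Et]; first by left.
- exfalso; pose r := (c + f t) / 2.
  have /(qsup_lt fs) : c < r by rewrite /r; lra.
  apply/negP; rewrite -leNgt; apply/ltW/(le_lt_trans _ Vu).
  rewrite -lee_fin rcdfE//; apply: le_trans _ (ranking_ge t mf).
  apply: le_measure; rewrite ?inE; [exact: measurable_le_cst|exact: measurable_lt_cst|].
  by move=> s /= /le_lt_trans; apply; rewrite /r; lra.
- right; split=> //; rewrite /= in_itv/= leNgt; apply/negP => wt.
  move: Vu; apply/negP; rewrite -leNgt -lee_fin -wu rankingE// -measureU//.
  apply: le_measure; rewrite ?inE; [exact: measurableU|exact: measurable_lex_section|].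
  move=> s [/= sc|[Es sw]] /=; first by rewrite Et sc.
  rewrite Es Et eqxx ltxx/=; move: sw; rewrite /= in_itv/= => /le_trans; apply; exact: ltW.
Qed.

End split_level.

End ranking.

Section uniform_ranking.
Context (R : realType).
Local Notation P := (unif01 R).
Local Notation RT := (measurableTypeR R).
Implicit Types f g : RT -> R.

(** The upper bound [unif01_ranking_le] concerns the strict inequality; applied at r + e with e
    tending to 0, it meets the lower bound at r. *)
Lemma same_law_ranking f : measurable_fun setT f -> same_law (ranking f) id.
Proof.
move=> mf; have mV := measurable_ranking mf.
have V0 t : 0 <= ranking f t by rewrite /ranking fine_ge0.
have V1 t : ranking f t <= 1 by rewrite (le_trans (ranking_le t mf))// rcdf_le1.
have mle r := measurable_le_cst r mV.
have idE r : [set t : RT | t <= r] = `]-oo, r]%classic.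
  by apply/seteqP; split => t /=; rewrite in_itv.
have le r : 0 <= r < 1 -> (P [set t | (ranking f t <= r)%R] <= r%:E)%E.
  move=> /andP[r0 r1]; apply/lee_addgt0Pr => e e0.
  have [re1|re1] := ltP (r + e) 1; last by rewrite (le_trans (probability_le1 _ (mle r)))// lee_fin.
  have re01 : 0 < r + e < 1 by rewrite ltr_wpDl.
  apply: le_trans (unif01_ranking_le mf re01).
  apply: le_measure; rewrite ?inE//; first exact: measurable_lt_cst.
  by move=> t /= /le_lt_trans; apply; rewrite ltrDl.
apply: same_law_cdf => // r; rewrite idE.
have [r0|r0] := ltP r 0.
  rewrite [X in P X](_ : _ = set0); last first.
    by apply/seteqP; split => // t /= /(le_trans (V0 t)); rewrite leNgt r0.
  apply/esym/eqP; rewrite measure0 eq_le measure_ge0 andbT.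
  apply: (@le_trans _ _ (P `]-oo, 0]%classic)); last by rewrite unif01_itvNyc// lexx ler01.
  by apply: le_measure; rewrite ?inE// => z /=; rewrite !in_itv/= => /le_trans; apply; exact: ltW.
have [r1|r1] := leP 1 r.
  rewrite [X in P X](_ : _ = setT); last first.
    by apply/seteqP; split => // t _ /=; exact: le_trans r1.
  rewrite probability_setT; apply/esym/eqP; rewrite eq_le probability_le1//=.
  apply: (@le_trans _ _ (P `]-oo, 1]%classic)); first by rewrite unif01_itvNyc// lexx ler01.
  by apply: le_measure; rewrite ?inE// => z /=; rewrite !in_itv/= => /le_trans; apply.
rewrite unif01_itvNyc ?r0 ?ltW//; apply/eqP; rewrite eq_le le ?r0//=.
have [->|rn0] := eqVneq r 0; first by rewrite (measure_ge0 P).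
by apply: unif01_ranking_ge => //; rewrite r1 lt_neqAle eq_sym rn0 r0.
Qed.

Lemma ae_ranking01 f : measurable_fun setT f -> {ae P, forall t, ranking f t \in `]0, 1[}.
Proof.
move=> mf; apply: (@ae_same_law _ id (ranking f) (fun x => x \in `]0, 1[)) => //.
- exact: measurable_ranking.
- by move=> B mB; rewrite same_law_ranking.
- exact: (measurable_itv `]0, 1[).
- exact: ae_unif01_itv.
Qed.

(** [le_qsup_ranking] gives one inequality; both sides have the law of [f], so it is an equality
    a.e. *)
Lemma rearr_ranking f : measurable_fun setT f ->
  {ae P, forall t, f t = rearr f (ranking f t)}.
Proof.
move=> mf; have mV := measurable_ranking mf; have mq := measurable_rearr mf.
apply: same_law_le_ae_eq => //.
- exact: (measurableT_comp (mq : measurable_fun setT (_ : RT -> R))).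
- move=> B mB; rewrite same_law_rearr//.
  have mqB : measurable (rearr f @^-1` B) by have := mq measurableT B mB; rewrite setTI.
  exact/esym/(same_law_ranking mf mqB).
- apply: aeS (ae_ranking01 mf) => t V01; rewrite rearrE//.
  by apply: le_qsup_ranking => //; rewrite -in_itv.
Qed.

Lemma Rintegral_same_law f g (h : RT -> R) : measurable_fun setT f ->
  measurable_fun setT g -> same_law f g -> measurable_fun setT h ->
  \int[P]_t h (f t) = \int[P]_t h (g t).
Proof.
move=> mf mg fg mh; congr fine.
by apply: (integral_same_law mf mg fg (h := EFin \o h)); exact/measurable_EFinP.
Qed.

Lemma integrable_same_law f g (h : RT -> R) : measurable_fun setT f ->
  measurable_fun setT g -> same_law f g -> measurable_fun setT h ->
  P.-integrable setT (EFin \o (h \o f)) -> P.-integrable setT (EFin \o (h \o g)).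
Proof.
move=> mf mg fg mh /integrableP[_ hf]; apply/integrableP; split.
  by apply/measurable_EFinP; exact: measurableT_comp.
rewrite -(integral_same_law mf mg fg (h := fun x => `|(h x)%:E|%E))//.
by apply: measurableT_comp => //; exact/measurable_EFinP.
Qed.

Lemma integrable_indicM (A : set RT) g : measurable A ->
  P.-integrable setT (EFin \o g) -> P.-integrable setT (fun t => (\1_A t * g t)%:E).
Proof.
move=> mA ig; have /measurable_EFinP mg := measurable_int _ ig.
apply: le_integrable ig => //.
  by apply/measurable_EFinP; exact: measurable_funM.
move=> t _ /=; rewrite lee_fin normrM ler_piMl// indicE.
by case: (_ \in _); rewrite ?normr1// normr0.
Qed.

Lemma Rintegral_indic (A : set RT) : measurable A -> (\int[P]_t \1_A t)%:E = P A.
Proof.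
by move=> mA; rewrite /Rintegral integral_indic// setIT fineK// fin_num_measure.
Qed.

(** Bathtub principle. Write g as q o V with V uniform. Both sets have mass 1 - u, so subtracting
    the constant c = q(u) shifts both integrals equally; then q(V) - c is nonnegative where V >= u
    and nonpositive elsewhere, and the comparison is pointwise. *)
Lemma indic_le_rearr (E : set RT) g (u : R) : measurable E -> 0 <= u <= 1 ->
  P E = (1 - u)%:E -> P.-integrable setT (EFin \o g) ->
  \int[P]_t (\1_E t * g t) <= \int[P]_t (\1_(`[u, +oo[%classic) t * rearr g t).
Proof.
move=> mE u01 PE ig; have /measurable_EFinP mg := measurable_int _ ig.
have mV := measurable_ranking mg; have mq := measurable_rearr mg.
pose U : set RT := `[u, +oo[%classic; pose q := rearr g; pose V := ranking g.
have mqV : measurable_fun setT (q \o V).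
  exact: (measurableT_comp (mq : measurable_fun setT (_ : RT -> R))).
have mU : measurable_fun setT (\1_U : RT -> R) by apply: measurable_indic; exact: measurable_itv.
have mUV : measurable (V @^-1` U).
  by have := mV measurableT U (measurable_itv _); rewrite setTI.
have UVE t : \1_U (V t) = \1_(V @^-1` U) t :> R by [].
have iqV : P.-integrable setT (EFin \o (q \o V)).
  apply: (integrable_same_law (f := id) (g := V) (h := q)) => //.
    by move=> B mB; rewrite same_law_ranking.
  apply: (integrable_same_law (f := g) (g := q) (h := id)) => //.
  exact: same_law_rearr.
have PU : P (V @^-1` U) = (1 - u)%:E.
  have -> : P (V @^-1` U) = P U by apply: (same_law_ranking mg); exact: measurable_itv.
  have -> : U = ~` `]-oo, u[%classic.
    by apply/seteqP; split => z; rewrite /U/= !in_itv/= andbT leNgt => /negP.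
  by rewrite probability_setC// unif01_itvNyo.
rewrite -[leRHS](Rintegral_same_law (f := V) (g := id) (h := fun x => \1_U x * q x))//; last 2 first.
- exact: same_law_ranking.
- by apply: measurable_funM.
rewrite [leLHS](@ae_eq_Rintegral _ _ _ P _ (fun t => \1_E t * (q \o V) t)); last 3 first.
- by apply: measurable_funM => //; exact: measurable_indic.
- by apply: measurable_funM => //; exact: measurable_indic.
- by apply: aeS (rearr_ranking mg) => t ->.
pose c := q u.
have cI (A : set RT) : measurable A -> P A = (1 - u)%:E ->
    \int[P]_t (\1_A t * (q \o V) t) = \int[P]_t (\1_A t * ((q \o V) t - c)) + (1 - u) * c.
  move=> mA PA; under [in RHS]eq_Rintegral do rewrite mulrBr.
  rewrite RintegralB//; last 2 first.
  - exact: integrable_indicM.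
  - by apply: integrable_indicM => //; exact: (@finite_measure_integrable_cst _ _ _ P setT c).
  rewrite RintegralZr//; last exact: integrable_indic.
  have -> : \int[P]_t \1_A t = 1 - u.
    by apply/EFin_inj; rewrite Rintegral_indic.
  by rewrite subrK.
rewrite cI// [leRHS](cI (V @^-1` U))// lerD2r.
have icqV : P.-integrable setT (EFin \o (fun t => (q \o V) t - c)).
  exact: (integrableB measurableT iqV (@finite_measure_integrable_cst _ _ _ P setT c measurableT)).
apply: ae_le_Rintegral.
- exact: integrable_indicM.
- exact: integrable_indicM.
(* At u = 0 and u = 1 the value c is the default 0 of [rearr] and cannot be compared with q(V); but
   there both sets are of full measure, or both null. *)
have ae01 : u = 0 \/ u = 1 -> {ae P, forall t, \1_E t = \1_(V @^-1` U) t :> R}.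
  move=> []u0; move: PE PU; rewrite u0 ?subr0 ?subrr => PE PU.
  - have aeA (A : set RT) : measurable A -> P A = 1%:E -> {ae P, forall t, A t}.
      move=> mA PA; exists (~` A); split => //; first exact: measurableC.
      by rewrite probability_setC// PA subee.
    apply: aeS (aeI (aeA _ mE PE) (aeA _ mUV PU)) => t [Et Vt].
    by rewrite !indicE !mem_set.
  - have aeA (A : set RT) : measurable A -> P A = 0%:E -> {ae P, forall t, ~ A t}.
      by move=> mA PA; exists A; split => //; move=> t /= /contrapT.
    apply: aeS (aeI (aeA _ mE PE) (aeA _ mUV PU)) => t [Et Vt].
    by rewrite !indicE !memNset.
have [/ae01|] := pselect (u = 0 \/ u = 1); first by apply: aeS => t ->.
move=> /not_orP[/eqP u0 /eqP u1].
have u01' : u \in `]0, 1[.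
  by rewrite in_itv/= !lt_neqAle eq_sym u0 u1; move: u01 => /andP[-> ->].
apply: aeS (ae_ranking01 mg) => t V01 /=.
rewrite -UVE !indicE; case: (leP u (V t)) => uV.
  have -> : (V t \in U) = true by rewrite mem_set//= /U/= in_itv/= andbT.
  rewrite mul1r ler_piMl//; first by rewrite subr_ge0; exact: rearr_nd.
  by case: (_ \in _); rewrite ?ler01.
have -> : (V t \in U) = false by apply/negbTE; rewrite notin_setE/= /U/= in_itv/= andbT; apply/negP; rewrite -ltNge.
rewrite mul0r mulr_ge0_le0//.
by rewrite subr_le0; apply: rearr_nd => //; exact: ltW.
Qed.

End uniform_ranking.

(** * The Hardy-Littlewood inequality by layer cake *)

Section hardy_littlewood.
Context (R : realType).
Local Notation P := (unif01 R).
Local Notation mu := (@lebesgue_measure R).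
Local Notation RT := (measurableTypeR R).
Implicit Types f g : RT -> R.

Lemma eq_indic (T U : Type) (A : set T) (B : set U) x y : (A x <-> B y) ->
  \1_A x = \1_B y :> R.
Proof.
move=> AB; rewrite !indicE; have [Ax|nAx] := pselect (A x).
  by rewrite !mem_set//; exact/AB.
by rewrite !memNset// => /AB.
Qed.

Lemma measurable_gt_cst f r : measurable_fun setT f -> measurable [set t | r < f t].
Proof.
move=> mf; have := measurableC (measurable_le_cst r mf).
by congr measurable; apply/seteqP; split=> x /=; rewrite ltNge => /negP.
Qed.

(** Integrating the first variable out gives [f t * g t] when [f t] is nonnegative. As g may change
    sign, Fubini and not only Tonelli is applied to it. *)
Definition layer f g (z : RT * RT) : R :=
  \1_[set z : RT * RT | (0 <= z.1) && (z.1 < f z.2)] z * g z.2.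

Lemma measurable_layer f g : measurable_fun setT f -> measurable_fun setT g ->
  measurable_fun setT (layer f g).
Proof.
move=> mf mg; apply: measurable_funM.
  apply: measurable_indic.
  have m : measurable_fun setT (fun z : RT * RT => (0 <= z.1) && (z.1 < f z.2)).
    apply: measurable_and.
      by apply: measurable_fun_ler; [exact: measurable_cst|exact: measurable_fst].
    apply: measurable_fun_ltr; first exact: measurable_fst.
    by apply: measurableT_comp => //; exact: measurable_snd.
  by have := m measurableT [set true] I; rewrite setTI.
by apply: measurableT_comp => //; exact: measurable_snd.
Qed.

Lemma integral_layer f g t : 0 <= f t ->
  (\int[mu]_s (layer f g (s, t))%:E = (f t * g t)%:E)%E.
Proof.
move=> f0.
under eq_integral => s _.
  rewrite (_ : layer f g (s, t) = g t * \1_(`[0%R, f t[%classic) s); last first.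
    rewrite /layer [RHS]mulrC; congr (_ * _); exact: eq_indic.
  rewrite EFinM; over.
rewrite integralZl//; last exact: integrable_indic_itv.
rewrite integral_indic// setIT /= lebesgue_measure_itv/= lte_fin.
rewrite mulrC EFinM; congr (_ * _)%E.
by case: ltgtP f0 => // [_|<-] _; rewrite ?oppr0 ?adde0// oppe0 adde0.
Qed.

Lemma integrable_layer f g : measurable_fun setT f -> measurable_fun setT g ->
  (forall t, 0 <= f t) -> P.-integrable setT (fun t => (f t * g t)%:E) ->
  (mu \x P)%E.-integrable setT (EFin \o layer f g).
Proof.
move=> mf mg f0 /integrableP[_ fg].
apply/integrable21ltyP.
  by apply/measurable_EFinP; exact: measurable_layer.
apply: le_lt_trans fg; apply: ge0_le_integral => //.
- by move=> t _; exact: integral_ge0.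
- apply: (measurable_fun_fubini_tonelli_G (abse \o (EFin \o layer f g))) => //.
  apply: measurableT_comp => //.
  by apply/measurable_EFinP; exact: measurable_layer.
- by move=> z; exact: abse_ge0.
- apply: measurableT_comp => //; apply/measurable_EFinP.
  exact: measurable_funM.
move=> t _; rewrite le_eqVlt; apply/orP; left; apply/eqP.
transitivity (\int[mu]_s (layer f (Num.norm \o g) (s, t))%:E)%E.
  apply: eq_integral => s _ /=; congr EFin; rewrite /layer normrM; congr (_ * _).
  by rewrite ger0_norm.
by rewrite integral_layer// /= normrM ger0_norm.
Qed.

Lemma layer_cake f g : measurable_fun setT f -> measurable_fun setT g ->
  (forall t, 0 <= f t) -> P.-integrable setT (fun t => (f t * g t)%:E) ->
  (\int[P]_t (f t * g t)%:E = \int[mu]_s \int[P]_t (layer f g (s, t))%:E)%E.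
Proof.
move=> mf mg f0 fg.
rewrite (Fubini (integrable_layer mf mg f0 fg)).
by apply: eq_integral => t _; rewrite integral_layer.
Qed.

Lemma eq_rearr f g : same_law f g -> rearr f = rearr g.
Proof.
move=> fg; have E : rcdf f = rcdf g.
  apply/funext => r; rewrite /rcdf; congr fine.
  have := fg `]-oo, r]%classic (measurable_itv _).
  by congr (P _ = P _); apply/seteqP; split => t /=; rewrite in_itv.
by rewrite /rearr; congr (_ \_ _); apply/funext => u; rewrite /qsup E.
Qed.

Lemma ae_eq_same_law f g : measurable_fun setT f -> measurable_fun setT g ->
  {ae P, forall t, f t = g t} -> same_law f g.
Proof.
move=> mf mg fg B mB.
have mfB : measurable (f @^-1` B) by rewrite -[X in measurable X]setTI; exact: mf.
have mgB : measurable (g @^-1` B) by rewrite -[X in measurable X]setTI; exact: mg.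
apply/eqP; rewrite eq_le; apply/andP; split; apply: ae_le_measure => //;
  by apply: aeS fg => t /=; rewrite /preimage/= => ->.
Qed.

Lemma qsup_ge0 f t : measurable_fun setT f -> (forall t, 0 <= f t) ->
  has_sup [set r | rcdf f r <= t] -> 0 <= t -> 0 <= qsup f t.
Proof.
move=> mf f0 fs t0; rewrite leNgt; apply/negP => q0.
have /(qsup_lt fs) : qsup f t < qsup f t / 2 by lra.
rewrite /rcdf (_ : [set _ | _] = set0) ?measure0 ?ltNge ?t0//.
by apply/seteqP; split => // x /= /(le_trans (f0 x)); lra.
Qed.

Lemma rearr_ge0 f t : measurable_fun setT f -> (forall t, 0 <= f t) -> 0 <= rearr f t.
Proof.
move=> mf f0; rewrite /rearr patchE; case: ifPn => // /set_mem t01.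
apply: qsup_ge0 => //; first exact: in_itv01_has_sup.
by move: t01; rewrite /= in_itv/= => /andP[/ltW].
Qed.

(** For each height s the claim is [indic_le_rearr] for the set where f > s, with u = F(s): on the
    rearranged side the layer where [rearr f] exceeds s agrees in []0, 1[] with [[F(s), +oo[],
    except possibly at t = F(s). *)
Let hl_ge0 f g : measurable_fun setT f -> measurable_fun setT g ->
  (forall t, 0 <= f t) -> P.-integrable setT (EFin \o g) ->
  P.-integrable setT (fun t => (f t * g t)%:E) ->
  P.-integrable setT (fun t => (rearr f t * rearr g t)%:E) ->
  \int[P]_t (f t * g t) <= \int[P]_t (rearr f t * rearr g t).
Proof.
move=> mf mg f0 ig fg rfg.
have mrf := measurable_rearr mf; have mrg := measurable_rearr mg.
have rf0 t := rearr_ge0 t mf f0.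
rewrite fine_le//; [exact: integrable_fin_num|exact: integrable_fin_num|].
rewrite layer_cake// layer_cake//.
apply: le_integral => //.
- exact: (integrable_fubini_F (integrable_layer mf mg f0 fg)).
- exact: (integrable_fubini_F (integrable_layer mrf mrg rf0 rfg)).
move=> s _; have [s0|s0] := ltP s 0.
  by rewrite !integral0_eq// => t _; rewrite /layer indicE memNset ?mul0r//=;
    rewrite leNgt s0.
have layerE k h : (fun t => (layer k h (s, t))%:E) =
    (fun t => (\1_[set t | s < k t] t * h t)%:E).
  apply/funext => t; rewrite /layer; congr ((_ * _)%:E); apply: eq_indic.
  by rewrite /= s0.
rewrite !layerE.
have irg : P.-integrable setT (EFin \o rearr g).
  by apply: (integrable_same_law (f := g) (h := id)) => //; exact: same_law_rearr.
have m1 := measurable_gt_cst s mf; have m2 := measurable_gt_cst s mrf.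
have u01 : 0 <= rcdf f s <= 1 by rewrite rcdf_ge0 rcdf_le1.
have Pf : P [set t | s < f t] = (1 - rcdf f s)%:E.
  rewrite EFinB rcdfE// -probability_setC; last exact: measurable_le_cst.
  by congr (P _); apply/seteqP; split => t /=; rewrite ltNge => /negP.
rewrite -[leLHS]fineK; last by apply: integrable_fin_num => //; exact: integrable_indicM.
rewrite -[leRHS]fineK; last by apply: integrable_fin_num => //; exact: integrable_indicM.
rewrite lee_fin; apply: le_trans (indic_le_rearr m1 u01 Pf ig) _.
rewrite le_eqVlt; apply/orP; left; apply/eqP; apply: ae_eq_Rintegral.
- by apply: measurable_funM => //; apply: measurable_indic; exact: measurable_itv.
- by apply: measurable_funM => //; exact: measurable_indic.
have ae_neq : {ae P, forall t, t <> rcdf f s}.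
  exists [set rcdf f s]; split; first exact: measurable_set1.
  - rewrite unif01E; last exact: measurable_set1.
    apply/eqP; rewrite eq_le measure_ge0 andbT.
    rewrite -(lebesgue_measure_set1 (rcdf f s)); apply: le_measure; rewrite ?inE.
    + by apply: measurableI => //; exact: measurable_set1.
    + exact: measurable_set1.
    + exact: subIsetl.
  - by move=> t /= /contrapT.
apply: aeS (aeI ae_neq (ae_unif01_itv R)) => t [tn t01].
congr (_ * _); apply: eq_indic.
have fs := in_itv01_has_sup mf t01.
rewrite /= in_itv/= andbT rearrE//; split => h.
  rewrite ltNge; apply/negP => qs.
  have := le_trans (rcdf_qsup_ge mf fs) (rcdf_nd mf qs).
  by move=> h'; apply: tn; apply/eqP; rewrite eq_le h h'.
exact: lt_qsup.
Qed.

(** Truncating f at 0 makes it nonnegative everywhere; this is an a.e. equality, so neither the law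
    nor [rearr f] changes. *)
Theorem hardy_littlewood f g : measurable_fun setT f -> measurable_fun setT g ->
  {ae P, forall t, 0 <= f t} -> P.-integrable setT (EFin \o g) ->
  P.-integrable setT (fun t => (f t * g t)%:E) ->
  P.-integrable setT (fun t => (rearr f t * rearr g t)%:E) ->
  \int[P]_t (f t * g t) <= \int[P]_t (rearr f t * rearr g t).
Proof.
move=> mf mg f0 ig fg rfg.
pose f' t := Num.max (f t) 0.
have mf' : measurable_fun setT f' by exact: measurable_maxr.
have ff' : {ae P, forall t, f t = f' t} by apply: aeS f0 => t f0; rewrite /f' max_l.
have rE : rearr f = rearr f' by apply: eq_rearr; exact: ae_eq_same_law.
have ae_ff' : {ae P, forall t, f t * g t = f' t * g t} by apply: aeS ff' => t ->.
rewrite (ae_eq_Rintegral _ _ ae_ff'); last 2 first.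
- exact: measurable_funM.
- exact: measurable_funM.
rewrite rE; apply: hl_ge0 => //; last by rewrite -rE.
- by move=> t; rewrite /f' le_max lexx orbT.
- apply: le_integrable fg => //.
    by apply/measurable_EFinP; exact: measurable_funM.
  move=> t _ /=; rewrite lee_fin !normrM ler_wpM2r//.
  by rewrite /f'; case: (leP 0 (f t)) => h; rewrite ?normr0.
Qed.

End hardy_littlewood.

(** * Classes of functions and their pairing *)

Section Lspace_unif01.
Context (R : realType) (q : \bar R) (q1 : (1 <= q)%E).
Local Notation P := (unif01 R).
Local Notation RT := (measurableTypeR R).
Implicit Types f g : RT -> R.

Lemma measurable_Lspace (X : LspaceType P q1) : measurable_fun setT (X : RT -> R).
Proof. exact: (measurable_funP (repr (X : aeEqMfun _ P))). Qed.

Lemma finite_norm_Lspace (X : LspaceType P q1) : finite_norm P q (X : RT -> R).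
Proof. exact: Lebesgue_finite. Qed.

Lemma ae_eq_finite_norm f g : measurable_fun setT f -> measurable_fun setT g ->
  {ae P, forall t, f t = g t} -> finite_norm P q f -> finite_norm P q g.
Proof.
move=> mf mg fg; apply: finite_norm_same_law => //; exact: ae_eq_same_law.
Qed.

Lemma exists_Lspace f : measurable_fun setT f -> finite_norm P q f ->
  exists X : LspaceType P q1, {ae P, forall t, X t = f t}.
Proof.
move=> mf ff.
have mf' : measurable_fun setT (f : RT -> RT) by exact: mf.
pose F : {mfun RT >-> RT} := mfun_Sub (mem_set mf' : (f : RT -> RT) \in mfun).
pose X : aeEqMfun RT P := (\pi_(aeEqMfun RT P) F)%qT.
have XF : {ae P, forall t, (X : RT -> R) t = f t}.
  have /eqmodP/asboolP : (repr X = F %[mod (aeEqMfun RT P)])%qT by rewrite reprK.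
  by apply: aeS => t /(_ I).
have nX : finite_norm P q X.
  apply: (ae_eq_finite_norm mf _ _ ff) => //.
    exact: (measurable_funP (repr X)).
  by apply: aeS XF => t ->.
pose m := isFinLebesgue.Build _ _ _ P q q1 X nX.
pose Y : LspaceType P q1 := HB.pack X m.
by exists Y.
Qed.

Lemma Lspace_ae_eq (X Y : LspaceType P q1) : {ae P, forall t, X t = Y t} -> X = Y.
Proof.
move=> XY; case: X Y XY => [x [[xn]]] [y [[yn]]] /= XY.
have xy : x = y.
  rewrite -[x]reprK -[y]reprK; apply/eqmodP/asboolP.
  by apply: aeS XY => t Xt _.
by subst y; rewrite (Prop_irrelevance xn yn).
Qed.

Lemma finite_norm_lin f g (a b : R) : measurable_fun setT f -> measurable_fun setT g ->
  finite_norm P q f -> finite_norm P q g -> finite_norm P q (fun t => a * f t + b * g t).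
Proof.
move=> mf mg ff fg.
have Lf : f \in Lfun P q by apply/andP; rewrite !inE.
have Lg : g \in Lfun P q by apply/andP; rewrite !inE.
have : (a *: f + b *: g : RT -> R) \in Lfun P q.
  by rewrite rpredD// rpredZ.
by move=> /andP[_]; rewrite inE.
Qed.

Lemma finite_norm_bounded f (M : R) : measurable_fun setT f ->
  {ae P, forall t, `|f t| <= M} -> finite_norm P q f.
Proof.
move=> mf fM.
suff : f \in Lfun P +oo%E.
  move=> /(@Lfun_subset _ _ _ P q +oo%E q1 (leey 1)) => /(_ _ (leey _)).
  by move=> /(_ (fin_num_measure _ _ measurableT)) /andP[_]; rewrite inE.
apply/andP; rewrite !inE; split=> //=; rewrite /finite_norm unlock /Lnorm.
case: ifPn => // _; apply: le_lt_trans (ltry M).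
by apply/ess_supP; apply: aeS fM => t; rewrite lee_fin.
Qed.

Lemma finite_norm_integrable f : measurable_fun setT f -> finite_norm P q f ->
  P.-integrable setT (EFin \o f).
Proof.
move=> mf ff; have Lf : f \in Lfun P q by apply/andP; rewrite !inE.
have := @Lfun_subset _ _ _ P 1 q (lexx _) q1 (fin_num_measure _ _ measurableT) q1 f Lf.
by rewrite Lfun1_integrable.
Qed.

End Lspace_unif01.

Section hoelder_unif01.
Context (R : realType) (p : R) (p1 : (1 <= p%:E)%E).
Local Notation P := (unif01 R).
Local Notation RT := (measurableTypeR R).
Implicit Types f g : RT -> R.

Lemma integrable_conj f g : measurable_fun setT f -> measurable_fun setT g ->
  finite_norm P (hoelder_conjugate p%:E) f -> finite_norm P p%:E g ->
  P.-integrable setT (fun t => (f t * g t)%:E).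
Proof.
move=> mf mg ff fg.
have mfg : measurable_fun setT (fun t => f t * g t) by exact: measurable_funM.
apply/integrableP; split; first exact/measurable_EFinP.
(* For p = 1 the conjugate exponent is +oo and the essential bound of f is used directly; otherwise
   it is p / (p - 1) and Hoelder's inequality applies. *)
have [pE|p_neq1] := eqVneq p 1.
  move: ff; rewrite pE hoelder_conjugate1 /finite_norm unlock /Lnorm.
  case: ifPn => [_|]; last first.
    by move=> /negP[]; apply: (lt_le_trans lte01); rewrite -(probability_setT P).
  move=> /ess_supr_bounded[M fM].
  have ig : P.-integrable setT (EFin \o g) by exact: (finite_norm_integrable p1 mg fg).
  have /integrableP[mM] := integrableZl measurableT `|M| (integrable_abse ig).
  apply: le_lt_trans; apply: ae_ge0_le_integral => //.
  - by apply: measurableT_comp => //; exact/measurable_EFinP.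
  - exact: measurableT_comp.
  - apply: aeS fM => t {}fM _; rewrite /= lee_fin !normrM !normr_id ler_wpM2r//.
    by rewrite (le_trans fM)// ler_norm.
have p_gt1 : 1 < p by rewrite lt_neqAle eq_sym p_neq1 -lee_fin.
have p0 : 0 < p by rewrite (lt_trans ltr01).
have pq : hoelder_conjugate p%:E = (p / (p - 1))%:E.
  rewrite /hoelder_conjugate/= eqe gt_eqF// -EFinB inver subr_eq0 gt_eqF//.
rewrite pq in ff.
have := @hoelder _ _ _ P f g (p / (p - 1)) p mf mg.
rewrite Lnorm1 => H; apply: le_lt_trans (H _ _ _) _ => //.
- by rewrite divr_gt0// subr_gt0.
- have p10 : p - 1 != 0 by rewrite subr_eq0.
  by field; rewrite p10 gt_eqF.
- by rewrite lte_mul_pinfty ?Lnorm_ge0// ge0_fin_numE ?Lnorm_ge0.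
Qed.

End hoelder_unif01.

(** * Convergence in the weak topologies, tested coordinate by coordinate *)

Section initial_topology_lemmas.
Context (R : realType).

Lemma cvg_initial_ptws (S : choiceType) (U : choiceType) (h : S -> {ptws U -> R})
    (F : set_system (initial_topology h)) (s : initial_topology h) : Filter F ->
  (forall u, h x u @[x --> F] --> h s u) -> F --> s.
Proof.
move=> FF Hu A; rewrite nbhsE => -[B [[C oC <-] Cs] BA].
have hF : h @ F --> (h s : {ptws U -> R}).
  apply/cvg_sup => u D /=; rewrite (@nbhsE (initial_topology _)).
  move=> [E [[G oG <-] Gs] ED]; apply: (filterS ED).
  by apply: (Hu u); apply: open_nbhs_nbhs; split.
apply: (filterS BA); apply: (hF C).
by apply: open_nbhs_nbhs; split.
Qed.

Lemma initial_ptws_continuous (S : choiceType) (U : choiceType)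
    (h : S -> {ptws U -> R}) (u : U) :
  continuous (fun x : initial_topology h => h x u).
Proof.
move=> x.
apply: (@continuous_comp (initial_topology h) {ptws U -> R} R h (@proj U (fun=> R) u) x).
- exact: initial_continuous.
- exact: (@proj_continuous U (fun=> R) u (h x)).
Qed.

End initial_topology_lemmas.

Section spaces.
Context (R : realType) (p : R) (p1 : (1 <= p%:E)%E).
Local Notation P := (unif01 R).
Local Notation RT := (measurableTypeR R).
Local Notation pstar := (hoelder_conjugate p%:E).
Implicit Types (f g : RT -> R) (X Y W : Zspace p1) (z : Zdual p1).

Lemma continuous_pairing X : continuous (fun z : Zdual p1 => pairing z X).
Proof. exact: (@initial_ptws_continuous R (Zdual p1) (Zspace p1) (@pairing R p p1) X). Qed.

Lemma cvg_Pspace (F : set_system (Pspace R)) (m : Pspace R) : Filter F ->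
  (forall f : C01 R, Pintegral x f @[x --> F] --> Pintegral m f) -> F --> m.
Proof. exact: (@cvg_initial_ptws R (Pspace R) (C01 R) (@Pintegral R) F m). Qed.

Lemma measurable_Zspace X : measurable_fun setT (X : RT -> R).
Proof. exact: (measurable_Lspace (q1 := p1)). Qed.

Lemma measurable_Zdual z : measurable_fun setT (z : RT -> R).
Proof. exact: (measurable_Lspace (q1 := hoelder_conj_ge1 p1)). Qed.

Lemma finite_norm_Zspace X : finite_norm P p%:E (X : RT -> R).
Proof. exact: (finite_norm_Lspace (q1 := p1)). Qed.

Lemma finite_norm_Zdual z : finite_norm P pstar (z : RT -> R).
Proof. exact: (finite_norm_Lspace (q1 := hoelder_conj_ge1 p1)). Qed.

Lemma exists_Zspace f : measurable_fun setT f -> finite_norm P p%:E f ->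
  exists X : Zspace p1, {ae P, forall t, X t = f t}.
Proof. exact: (exists_Lspace p1). Qed.

Lemma exists_Zdual f : measurable_fun setT f -> finite_norm P pstar f ->
  exists z : Zdual p1, {ae P, forall t, z t = f t}.
Proof. exact: (exists_Lspace (hoelder_conj_ge1 p1)). Qed.

Lemma Zdual_ae_eq z z' : {ae P, forall t, z t = z' t} -> z = z'.
Proof. exact: (Lspace_ae_eq (q1 := hoelder_conj_ge1 p1)). Qed.

Lemma integrable_Zspace X : P.-integrable setT (fun t => (X t)%:E).
Proof.
exact: (finite_norm_integrable p1 (measurable_Zspace X) (finite_norm_Zspace X)).
Qed.

Lemma integrable_Zdual z : P.-integrable setT (fun t => (z t)%:E).
Proof.
exact: (finite_norm_integrable (hoelder_conj_ge1 p1) (measurable_Zdual z) (finite_norm_Zdual z)).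
Qed.

Lemma integrable_pairing z X : P.-integrable setT (fun t => (z t * X t)%:E).
Proof.
exact: (integrable_conj p1 (measurable_Zdual z) (measurable_Zspace X)
  (finite_norm_Zdual z) (finite_norm_Zspace X)).
Qed.

Lemma pairingE z X : pairing z X = \int[P]_t (z t * X t).
Proof.
congr fine; apply/esym; apply: (integral_unif01 (f := fun t => (z t * X t)%:E)).
by have := measurable_int _ (integrable_pairing z X).
Qed.

Lemma pairing_ae z X f g : measurable_fun setT f -> measurable_fun setT g ->
  {ae P, forall t, z t = f t} -> {ae P, forall t, X t = g t} ->
  pairing z X = \int[P]_t (f t * g t).
Proof.
move=> mf mg zf Xg; rewrite pairingE; apply: ae_eq_Rintegral.
- by apply: measurable_funM; [exact: measurable_Zdual|exact: measurable_Zspace].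
- exact: measurable_funM.
- by apply: aeS (aeI zf Xg) => t [-> ->].
Qed.

Lemma pairing_linr z X Y W (a b : R) :
  {ae P, forall t, W t = a * X t + b * Y t} ->
  pairing z W = a * pairing z X + b * pairing z Y.
Proof.
move=> WE; rewrite !pairingE -!RintegralZl//; [|exact: integrable_pairing..].
rewrite -RintegralD//; last 2 first.
- exact: (integrableZl measurableT a (integrable_pairing z X)).
- exact: (integrableZl measurableT b (integrable_pairing z Y)).
have mz := measurable_Zdual z; have mX := measurable_Zspace X.
have mY := measurable_Zspace Y; have mW := measurable_Zspace W.
apply: ae_eq_Rintegral.
- exact: measurable_funM.
- by apply: measurable_funD; apply: measurable_funM => //; exact: measurable_funM.
- by apply: aeS WE => t ->; ring.
Qed.

Lemma pairing_linl z z1 z2 X (a b : R) :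
  {ae P, forall t, z t = a * z1 t + b * z2 t} ->
  pairing z X = a * pairing z1 X + b * pairing z2 X.
Proof.
move=> zE; rewrite !pairingE -!RintegralZl//; [|exact: integrable_pairing..].
rewrite -RintegralD//; last 2 first.
- exact: (integrableZl measurableT a (integrable_pairing z1 X)).
- exact: (integrableZl measurableT b (integrable_pairing z2 X)).
have mz := measurable_Zdual z; have mX := measurable_Zspace X.
have m1 := measurable_Zdual z1; have m2 := measurable_Zdual z2.
apply: ae_eq_Rintegral.
- exact: measurable_funM.
- by apply: measurable_funD; apply: measurable_funM => //; exact: measurable_funM.
- by apply: aeS zE => t ->; ring.
Qed.

Lemma exists_Zspace_lin X Y (a b : R) :
  exists W : Zspace p1, {ae P, forall t, W t = a * X t + b * Y t}.
Proof.
have mX := measurable_Zspace X; have mY := measurable_Zspace Y.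
apply: exists_Zspace.
- by apply: measurable_funD; apply: measurable_funM.
- exact: (finite_norm_lin p1 a b mX mY (finite_norm_Zspace X) (finite_norm_Zspace Y)).
Qed.

Lemma exists_Zdual_lin z1 z2 (a b : R) :
  exists z, {ae P, forall t, z t = a * z1 t + b * z2 t}.
Proof.
have m1 := measurable_Zdual z1; have m2 := measurable_Zdual z2.
apply: exists_Zdual.
- by apply: measurable_funD; apply: measurable_funM.
- exact: (finite_norm_lin (hoelder_conj_ge1 p1) a b m1 m2
    (finite_norm_Zdual z1) (finite_norm_Zdual z2)).
Qed.

Lemma exists_Zspace_bounded f (M : R) : measurable_fun setT f ->
  {ae P, forall t, `|f t| <= M} -> exists X : Zspace p1, {ae P, forall t, X t = f t}.
Proof.
by move=> mf fM; apply: exists_Zspace => //; exact: (finite_norm_bounded p1 mf fM).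
Qed.

Lemma density_ge0 z : density z -> {ae P, forall t, 0 <= z t}.
Proof. by case. Qed.

Lemma density_int z : density z -> \int[P]_t z t = 1.
Proof.
move=> [_ z1]; rewrite /Rintegral.
have -> : (\int[P]_t (z t)%:E = 1)%E; last by [].
rewrite -z1; apply: (integral_unif01 (f := fun t => (z t)%:E)).
by have := measurable_int _ (integrable_Zdual z).
Qed.

Lemma densityP z : {ae P, forall t, 0 <= z t} -> \int[P]_t z t = 1 -> density z.
Proof.
move=> z0 z1; split=> //.
rewrite -(integral_unif01 (f := fun t => (z t)%:E)); last first.
  by have := measurable_int _ (integrable_Zdual z).
rewrite -[LHS]fineK; last by apply: integrable_fin_num => //; exact: integrable_Zdual.
by congr EFin; exact: z1.
Qed.

End spaces.

(** * Moments *)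

Section bernstein.
Context (R : realType).
Implicit Types (g h : nat -> R) (x : R).

(* De Casteljau recursion for
   [\sum_k 'C(n, k) g(k) 'X^k (1 - 'X)^(n - k)]. *)
Fixpoint bernstein n g : {poly R} :=
  if n is m.+1 then 'X * bernstein m (g \o S) + (1 - 'X) * bernstein m g
  else (g 0%N)%:P.

Lemma bernsteinS n g x : (bernstein n.+1 g).[x] =
  x * (bernstein n (g \o S)).[x] + (1 - x) * (bernstein n g).[x].
Proof. by rewrite /= !hornerE. Qed.

Lemma le_bernstein n g h x : 0 <= x <= 1 -> (forall k, (k <= n)%N -> g k <= h k) ->
  (bernstein n g).[x] <= (bernstein n h).[x].
Proof.
move=> /andP[x0 x1]; elim: n g h => [|n IH] g h gh; first by rewrite /= !hornerC gh.
rewrite !bernsteinS lerD// ler_wpM2l ?subr_ge0//; apply: IH => k kn /=; apply: gh => //.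
exact: leqW.
Qed.

Lemma bernstein_affine n g x (a b : R) :
  (bernstein n (fun k => a + b * g k)).[x] = a + b * (bernstein n g).[x].
Proof.
elim: n g => [|n IH] g; first by rewrite /= !hornerC.
rewrite !bernsteinS IH (_ : _ \o S = fun k => a + b * (g \o S) k)// IH; ring.
Qed.

(** Second moment about c of a binomial variable with parameters n and x. It is stated for every c
    because the recursion replaces c by c - 1. *)
Lemma bernstein_sqr n x (c : R) :
  (bernstein n (fun k => (k%:R - c) ^+ 2)).[x] =
  (n%:R * x - c) ^+ 2 + n%:R * x * (1 - x).
Proof.
elim: n c => [|n IH] c; first by rewrite /= hornerC; ring.
rewrite bernsteinS IH (_ : _ \o S = fun k => (k%:R - (c - 1)) ^+ 2); last first.
  by apply/funext => k /=; rewrite -natr1; ring.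
by rewrite IH -natr1; ring.
Qed.

(** Bernstein's argument. Either k/N is within d of x and uniform continuity applies, or the
    oscillation, at most 2M, is paid by C (k/N - x)^2 with C = 2M / d^2. After averaging, the
    quadratic part contributes C x (1 - x) / N, at most e / 2 for N large. *)
Theorem weierstrass (f : R -> R) (e : R) : {within `[0, 1], continuous f} -> 0 < e ->
  exists q : {poly R}, forall x, 0 <= x <= 1 -> `|f x - q.[x]| <= e.
Proof.
move=> fc e0.
have [M M0 fM] : exists2 M : R, 0 < M & forall x, 0 <= x <= 1 -> `|f x| <= M.
  have := continuous_compact fc (@segment_compact R 0 1).
  move=> /compact_bounded[M [_ HM]]; exists (`|M| + 1); first by rewrite ltr_wpDl.
  move=> x x01; apply: (HM (`|M| + 1)); first by rewrite ltr_pwDr// ler_norm.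
  by exists x => //; rewrite /= in_itv.
have [d d0 fd] : exists2 d : R, 0 < d & forall x y, 0 <= x <= 1 -> 0 <= y <= 1 ->
    `|x - y| < d -> `|f x - f y| <= e / 2.
  have /compact_near_coveringP/near_covering_withinP cov := @segment_compact R 0 1.
  have HF : \forall d \near (0:R)^'+, forall x, `[0, 1]%classic x ->
      forall y, 0 <= y <= 1 -> `|x - y| < d -> `|f x - f y| <= e / 2.
    apply: (cov R _ (fun d x => forall y, 0 <= y <= 1 -> `|x - y| < d ->
      `|f x - f y| <= e / 2)) => x x01. have e40 : 0 < e / 4 by rewrite divr_gt0.
    have : \forall y \near x, y \in `[0, 1] -> `|f x - f y| < e / 4.
      by have /subspace_continuousP /(_ x x01) /cvgrPdist_lt /(_ _ e40) := fc.
    move=> /nbhs_ballP[r /= r0 Hr].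
    exists (ball x (r / 2), [set d | d < r / 2]).
      split; first by apply: nbhsx_ballx; rewrite divr_gt0.
      by apply: nbhs_right_lt; rewrite divr_gt0.
    move=> [x' d] [/= xx' dr] x'01 y y01 x'y.
    have h1 : `|f x - f x'| < e / 4.
      by apply: Hr => //; apply: le_ball xx'; lra.
    have h2 : `|f x - f y| < e / 4.
      apply: Hr; last by rewrite in_itv.
      rewrite /ball/= (le_lt_trans (ler_distD x' _ _))// [ltRHS]splitr ltrD//.
      exact: lt_trans dr.
    rewrite (le_trans (ler_distD (f x) _ _))// distrC; lra.
  have [d [d0 Hd]] := @filter_ex _ _ (at_right_proper_filter (0:R)) _
    (filterI (nbhs_right_gt (0:R)) HF).
  by exists d => // x y x01 y01; apply: Hd => //=; rewrite in_itv.
pose C := 2 * M / d ^+ 2.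
have C0 : 0 < C by rewrite divr_gt0// ?mulr_gt0// exprn_gt0.
have [n nC] : exists n : nat, C / (e / 2) < n.+1%:R.
  by exists (Num.truncn (C / (e / 2))); exact: truncnS_gt.
set N := n.+1 in nC.
have N0 : 0 < N%:R :> R by rewrite ltr0n.
exists (bernstein N (fun k => f (k%:R / N%:R))) => x x01.
pose B := C / N%:R ^+ 2.
have key k : (k <= N)%N -> `|f (k%:R / N%:R) - f x| <= e / 2 + B * (k%:R - N%:R * x) ^+ 2.
  move=> kN; have k01 : 0 <= (k%:R / N%:R : R) <= 1.
    by rewrite divr_ge0//= ler_pdivrMr// mul1r ler_nat.
  have BE : B * (k%:R - N%:R * x) ^+ 2 = C * (k%:R / N%:R - x) ^+ 2.
    by rewrite /B; field; rewrite gt_eqF.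
  rewrite BE; have [kd|kd] := ltP `|k%:R / N%:R - x| d.
    by rewrite (le_trans (fd _ _ k01 x01 kd))// lerDl mulr_ge0 ?sqr_ge0 ?(ltW C0).
  apply: (@le_trans _ _ (2 * M)).
    have := fM _ k01; have := fM _ x01; have := ler_normB (f (k%:R / N%:R)) (f x); lra.
  apply: (@le_trans _ _ (C * d ^+ 2)).
    by rewrite /C divfK// expf_neq0// gt_eqF.
  apply: (@le_trans _ _ (C * (k%:R / N%:R - x) ^+ 2)); last by rewrite lerDr; lra.
  rewrite ler_wpM2l// ?(ltW C0)// -[leRHS]real_normK ?num_real//.
  by rewrite ler_pXn2r// nnegrE// ltW.
have bnd : B * (N%:R * x * (1 - x)) <= e / 2.
  have -> : B * (N%:R * x * (1 - x)) = C / N%:R * (x * (1 - x)).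
    by rewrite /B; field; rewrite gt_eqF.
  have xx : x * (1 - x) <= 1 by nra.
  have CN : C / N%:R <= e / 2.
    by rewrite ler_pdivrMr// mulrC -ler_pdivrMr ?divr_gt0// ltW.
  apply: le_trans CN; rewrite -[leRHS]mulr1 ler_wpM2l// divr_ge0// ltW//.
have up : (bernstein N (fun k => f (k%:R / N%:R))).[x] <= f x + e.
  apply: (@le_trans _ _ (bernstein N (fun k => (f x + e / 2) + B * (k%:R - N%:R * x) ^+ 2)).[x]).
    apply: le_bernstein => // k kN; have := key _ kN; rewrite ler_norml; lra.
  by rewrite bernstein_affine bernstein_sqr; lra.
have lo : f x - e <= (bernstein N (fun k => f (k%:R / N%:R))).[x].
  apply: (@le_trans _ _ (bernstein N (fun k => (f x - e / 2) + (- B) * (k%:R - N%:R * x) ^+ 2)).[x]).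
    by rewrite bernstein_affine bernstein_sqr; lra.
  apply: le_bernstein => // k kN; have := key _ kN; rewrite ler_norml; lra.
rewrite ler_norml; lra.
Qed.

End bernstein.

Lemma integrable_mul_bounded d (T : measurableType d) (R : realType)
    (P : probability T R) (w g : T -> R) (M : R) :
  measurable_fun setT g -> {ae P, forall t, `|g t| <= M} ->
  P.-integrable setT (EFin \o w) -> P.-integrable setT (fun t => (w t * g t)%:E).
Proof.
move=> mg gM wi; have /measurable_EFinP mw := measurable_int _ wi.
have mwg : measurable_fun setT (fun t => w t * g t) by exact: measurable_funM.
apply/integrableP; split; first exact/measurable_EFinP.
have /integrableP[mM] := integrableZl measurableT `|M| (integrable_abse wi).
apply: le_lt_trans; apply: ae_ge0_le_integral => //.
- by apply: measurableT_comp => //; exact/measurable_EFinP.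
- exact: measurableT_comp.
- apply: aeS gM => t {}gM _; rewrite /= lee_fin !normrM !normr_id mulrC ler_wpM2r//.
  by rewrite (le_trans gM)// ler_norm.
Qed.

(** * An integrable function with vanishing moments is null *)

Section moment_uniqueness.
Context (R : realType).
Local Notation P := (unif01 R).
Local Notation mu := (@lebesgue_measure R).
Local Notation RT := (measurableTypeR R).

Lemma Rintegral_horner d (T : measurableType d) (Q : probability T R) (w X : T -> R)
    (q : {poly R}) : measurable_fun setT X -> {ae Q, forall t, 0 <= X t <= 1} ->
  Q.-integrable setT (EFin \o w) ->
  \int[Q]_t (w t * q.[X t]) = \sum_(i < size q) q`_i * \int[Q]_t (w t * X t ^+ i).
Proof.
move=> mX X01 wi.
have iX i : Q.-integrable setT (fun t => (w t * X t ^+ i)%:E).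
  apply: (integrable_mul_bounded (M := 1)) => //.
    exact: measurable_funX.
  apply: aeS X01 => t /andP[X0 X1].
  by rewrite normrX ger0_norm// exprn_ile1.
transitivity (\int[Q]_t (\sum_(i < size q) q`_i * (w t * X t ^+ i))).
  apply: eq_Rintegral => t _; rewrite horner_coef mulr_sumr.
  by apply: eq_bigr => i _; ring.
have key n : Q.-integrable setT (fun t => (\sum_(i < n) q`_i * (w t * X t ^+ i))%:E) /\
    \int[Q]_t (\sum_(i < n) q`_i * (w t * X t ^+ i)) =
    \sum_(i < n) q`_i * \int[Q]_t (w t * X t ^+ i).
  elim: n => [|n [IH1 IH2]].
    rewrite big_ord0; under eq_fun do rewrite big_ord0.
    by split; [exact: integrable0|under eq_Rintegral do rewrite big_ord0; rewrite Rintegral_cst// mul0r].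
  have i2 : Q.-integrable setT (fun t => (q`_n * (w t * X t ^+ n))%:E).
    exact: (integrableZl measurableT q`_n (iX n)).
  split.
    under eq_fun do rewrite big_ord_recr/= EFinD.
    exact: (integrableD measurableT IH1 i2).
  under eq_Rintegral do rewrite big_ord_recr/=.
  rewrite RintegralD// IH2 big_ord_recr/=; congr (_ + _).
  exact: (RintegralZl q`_n measurableT (iX n)).
exact: (key _).2.
Qed.

(** A polynomial within e / (C + 1) of g is used, where C is the L_1 norm of w and the added 1
    guards against C = 0. *)
Lemma Rintegral_continuous0 (w : RT -> R) (g : R -> R) :
  P.-integrable setT (EFin \o w) ->
  (forall k : nat, \int[P]_t (w t * t ^+ k) = 0) ->
  continuous g -> \int[P]_t (w t * g t) = 0.
Proof.
move=> wi wk gc; have mw := measurable_int _ wi.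
have mg : measurable_fun setT (g : RT -> R) by exact: continuous_measurable_fun.
have t01 : {ae P, forall t : RT, 0 <= t <= 1}.
  by apply: aeS (ae_unif01_itv R) => t; rewrite in_itv/= => /andP[/ltW-> /ltW->].
apply/eqP; rewrite -normr_le0; apply/ler_addgt0Pr => e e0; rewrite add0r.
pose C := \int[P]_t `|w t|.
have C0 : 0 <= C by apply: Rintegral_ge0.
have e'0 : 0 < e / (C + 1) by rewrite divr_gt0// ltr_wpDl.
have [q Hq] := weierstrass (continuous_subspaceT gc) e'0.
have iq : P.-integrable setT (fun t => (w t * (g t - q.[t]))%:E).
  apply: (integrable_mul_bounded (M := e / (C + 1))) => //.
    apply: measurable_funB => //.
    by apply: continuous_measurable_fun; exact: continuous_horner.
  by apply: aeS t01 => t; exact: Hq.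
have iq' : P.-integrable setT (fun t => (w t * q.[t])%:E).
  apply: (integrable_mul_bounded (M := \sum_(i < size q) `|q`_i|)) => //.
    by apply: continuous_measurable_fun; exact: continuous_horner.
  apply: aeS t01 => t /andP[t0 t1]; rewrite horner_coef (le_trans (ler_norm_sum _ _ _))//.
  by apply: ler_sum => i _; rewrite normrM ler_piMr// normrX ger0_norm// exprn_ile1.
have -> : \int[P]_t (w t * g t) = \int[P]_t (w t * (g t - q.[t])).
  transitivity (\int[P]_t (w t * (g t - q.[t]) + w t * q.[t])).
    by apply: eq_Rintegral => t _; ring.
  have H : \int[P]_t (w t * q.[t]) = _ :=
    Rintegral_horner (X := (id : RT -> R)) q (@measurable_id _ _ setT) t01 wi.
  rewrite RintegralD// H.
  by rewrite big1 ?addr0// => i _; rewrite wk mulr0.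
apply: le_trans (le_normr_Rintegral measurableT iq) _.
apply: (@le_trans _ _ (\int[P]_t (`|w t| * (e / (C + 1))))).
  apply: ae_le_Rintegral.
  - exact: (integrable_norm iq).
  - exact: (integrableZr measurableT (e / (C + 1)) (integrable_norm wi)).
  - by apply: aeS t01 => t t01'; rewrite normrM ler_wpM2l// Hq.
rewrite RintegralZr//; last exact: integrable_norm.
have C1 : C / (C + 1) <= 1 by rewrite ler_pdivrMr ?mul1r ?lerDl// ltr_wpDl.
by rewrite -/C mulrCA ler_piMr// ltW.
Qed.

(** The indicator is the pointwise limit of the continuous ramps [r n], equal to 1 up to b and to 0
    from b + 1/n on, and |w| dominates. *)
Lemma Rintegral_itvNyc0 (w : RT -> R) (b : R) :
  P.-integrable setT (EFin \o w) ->
  (forall g : R -> R, continuous g -> \int[P]_t (w t * g t) = 0) ->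
  \int[P]_t (w t * \1_(`]-oo, b]%classic) t) = 0.
Proof.
move=> wi wg; have /measurable_EFinP mw := measurable_int _ wi.
pose r (n : nat) (t : R) := Num.max 0 (Num.min 1 (1 - n%:R * (t - b))).
have rc n : continuous (r n).
  move=> t; apply: (@continuous_max R R (cst 0) (fun t => Num.min 1 (1 - n%:R * (t - b))) t).
    exact: cvg_cst.
  apply: (@continuous_min R R (cst 1) (fun t => 1 - n%:R * (t - b)) t); first exact: cvg_cst.
  apply: (@cvgB R R^o); first exact: cvg_cst.
  apply: cvgM; first exact: cvg_cst.
  by apply: (@cvgB R R^o); [exact: cvg_id|exact: cvg_cst].
have r01 n t : 0 <= r n t <= 1 by rewrite /r le_max lexx ge_max ler01 ge_min lexx.
have mr n : measurable_fun setT (r n : RT -> R) by exact: continuous_measurable_fun.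
have mI : measurable_fun setT (\1_(`]-oo, b]%classic : set RT) : RT -> R).
  by apply: measurable_indic; exact: measurable_itv.
have := @dominated_convergence _ _ _ P setT measurableT
  (fun n t => (w t * r n t)%:E) (fun t => (w t * \1_(`]-oo, b]%classic) t)%:E)
  (fun t => `|w t|%:E).
case.
- by move=> n; apply/measurable_EFinP; exact: measurable_funM.
- by apply/measurable_EFinP; exact: measurable_funM.
- apply: aeT => t _; apply: cvg_EFin; first exact: nearW.
  apply: cvgM; first exact: cvg_cst.
  rewrite indicE; have [tb|tb] := leP t b.
    rewrite mem_set/=; last by rewrite in_itv.
    rewrite (_ : (fun _ => _) = cst 1); first exact: cvg_cst.
    apply/funext => n; have h : n%:R * (t - b) <= 0 by rewrite mulr_ge0_le0// subr_le0.
    by rewrite /r min_l ?max_r//; lra.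
  rewrite memNset/=; last by rewrite in_itv/= leNgt tb.
  apply: cvg_near_cst; exists (Num.truncn ((t - b)^-1)).+1 => // n /= Nn.
  have tb0 : 0 < t - b by rewrite subr_gt0.
  have : 1 <= n%:R * (t - b).
    rewrite -ler_pdivrMr// div1r (le_trans (ltW (truncnS_gt _)))// ler_nat//.
  move=> h; rewrite /r max_l//; rewrite ge_min; apply/orP; right; lra.
- exact: (integrable_norm wi).
- apply: aeT => t n _ /=; rewrite lee_fin normrM ler_piMr//.
  by have /andP[r0 r1] := r01 n t; rewrite ger0_norm.
move=> _ _ /=.
have -> : (fun n => \int[P]_t (w t * r n t)%:E)%E = cst 0%E.
  apply/funext => n; rewrite -[LHS]fineK.
    by congr EFin; exact: wg.
  apply: integrable_fin_num => //; apply: (integrable_mul_bounded (M := 1)) => //.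
  by apply: aeT => t; have /andP[r0 r1] := r01 n t; rewrite ger0_norm.
move=> /(cvg_lim (@ereal_hausdorff _)); rewrite lim_cst// => H.
by rewrite /Rintegral -H.
Qed.

(** Vanishing against monomials passes to continuous functions and then to indicators of half-lines.
    The primitive of w is therefore identically 0, and differentiating it a.e. gives w = 0. *)
Theorem moments_eq0 (w : RT -> R) : P.-integrable setT (EFin \o w) ->
  (forall k : nat, \int[P]_t (w t * t ^+ k) = 0) -> {ae P, forall t, w t = 0}.
Proof.
move=> wi wk; have mw := measurable_int _ wi; have /measurable_EFinP mw' := mw.
pose v : R -> R := w \_ `[0, 1].
have vE : EFin \o v = (EFin \o w) \_ `[0, 1] by rewrite restrict_EFin.
have vi : mu.-integrable setT (EFin \o v).
  rewrite vE; apply/(integrable_mkcond (EFin \o w) (measurable_itv _)).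
  move/integrableP : wi => [_ wi]; apply/integrableP; split; first exact: measurable_funTS.
  by rewrite -integral_unif01//; exact: measurableT_comp.
have mI x : measurable_fun setT (\1_(`]-oo, x]%classic : set RT) : RT -> R).
  by apply: measurable_indic; exact: measurable_itv.
have F0 : (fun x => \int[mu]_(t in `]-oo, x]) v t) = cst 0.
  apply/funext => x; rewrite /cst.
  rewrite -(Rintegral_itvNyc0 x wi (fun g => Rintegral_continuous0 wi wk (g := g))).
  transitivity (\int[mu]_(t in `[0, 1]) (w t * \1_(`]-oo, x]%classic) t)).
    rewrite Rintegral_mkcond [RHS]Rintegral_mkcond; apply: eq_Rintegral => t _.
    rewrite /v !patchE indicE; case: ifPn => tx; case: ifPn => // t01.
      by rewrite mulr1.
    by rewrite mulr0.
  congr fine; apply/esym.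
  apply: (integral_unif01 (f := fun t => (w t * \1_(`]-oo, x]%classic) t)%:E)).
  by apply/measurable_EFinP; exact: measurable_funM.
have lv : locally_integrable setT v.
  by apply: open_integrable_locally; [exact: openT|exact: vi].
have iv y : mu.-integrable `]-oo, y] (EFin \o v) by apply: integrableS vi.
have := FTC1Ny iv lv; rewrite F0 => -[N [mN N0 sN]].
have : {ae mu, forall x, v x = 0}.
  exists N; split=> //; apply: subset_trans sN => x /= nv H; apply: nv.
  by have [_ <-] := H; rewrite derive1_cst.
move=> /ae_unif01 H; apply: aeS (aeI H (ae_unif01_itv R)) => t [+ t01].
by rewrite /v patchE mem_set//=; exact: subset_itv_oo_cc t01.
Qed.

End moment_uniqueness.

Lemma cvg_sum_ord (R : realType) (T : Type) (F : set_system T) {FF : Filter F}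
    (c : nat -> R) (n : nat) (u : T -> nat -> R) (l : nat -> R) :
  (forall k, u x k @[x --> F] --> l k) ->
  \sum_(i < n) c i * u x i @[x --> F] --> \sum_(i < n) c i * l i.
Proof.
move=> ul; elim: n => [|n IH].
  by under eq_fun do rewrite big_ord0; rewrite big_ord0; exact: cvg_cst.
under eq_fun do rewrite big_ord_recr/=; rewrite big_ord_recr/=.
apply: (@cvgD R R^o) => //.
by apply: cvgM; [exact: cvg_cst|exact: ul].
Qed.

(** * Moments control weak convergence of measures *)

Section Pspace_moments.
Context (R : realType).
Local Notation RT := (measurableTypeR R).
Implicit Types m : Pspace R.

Definition moment m (k : nat) : R := \int[sval m]_a (a ^+ k).

Lemma Pspace_ae m : {ae sval m, forall a, a \in `[0%R, 1%R[}.
Proof.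
exists (~` `[0%R, 1%R[%classic); split=> //; first exact: measurableC.
rewrite probability_setC; last exact: measurable_itv.
by have -> := svalP m; rewrite subee.
Qed.

Lemma Pspace_ae01 m : {ae sval m, forall a : RT, 0 <= a <= 1}.
Proof. by apply: aeS (Pspace_ae m) => a; rewrite in_itv/= => /andP[-> /ltW]. Qed.

Lemma moment_horner m (q : {poly R}) :
  \int[sval m]_a q.[a] = \sum_(i < size q) q`_i * moment m i.
Proof.
have i1 : (sval m).-integrable setT (EFin \o (cst 1 : RT -> R)).
  exact: (@finite_measure_integrable_cst _ _ _ (sval m) setT 1).
have := Rintegral_horner (w := cst 1) (X := (id : RT -> R)) q (@measurable_id _ _ setT)
  (Pspace_ae01 m) i1.
under eq_Rintegral do rewrite mul1r.
by move=> ->; apply: eq_bigr => i _; congr (_ * _); apply: eq_Rintegral => t _; rewrite mul1r.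
Qed.

Lemma Pintegral_approx m (f : C01 R) (q : {poly R}) (e : R) :
  (forall x, 0 <= x <= 1 -> `|sval f x - q.[x]| <= e) ->
  `|Pintegral m f - \sum_(i < size q) q`_i * moment m i| <= e.
Proof.
move=> fq; rewrite /Pintegral Rintegral_mkcond -moment_horner.
have mf : measurable_fun setT ((sval f \_ `[0, 1]) : RT -> R).
  apply/(measurable_restrictT _ (measurable_itv _)).
  by apply: subspace_continuous_measurable_fun => //; exact: (svalP f).
have mq : measurable_fun setT ((fun t => q.[t]) : RT -> R).
  by apply: continuous_measurable_fun; exact: continuous_horner.
have iq : (sval m).-integrable setT (EFin \o ((fun t => q.[t]) : RT -> R)).
  apply: (integrable_bounded (M := \sum_(i < size q) `|q`_i|)) => //.
  apply: aeS (Pspace_ae01 m) => t /andP[t0 t1]; rewrite horner_coef (le_trans (ler_norm_sum _ _ _))//.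
  by apply: ler_sum => i _; rewrite normrM ler_piMr// normrX ger0_norm// exprn_ile1.
have aefq : {ae sval m, forall t : RT, `|(sval f \_ `[0, 1]) t - q.[t]| <= e}.
  apply: aeS (Pspace_ae01 m) => t t01; rewrite patchE mem_set/=; last by rewrite in_itv.
  exact: fq.
have ifq : (sval m).-integrable setT (EFin \o (fun t : RT => (sval f \_ `[0, 1]) t - q.[t])).
  by apply: (integrable_bounded (M := e)) => //; exact: measurable_funB.
have iff : (sval m).-integrable setT (EFin \o ((sval f \_ `[0, 1]) : RT -> R)).
  apply: eq_integrable (integrableD measurableT ifq iq) => // t _ /=.
  by rewrite -EFinD subrK.
rewrite -RintegralB//.
apply: le_trans (le_normr_Rintegral measurableT ifq) _.
apply: (@le_trans _ _ (\int[sval m]_t (cst e t))).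
  apply: ae_le_Rintegral => //.
  - exact: (integrable_norm ifq).
  - exact: (@finite_measure_integrable_cst _ _ _ (sval m) setT e).
by rewrite Rintegral_cst//= (probability_setT (sval m)) mulr1.
Qed.

(** All the measures have mass 1 on [[0, 1]], so replacing the test function by a polynomial costs e
    / 3 uniformly along the filter, and only finitely many moments remain. *)
Lemma cvg_Pspace_moments (F : set_system (Pspace R)) m : Filter F ->
  (forall k, moment x k @[x --> F] --> moment m k) -> F --> m.
Proof.
move=> FF Fk; apply: cvg_Pspace => f; apply/cvgrPdist_le => e e0.
have e30 : 0 < e / 3 by rewrite divr_gt0.
have [q fq] := weierstrass (svalP f) e30.
have : (fun x => \sum_(i < size q) q`_i * moment x i) @ F -->
    \sum_(i < size q) q`_i * moment m i.
  exact: (@cvg_sum_ord R (Pspace R) F FF (fun i => q`_i) (size q) (@moment) (moment m) Fk).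
move=> /cvgrPdist_le /(_ _ e30); apply: filterS => x Hx.
have := Pintegral_approx m fq; have := Pintegral_approx x fq; move: Hx.
by rewrite !ler_norml; lra.
Qed.

End Pspace_moments.

(** * The map T and average value at risk *)

(** Nondecreasing on either side of the pole 1. *)
Lemma measurable_inv_onem (R : realType) :
  measurable_fun setT ((fun a => (1 - a)^-1) : measurableTypeR R -> R).
Proof.
have -> : setT = `]-oo, 1[ `|` ([set 1] `|` `]1, +oo[) :> set (measurableTypeR R).
  apply/seteqP; split => // a _ /=; rewrite !in_itv/= andbT.
  by case: (ltgtP a 1) => a1; [left|right; right|right; left].
have m1 : measurable ([set 1] : set (measurableTypeR R)) by exact: measurable_set1.
apply/measurable_funU => //; first exact: measurableU.
split.
  have H : {in `]-oo, 1[ &, {homo (fun a : R => (1 - a)^-1) : x y / x <= y}}.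
    by move=> x y; rewrite !in_itv/= => x1 y1 xy; rewrite lef_pV2 ?posrE; lra.
  exact: (measurable_fun_nondecreasing_in H).
apply/measurable_funU => //; split; first exact: measurable_fun_set1.
have H : {in `]1, +oo[ &, {homo (fun a : R => (1 - a)^-1) : x y / x <= y}}.
  move=> x y; rewrite !in_itv/= !andbT => x1 y1 xy.
  by rewrite lef_nV2 ?negrE; lra.
exact: (measurable_fun_nondecreasing_in H).
Qed.

Section Tmap_fubini.
Context (R : realType) (m : Pspace R).
Local Notation P := (unif01 R).
Local Notation RT := (measurableTypeR R).
Local Notation Q := (sval m).
Implicit Types f : RT -> R.

Let Tset : set (RT * RT) := [set z | [&& 0 <= z.1, z.1 <= z.2 & z.2 < 1]].

Let mTset : measurable Tset.
Proof.
have m1 : measurable_fun setT (fun z : RT * RT => [&& 0 <= z.1, z.1 <= z.2 & z.2 < 1]).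
  apply: measurable_and.
    by apply: measurable_fun_ler; [exact: measurable_cst|exact: measurable_fst].
  apply: measurable_and.
    by apply: measurable_fun_ler; [exact: measurable_fst|exact: measurable_snd].
  by apply: measurable_fun_ltr; [exact: measurable_snd|exact: measurable_cst].
by have := m1 measurableT [set true] I; rewrite setTI.
Qed.

(** The kernel linking T to AV@R, supported on 0 <= a <= t < 1: integrating a out against the
    measure gives [Tmap01 t * f t], integrating t out against the uniform law gives [avar f a]. *)
Let kern f (z : RT * RT) : R := \1_Tset z * (1 - z.1)^-1 * f z.2.

Let minv : measurable_fun setT ((fun a => (1 - a)^-1) : RT -> R).
Proof. exact: measurable_inv_onem. Qed.

Let mkern f : measurable_fun setT f -> measurable_fun setT (kern f).
Proof.
move=> mf; apply: measurable_funM; last by apply: measurableT_comp => //; exact: measurable_snd.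
apply: measurable_funM; first exact: measurable_indic.
by apply: (@measurableT_comp _ _ _ _ _ _ (fun a : RT => (1 - a)^-1)) => //; exact: measurable_fst.
Qed.

Let integrable_inv t : t < 1 ->
  Q.-integrable setT (fun a : RT => (\1_(`[0, t]%classic : set RT) a * (1 - a)^-1)%:E).
Proof.
move=> t1; apply: (integrable_bounded (M := (1 - t)^-1)).
  apply: measurable_funM => //; apply: measurable_indic; exact: measurable_itv.
apply: aeT => a; rewrite indicE; case: (boolP (a \in _)) => [|_].
  rewrite inE/= in_itv/= => /andP[a0 at_].
  by rewrite mul1r ger0_norm ?invr_ge0 ?lef_pV2 ?posrE; lra.
by rewrite mul0r normr0 invr_ge0; lra.
Qed.

Lemma Tmap_indic t : Tmap m t = \int[Q]_a (\1_(`[0, t]%classic : set RT) a * (1 - a)^-1).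
Proof.
rewrite /Tmap Rintegral_mkcond; apply: eq_Rintegral => a _; rewrite patchE indicE.
by case: ifPn; rewrite ?mul1r ?mul0r.
Qed.

Lemma Tmap_ge0 t : t < 1 -> 0 <= Tmap m t.
Proof.
move=> t1; rewrite /Tmap; apply: Rintegral_ge0 => a; rewrite /= in_itv/= => /andP[_ at_].
by rewrite invr_ge0; lra.
Qed.

Lemma Tmap_nd s t : s <= t -> t < 1 -> Tmap m s <= Tmap m t.
Proof.
move=> st t1; rewrite !Tmap_indic; apply: le_Rintegral => //.
- exact: integrable_inv (le_lt_trans st t1).
- exact: integrable_inv.
move=> a _; rewrite !indicE; case: (boolP (a \in `[0, s]%classic)) => [|_].
  rewrite inE/= in_itv/= => /andP[a0 as_]; rewrite mem_set//= in_itv/= a0.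
  exact: le_trans st.
rewrite mul0r; case: (boolP (a \in _)); rewrite ?mul0r// inE/= in_itv/= => /andP[_ at_].
by rewrite mul1r invr_ge0; lra.
Qed.

(** From 1 on, the integral defining [Tmap] may be infinite, and its real value would then be the
    default 0, which breaks monotonicity; hence the cut. *)
Definition Tmap01 : RT -> R := Tmap m \_ `[0, 1[.

Lemma measurable_Tmap01 : measurable_fun setT Tmap01.
Proof.
apply/(measurable_restrictT _ (measurable_itv _)).
have H : {in `[0, 1[ &, {homo Tmap m : x y / x <= y}}.
  by move=> x y _; rewrite in_itv/= => /andP[_ y1] xy; exact: Tmap_nd.
exact: (measurable_fun_nondecreasing_in H).
Qed.

Lemma Tmap01_ge0 t : 0 <= Tmap01 t.
Proof.
rewrite /Tmap01 patchE; case: ifPn => //; rewrite inE/= in_itv/= => /andP[_].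
exact: Tmap_ge0.
Qed.

Lemma ae_Tmap01 : {ae P, forall t, Tmap01 t = Tmap m t}.
Proof.
apply: aeS (ae_unif01_itv R) => t t01; rewrite /Tmap01 patchE mem_set//=.
by move: t01; rewrite !in_itv/= => /andP[/ltW-> ->].
Qed.

Let integral_kern1 f t : (\int[Q]_a (kern f (a, t))%:E = (Tmap01 t * f t)%:E)%E.
Proof.
have [t1|t1] := ltP t 1; last first.
  rewrite /Tmap01 patchE memNset; last by rewrite /= in_itv/= ltNge t1 andbF.
  rewrite mul0r integral0_eq// => a _.
  have nT : ~ Tset (a, t) by move=> /and3P[_ _] /=; rewrite ltNge t1.
  by rewrite /kern indicE memNset// !mul0r.
have kE : (fun a => (kern f (a, t))%:E) =
    (fun a => (f t)%:E * (\1_(`[0%R, t]%classic : set RT) a * (1 - a)^-1)%:E)%E.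
  apply/funext => a; rewrite -EFinM; congr EFin; rewrite /kern/= mulrC; congr (_ * (_ * _)).
  by apply: eq_indic; rewrite /Tset/= t1 andbT in_itv.
rewrite kE integralZl//; last exact: integrable_inv.
rewrite mulrC EFinM; congr (_ * _)%E.
rewrite -[LHS]fineK; last by apply: integrable_fin_num => //; exact: integrable_inv.
congr EFin; transitivity (Tmap m t); first by rewrite Tmap_indic.
rewrite /Tmap01 patchE; case: ifPn => //.
rewrite notin_setE/= in_itv/= t1 andbT => /negP; rewrite -ltNge => t0.
rewrite Tmap_indic (@eq_Rintegral _ _ _ Q setT (cst 0)); first by rewrite Rintegral_cst// mul0r.
move=> a _; rewrite indicE memNset ?mul0r//= in_itv/= => /andP[a0 /(le_trans a0)].
by rewrite leNgt t0.
Qed.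

(** The average of f over [[a, 1]], without rearrangement. It is linear in f, as AV@R is not, and
    gives AV@R of X when applied to [rearr X]. *)
Definition avar f (a : R) : R := (1 - a)^-1 * \int[P]_t (\1_(`[a, +oo[%classic : set RT) t * f t).

Let integral_kern2 f a : P.-integrable setT (EFin \o f) -> 0 <= a < 1 ->
  (\int[P]_t (kern f (a, t))%:E = (avar f a)%:E)%E.
Proof.
move=> fi /andP[a0 a1]; have /measurable_EFinP mf := measurable_int _ fi.
have mI : measurable (`[a, +oo[%classic : set RT) by exact: measurable_itv.
have iaf : P.-integrable setT (fun t => (\1_(`[a, +oo[%classic : set RT) t * f t)%:E).
  exact: integrable_indicM.
transitivity (\int[P]_t (((1 - a)^-1)%:E * (\1_(`[a, +oo[%classic : set RT) t * f t)%:E))%E.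
  apply: ae_eq_integral => //.
  - apply/measurable_EFinP.
    by apply: (measurableT_comp (mkern mf)); exact: measurable_pair1.
  - by apply: measurable_funeM; exact: (measurable_int _ iaf).
  apply: aeS (ae_unif01_itv R) => t; rewrite in_itv/= => /andP[_ t1] _.
  rewrite -EFinM; congr EFin; rewrite /kern/= mulrA; congr (_ * _).
  rewrite mulrC; congr (_ * _); apply: eq_indic.
  by rewrite /Tset/= a0 t1 andbT in_itv/= andbT.
rewrite integralZl// EFinM; congr (_ * _)%E.
by rewrite /Rintegral fineK//; exact: integrable_fin_num.
Qed.

(** Fubini for [kern f]. Since the kernel weight is nonnegative, the absolute value of [kern f] is
    the kernel of |f|, so integrability on the product reduces to that of [Tmap01 t * f t]. *)
Lemma integral_avar f : P.-integrable setT (EFin \o f) ->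
  P.-integrable setT (fun t => (Tmap01 t * f t)%:E) ->
  (\int[Q]_(a in `[0%R, 1%R[) (avar f a)%:E = (\int[P]_t (Tmap01 t * f t))%:E)%E.
Proof.
move=> fi Tfi; have /measurable_EFinP mf := measurable_int _ fi.
have ik : (Q \x P)%E.-integrable setT (EFin \o kern f).
  apply/integrable21ltyP; first by apply/measurable_EFinP; exact: mkern.
  move/integrableP: Tfi => [_]; apply: le_lt_trans.
  rewrite le_eqVlt; apply/orP; left; apply/eqP; apply: eq_integral => t _.
  transitivity (\int[Q]_a (kern (fun t => `|f t|) (a, t))%:E)%E.
    apply: eq_integral => a _ /=; congr EFin; rewrite /kern normrM; congr (_ * _).
    rewrite ger0_norm//= indicE; case: (boolP (_ \in _)); last by rewrite mul0r.
    by rewrite inE/= => /and3P[/= a0 at_ t1]; rewrite mul1r invr_ge0 subr_ge0 (le_trans at_)// ltW.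
  by rewrite integral_kern1/= normrM (ger0_norm (Tmap01_ge0 _)).
have := Fubini ik.
under [X in _ = X -> _]eq_integral do rewrite /= integral_kern1.
rewrite /Rintegral => H; rewrite fineK; last exact: integrable_fin_num.
have mG : measurable_fun setT (fun a => \int[P]_t (kern f (a, t))%:E)%E.
  by have := measurable_int _ (integrable_fubini_F ik).
have avarE : (fun a => (avar f a)%:E) \_ `[0%R, 1%R[ =
    (fun a => \int[P]_t (kern f (a, t))%:E)%E \_ `[0%R, 1%R[.
  apply/funext => a; rewrite !patchE; case: ifPn => // a01.
  by rewrite integral_kern2//; move: a01; rewrite inE/= in_itv.
rewrite -H integral_mkcond avarE.
apply: ae_eq_integral => //.
- by apply/(measurable_restrictT _ (measurable_itv _)); exact: measurable_funTS.
- by apply: aeS (Pspace_ae m) => a a01 _; rewrite patchE mem_set.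
Qed.

Lemma ae_unif01_ge0 : {ae P, forall t : RT, 0 <= t < 1}.
Proof. by apply: aeS (ae_unif01_itv R) => t; rewrite in_itv/= => /andP[/ltW-> ->]. Qed.

(** The average of the constant 1 over [[a, 1]] is 1 and the measure has mass 1. Tonelli is used, as
    integrability of [Tmap01] is part of what is proved. *)
Lemma Tmap01_int : P.-integrable setT (EFin \o Tmap01) /\ \int[P]_t Tmap01 t = 1.
Proof.
have key : (\int[P]_t (Tmap01 t)%:E = 1)%E.
  transitivity (\int[P]_t \int[Q]_a (kern (cst 1) (a, t))%:E)%E.
    by apply: eq_integral => t _; rewrite integral_kern1 mulr1.
  rewrite -(@fubini_tonelli _ _ _ _ _ Q P (EFin \o kern (cst 1)))/=; last 2 first.
  - by apply/measurable_EFinP; exact: mkern.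
  - move=> [a t] /=; rewrite lee_fin /kern mulr1 indicE; case: (boolP (_ \in _)).
      by rewrite inE/= => /and3P[/= a0 at_ t1]; rewrite mul1r invr_ge0 subr_ge0 (le_trans at_)// ltW.
    by rewrite mul0r.
  transitivity (\int[Q]_a (cst 1%E a))%E.
    apply: ae_eq_integral => //.
    - apply: (measurable_fun_fubini_tonelli_F (EFin \o kern (cst 1))) => //.
      + by apply/measurable_EFinP; exact: mkern.
      + move=> [a t] /=; rewrite lee_fin /kern mulr1 indicE; case: (boolP (_ \in _)).
          by rewrite inE/= => /and3P[/= a0 at_ t1]; rewrite mul1r invr_ge0 subr_ge0 (le_trans at_)// ltW.
        by rewrite mul0r.
    apply: aeS (Pspace_ae m) => a; rewrite in_itv/= => a01 _.
    have i1 : P.-integrable setT (EFin \o (cst 1 : RT -> R)).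
      exact: (@finite_measure_integrable_cst _ _ _ P setT 1).
    rewrite (integral_kern2 i1)// /avar; congr EFin.
    under eq_Rintegral do rewrite mulr1.
    have -> : \int[P]_t \1_(`[a, +oo[%classic : set RT) t = 1 - a.
      apply/EFin_inj; rewrite Rintegral_indic; last exact: measurable_itv.
      have -> : `[a, +oo[%classic = ~` `]-oo, a[%classic :> set RT.
        by apply/seteqP; split => z; rewrite /= !in_itv/= andbT leNgt => /negP.
      rewrite probability_setC; last exact: measurable_itv.
      by rewrite unif01_itvNyo//; move: a01 => /andP[-> /ltW->].
    by rewrite mulVf// subr_eq0 gt_eqF//; move: a01 => /andP[].
  by rewrite integral_cst//= mul1e (probability_setT Q).
split; last by rewrite /Rintegral key.
apply/integrableP; split; first by apply/measurable_EFinP; exact: measurable_Tmap01.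
under eq_integral do rewrite /= ger0_norm ?Tmap01_ge0//.
by rewrite key ltry.
Qed.

End Tmap_fubini.

(** * Averages of polynomials, and moments of a measure as pairings *)

Section avar_polynomial.
Context (R : realType).
Local Notation P := (unif01 R).
Local Notation mu := (@lebesgue_measure R).
Local Notation RT := (measurableTypeR R).

Lemma Rintegral_indic_itv (f : RT -> R) (a : R) : measurable_fun setT f -> 0 <= a ->
  \int[P]_t (\1_(`[a, +oo[%classic : set RT) t * f t) = \int[mu]_(t in `[a, 1]) f t.
Proof.
move=> mf a0.
have mI : measurable (`[a, +oo[%classic : set RT) by exact: measurable_itv.
transitivity (\int[mu]_(t in `[0, 1]) (\1_(`[a, +oo[%classic : set RT) t * f t)).
  congr fine.
  apply: (integral_unif01 (f := fun t => (\1_(`[a, +oo[%classic : set RT) t * f t)%:E)).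
  by apply/measurable_EFinP; apply: measurable_funM => //; exact: measurable_indic.
rewrite Rintegral_mkcond [RHS]Rintegral_mkcond; apply: eq_Rintegral => t _.
rewrite !patchE indicE; case: (boolP (t \in `[a, 1]%classic)).
  rewrite inE/= in_itv/= => /andP[at_ t1].
  by rewrite !mem_set ?mul1r//= ?in_itv/= ?andbT// t1 (le_trans a0).
rewrite notin_setE/= in_itv/= => /negP; rewrite negb_and => H.
case: ifPn => //; rewrite inE/= in_itv/= => /andP[t0 t1].
rewrite memNset ?mul0r//= in_itv/= andbT => at_.
by move: H; rewrite at_ t1.
Qed.

Lemma Rintegral_indic_deriv (q : {poly R}) (a : R) : 0 <= a < 1 ->
  \int[P]_t (\1_(`[a, +oo[%classic : set RT) t * q^`().[t]) = q.[1] - q.[a].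
Proof.
move=> /andP[a0 a1].
rewrite Rintegral_indic_itv//; last by apply: continuous_measurable_fun; exact: continuous_horner.
rewrite /Rintegral (@continuous_FTC2 R (horner q^`()) (horner q) a 1)//.
- exact/continuous_subspaceT/continuous_horner.
- split.
  + by move=> x _; exact: derivable_horner.
  + by apply: cvg_at_right_filter; exact: continuous_horner.
  + by apply: cvg_at_left_filter; exact: continuous_horner.
- by move=> x _; rewrite derivE.
Qed.

(* Chosen so that its average over [a, 1] is [a ^+ k]. *)
Definition momentpoly (k : nat) : {poly R} := (('X - 1%:P) * 'X^k)^`().

Lemma momentpolyE k t :
  (momentpoly k).[t] = t ^+ k + (t - 1) * (k%:R * t ^+ k.-1).
Proof.
rewrite /momentpoly derivM derivXsubC mul1r derivXn hornerD hornerXn hornerM.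
by rewrite hornerXsubC hornerMn hornerXn mulr_natl.
Qed.

Lemma avar_momentpoly k a : 0 <= a < 1 ->
  avar (fun t => (momentpoly k).[t]) a = a ^+ k.
Proof.
move=> a01; rewrite /avar Rintegral_indic_deriv// !hornerM !hornerXsubC !hornerXn subrr mul0r sub0r.
rewrite -mulNr opprB mulKf// subr_eq0 gt_eqF//; by case/andP: a01.
Qed.

Lemma horner_le (q : {poly R}) (t : R) : 0 <= t <= 1 ->
  `|q.[t]| <= \sum_(i < size q) `|q`_i|.
Proof.
move=> /andP[t0 t1]; rewrite horner_coef (le_trans (ler_norm_sum _ _ _))//.
by apply: ler_sum => i _; rewrite normrM ler_piMr// normrX ger0_norm// exprn_ile1.
Qed.

Lemma measurable_horner (q : {poly R}) : measurable_fun setT (fun t : RT => q.[t]).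
Proof. by apply: continuous_measurable_fun; exact: continuous_horner. Qed.

Lemma integrable_horner (q : {poly R}) : P.-integrable setT (fun t : RT => (q.[t])%:E).
Proof.
apply: (integrable_bounded (f := fun t : RT => q.[t]) (M := \sum_(i < size q) `|q`_i|)).
  exact: measurable_horner.
by apply: aeS (ae_unif01_ge0 R) => t /andP[t0 t1]; rewrite horner_le// t0 ltW.
Qed.

Lemma moment_Tmap (m : Pspace R) k :
  moment m k = \int[P]_t (Tmap01 m t * (momentpoly k).[t]).
Proof.
have [iT _] := Tmap01_int m.
have iTp : P.-integrable setT (fun t => (Tmap01 m t * (momentpoly k).[t])%:E).
  apply: (integrable_mul_bounded (M := \sum_(i < size (momentpoly k)) `|(momentpoly k)`_i|)) => //.
    exact: measurable_horner.
  by apply: aeS (ae_unif01_ge0 R) => t /andP[t0 t1]; rewrite horner_le// t0 ltW.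
apply/EFin_inj; rewrite -integral_avar//; last exact: integrable_horner.
have mx : measurable_fun setT ((fun a => a ^+ k) : RT -> R) by exact: measurable_funX.
rewrite /moment /Rintegral fineK; last first.
  apply: integrable_fin_num => //; apply: (integrable_bounded (M := 1)) => //.
  by apply: aeS (Pspace_ae01 m) => a /andP[a0 a1]; rewrite normrX ger0_norm// exprn_ile1.
rewrite [RHS]integral_mkcond.
have E : (fun a => (avar (fun t => (momentpoly k).[t]) a)%:E) \_ `[0%R, 1%R[ =
         (fun a => (a ^+ k)%:E) \_ `[0%R, 1%R[.
  apply/funext => a; rewrite !patchE; case: ifPn => //.
  by rewrite inE/= in_itv/= => a01; rewrite avar_momentpoly.
rewrite E; apply: ae_eq_integral => //.
- exact/measurable_EFinP.
- apply/(measurable_restrictT _ (measurable_itv _)); apply: measurable_funTS.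
  exact/measurable_EFinP.
- by apply: aeS (Pspace_ae m) => a a01 _; rewrite patchE mem_set.
Qed.

(** [momentpoly k.+1] is (k + 2) t^(k+1) - (k + 1) t^k and [momentpoly 0] is 1, so the moments
    against monomials vanish by induction. *)
Lemma momentpoly_eq0 (w : RT -> R) : P.-integrable setT (EFin \o w) ->
  (forall k, \int[P]_t (w t * (momentpoly k).[t]) = 0) -> {ae P, forall t, w t = 0}.
Proof.
move=> wi wk; apply: moments_eq0 => //.
have iw k : P.-integrable setT (fun t => (w t * t ^+ k)%:E).
  have mx : measurable_fun setT ((fun a => a ^+ k) : RT -> R) by exact: measurable_funX.
  apply: (integrable_mul_bounded (M := 1) mx) => //.
  apply: aeS (ae_unif01_ge0 R) => t /andP[t0 t1].
  by rewrite normrX ger0_norm// exprn_ile1// ltW.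
elim=> [|k IH].
  rewrite -(wk 0%N); apply: eq_Rintegral => t _.
  by rewrite momentpolyE !mul0r mulr0 addr0.
have := wk k.+1.
have -> : \int[P]_t (w t * (momentpoly k.+1).[t]) =
    \int[P]_t (k.+2%:R * (w t * t ^+ k.+1) - k.+1%:R * (w t * t ^+ k)).
  apply: eq_Rintegral => t _; rewrite momentpolyE /= exprS -(natr1 k.+1); ring.
rewrite RintegralB//; last 2 first.
- exact: (integrableZl measurableT k.+2%:R (iw k.+1)).
- exact: (integrableZl measurableT k.+1%:R (iw k)).
rewrite (RintegralZl k.+2%:R measurableT (iw k.+1)) (RintegralZl k.+1%:R measurableT (iw k)).
by rewrite IH mulr0 subr0 => /eqP; rewrite mulf_eq0 pnatr_eq0/= => /eqP.
Qed.

End avar_polynomial.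

(** * AV@R as an average of the rearrangement *)

Section AVaR_quantile.
Context (R : realType) (p : R) (p1 : (1 <= p%:E)%E).
Local Notation P := (unif01 R).
Local Notation mu := (@lebesgue_measure R).
Local Notation RT := (measurableTypeR R).
Implicit Types X : Zspace p1.

Lemma ZcdfE X r : Zcdf X r = (rcdf (X : RT -> R) r)%:E.
Proof. by rewrite rcdfE//; exact: measurable_Zspace. Qed.

Lemma quantileE X t : t \in `]0, 1[ -> quantile X t = (rearr X t)%:E.
Proof.
move=> t01; have mX := measurable_Zspace X; have fs := in_itv01_has_sup mX t01.
rewrite rearrE// /quantile.
have -> : [set r : R | (Zcdf X r <= t%:E)%E] = [set r | rcdf (X : RT -> R) r <= t].
  by apply/seteqP; split => r /=; rewrite ZcdfE lee_fin.
by rewrite ereal_sup_EFin//; case: fs.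
Qed.

Lemma quantile_nd X s t : s <= t -> (quantile X s <= quantile X t)%E.
Proof.
move=> st; apply: le_ereal_sup => _ [r /= Xr <-]; exists r => //=.
by rewrite (le_trans Xr)// lee_fin.
Qed.

Lemma measurable_quantile X : measurable_fun setT (quantile X : RT -> \bar R).
Proof.
apply: (measurability (@ErealGenCInfty.G R)) => [|/= _ [_] [r] -> <-].
  exact: ErealGenCInfty.measurableE.
rewrite setTI; apply: is_interval_measurable => s t/=.
rewrite !in_itv/= !andbT => rs rt u /andP[su ut].
by rewrite in_itv/= andbT (le_trans rs)// quantile_nd.
Qed.

Lemma AVaRE X a : 0 <= a < 1 -> AVaR a X = (avar (rearr X) a)%:E.
Proof.
move=> /andP[a0 a1]; have mX := measurable_Zspace X; have mq := measurable_rearr mX.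
have iq : P.-integrable setT (EFin \o rearr X).
  apply: (integrable_same_law (f := X) (h := id)) => //.
    exact: same_law_rearr.
  exact: integrable_Zspace.
have mI : measurable (`[a, +oo[%classic : set RT) by exact: measurable_itv.
rewrite /AVaR /avar EFinM; congr (_ * _)%E.
rewrite /Rintegral fineK; last by apply: integrable_fin_num => //; exact: integrable_indicM.
have m1 : measurable_fun setT (fun t => (\1_(`[a, +oo[%classic : set RT) t * rearr X t)%:E).
  by apply/measurable_EFinP; apply: measurable_funM => //; exact: measurable_indic.
rewrite (integral_unif01 m1) integral_mkcond [RHS]integral_mkcond.
(* [quantile] may be infinite at 0 and 1, where [rearr] has the value 0; these two points are
   negligible. *)
have ae01 : {ae mu, forall t, ~ [set 0; 1] t}.
  have m01 : measurable ([set 0; 1] : set R) by apply: measurableU; exact: measurable_set1.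
  exists [set 0; 1]; split => //.
    by apply: countable_lebesgue_measure0; apply: finite_set_countable; exact: finite_set2.
  by move=> t /= /contrapT.
apply: ae_eq_integral => //.
- apply/(measurable_restrictT _ (measurable_itv _)); apply: measurable_funTS.
  exact: measurable_quantile.
- by apply/(measurable_restrictT _ (measurable_itv _)); exact: measurable_funTS.
apply: aeS ae01 => t /= /not_orP[/eqP t0 /eqP t1] _.
rewrite !patchE indicE; case: (boolP (t \in `[a, 1]%classic)).
  rewrite inE/= in_itv/= => /andP[at_ tl].
  rewrite !mem_set ?mul1r//= ?in_itv/= ?andbT ?tl ?(le_trans a0)// quantileE//.
  by rewrite in_itv/= !lt_neqAle eq_sym t0 t1 tl (le_trans a0).
rewrite notin_setE/= in_itv/= => /negP; rewrite negb_and => H.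
case: ifPn => //; rewrite inE/= in_itv/= => /andP[_ tl].
rewrite memNset ?mul0r//= in_itv/= andbT => at_.
by move: H; rewrite at_ tl.
Qed.

Lemma integrable_rearr X : P.-integrable setT (EFin \o rearr X).
Proof.
have mX := measurable_Zspace X; have mq := measurable_rearr mX.
apply: (integrable_same_law (f := X) (h := id)) => //.
  exact: same_law_rearr.
exact: integrable_Zspace.
Qed.

Lemma exists_Zspace_rearr X : exists Y : Zspace p1, {ae P, forall t, Y t = rearr X t}.
Proof.
have mX := measurable_Zspace X; have mq := measurable_rearr mX.
apply: exists_Zspace => //.
exact: (finite_norm_same_law p1 mX mq (same_law_rearr mX) (finite_norm_Zspace X)).
Qed.

Lemma integral_AVaR_avar (m : Pspace R) X :
  (\int[sval m]_(a in `[0%R, 1%R[) AVaR a X =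
   \int[sval m]_(a in `[0%R, 1%R[) (avar (rearr X) a)%:E)%E.
Proof.
by apply: eq_integral => a; rewrite inE/= in_itv/= => a01; rewrite AVaRE.
Qed.

(** The presence of z in the dual makes the product of T m with [rearr X] integrable, as
    [integral_avar] demands. *)
Lemma integral_AVaR (m : Pspace R) (z : Zdual p1) X (Y : Zspace p1) :
  {ae P, forall t, z t = Tmap m t} -> {ae P, forall t, Y t = rearr X t} ->
  (\int[sval m]_(a in `[0%R, 1%R[) AVaR a X = (pairing z Y)%:E)%E.
Proof.
move=> zT YX; rewrite integral_AVaR_avar.
have zT' : {ae P, forall t, z t = Tmap01 m t}.
  by apply: aeS (aeI zT (ae_Tmap01 m)) => t [-> ->].
have mX := measurable_Zspace X; have mq := measurable_rearr mX.
have mT := measurable_Tmap01 m; have mY := measurable_Zspace Y; have mz := measurable_Zdual z.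
rewrite (pairing_ae mT mq zT' YX) integral_avar//; first exact: integrable_rearr.
have /integrableP[_ H] := integrable_pairing z Y.
apply/integrableP; split; first by apply/measurable_EFinP; exact: measurable_funM.
apply: le_lt_trans H; rewrite le_eqVlt; apply/orP; left; apply/eqP.
apply: ae_eq_integral => //.
- by apply: measurableT_comp => //; apply/measurable_EFinP; exact: measurable_funM.
- by apply: measurableT_comp => //; apply/measurable_EFinP; exact: measurable_funM.
- by apply: aeS (aeI zT' YX) => t [-> ->].
Qed.

End AVaR_quantile.

(** * Surjectivity of T onto the spectral functions *)

Section spectral_measure.
Context (R : realType) (sigma : R -> R).
Hypothesis sp : spectral sigma.
Local Notation P := (unif01 R).
Local Notation mu := (@lebesgue_measure R).
Local Notation RT := (measurableTypeR R).

Let sg : RT -> R := sigma \_ `[0, 1[.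

Let sgE t : 0 <= t < 1 -> sg t = sigma t.
Proof. by move=> t01; rewrite /sg patchE mem_set//= in_itv. Qed.

Let sg_ge0 t : 0 <= sg t.
Proof.
rewrite /sg patchE; case: ifPn => //; rewrite inE/= => t01.
by have [_ _ + _] := sp; apply.
Qed.

Let sigma_nd s t : 0 <= s -> s <= t -> t < 1 -> sigma s <= sigma t.
Proof.
move=> s0 st t1; have [_ nd _ _] := sp; apply: nd => //; rewrite in_itv/=.
  by rewrite s0 (le_lt_trans st).
by rewrite t1 (le_trans s0).
Qed.

Let msg : measurable_fun setT sg.
Proof.
apply/(measurable_restrictT _ (measurable_itv _)).
have [_ H _ _] := sp; exact: (measurable_fun_nondecreasing_in H).
Qed.

Let sg_int : (\int[P]_t (sg t)%:E = 1)%E.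
Proof.
rewrite (integral_unif01 (f := EFin \o sg)); last exact/measurable_EFinP.
have [_ _ _ <-] := sp.
rewrite integral_mkcond [RHS]integral_mkcond; apply: eq_integral => t _.
rewrite !patchE/= /sg patchE; case: (boolP (t \in `[0%R, 1%R]%classic)) => h1.
  by case: ifPn.
case: ifPn => //; rewrite inE/= in_itv/= => /andP[t0 t1].
by move: h1; rewrite notin_setE/= in_itv/= t0 (ltW t1).
Qed.

Let g (s : RT) : RT := fine (P [set t | sg t < s]).

Let gE s : (g s)%:E = P [set t | sg t < s].
Proof. by rewrite fineK// fin_num_measure//; exact: measurable_lt_cst. Qed.

Let g_ge0 s : 0 <= g s.
Proof. by rewrite fine_ge0. Qed.

Let mg : measurable_fun setT g.
Proof.
apply: nondecreasing_measurable => // x y xy.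
rewrite -lee_fin !gE; apply: le_measure; rewrite ?inE; try exact: measurable_lt_cst.
by move=> t /= /lt_le_trans; apply.
Qed.

(** [g] is the generalised inverse of sigma. Left to right is where right continuity enters: if
    sigma(a) < s then sigma < s up to some x > a, so that g s >= x > a. The converse is
    monotonicity. *)
Let g_le a s : 0 <= a < 1 -> (g s <= a) <-> (s <= sigma a).
Proof.
move=> /[dup] a01 /andP[a0 a1]; split.
- move=> ga; rewrite leNgt; apply/negP => sa.
  have [+ _ _ _] := sp; move=> /(_ a); rewrite in_itv/= => /(_ a01) rc.
  have H1 : \forall x \near a^'+, sigma x < s by exact: (cvgr_lt _ rc).
  have H2 : \forall x \near a^'+, a < x by exact: nbhs_right_gt.
  have H3 : \forall x \near a^'+, x < 1 by exact: nbhs_right_lt.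
  have [x [xs [ax x1]]] := @filter_ex _ _ (at_right_proper_filter a) _
    (filterI H1 (filterI H2 H3)).
  move: ga; apply/negP; rewrite -ltNge; apply: (lt_le_trans ax).
  have x01 : 0 <= x <= 1 by rewrite (ltW x1) (le_trans a0 (ltW ax)).
  rewrite -lee_fin gE -(unif01_itvNyc x01); apply: ae_le_measure => //.
    exact: measurable_lt_cst.
  apply: aeS (ae_unif01_ge0 R) => t /andP[t0 t1] /=; rewrite in_itv/= => tx.
  by rewrite sgE ?t0// (le_lt_trans _ xs)// sigma_nd.
- move=> sa; have a01' : 0 <= a <= 1 by rewrite a0 ltW.
  rewrite -lee_fin gE -(unif01_itvNyo a01'); apply: ae_le_measure => //.
    exact: measurable_lt_cst.
  apply: aeS (ae_unif01_ge0 R) => t /andP[t0 t1] /=; rewrite in_itv/= sgE ?t0// => ts.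
  rewrite ltNge; apply/negP => at_.
  by move: ts; rewrite ltNge => /negP; apply; rewrite (le_trans sa)// sigma_nd.
Qed.

(** The subgraph of sigma, of total mass the integral of sigma. For s >= 0 its section at height s
    is [[g s, 1[], of mass 1 - g s; restricting the product measure to D thus produces the density 1
    - g s and inherits sigma-additivity. *)
Let D : set (RT * RT) := [set z | [&& 0 <= z.1, z.1 <= sg z.2, 0 <= z.2 & z.2 < 1]].

Let mD : measurable D.
Proof.
have m1 : measurable_fun setT (fun z : RT * RT => [&& 0 <= z.1, z.1 <= sg z.2, 0 <= z.2 & z.2 < 1]).
  apply: measurable_and.
    by apply: measurable_fun_ler; [exact: measurable_cst|exact: measurable_fst].
  apply: measurable_and.
    apply: measurable_fun_ler; first exact: measurable_fst.
    by apply: measurableT_comp => //; exact: measurable_snd.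
  apply: measurable_and.
    by apply: measurable_fun_ler; [exact: measurable_cst|exact: measurable_snd].
  by apply: measurable_fun_ltr; [exact: measurable_snd|exact: measurable_cst].
by have := m1 measurableT [set true] I; rewrite setTI.
Qed.

Let phi (z : RT * RT) : RT := g z.1.

Let mphi : measurable_fun setT phi.
Proof. by apply: (measurableT_comp mg); exact: measurable_fst. Qed.

(* [T^-1 sigma]: as [sigma t] is the length of [{s | 0 <= s <= sigma t}] and
   [s <= sigma t] amounts to [g s <= t], the measure
   [B |-> \int_{s >= 0, g s \in B} (1 - g s) ds] has image [sigma] under [T]. *)
Definition spectral_measure (B : set RT) : \bar R := (mu \x P)%E (phi @^-1` B `&` D).

Let mphiB (B : set RT) : measurable B -> measurable (phi @^-1` B).
Proof. by move=> mB; have := mphi measurableT mB; rewrite setTI. Qed.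

Let nu0 : spectral_measure set0 = 0%E.
Proof. by rewrite /spectral_measure preimage_set0 set0I measure0. Qed.

Let nu_ge0 B : (0 <= spectral_measure B)%E.
Proof. exact: (measure_ge0 (mu \x P)%E). Qed.

Let nu_sigma_additive : semi_sigma_additive spectral_measure.
Proof.
move=> F mF tF mUF; rewrite /spectral_measure preimage_bigcup setI_bigcupl.
apply: (@measure_semi_sigma_additive _ _ _ (mu \x P)%E).
- by move=> n; apply: measurableI => //; exact: mphiB.
- apply/trivIsetP => /= i j _ _ ij; rewrite setIACA -preimage_setI.
  by move/trivIsetP : tF => /(_ _ _ _ _ ij) ->//; rewrite preimage_set0 set0I.
- by rewrite -setI_bigcupl -preimage_bigcup; apply: measurableI => //; exact: mphiB.
Qed.

HB.instance Definition _ := isMeasure.Build _ RT R spectral_measure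
  nu0 nu_ge0 nu_sigma_additive.

Let leb0 s : 0 <= s -> mu `[0, s]%classic = s%:E.
Proof.
move=> s0; rewrite lebesgue_measure_itv/= lte_fin.
by move: s0; rewrite le_eqVlt => /predU1P[<-|->]; rewrite ?ltxx// oppr0 addr0.
Qed.

Let prodD : (mu \x P)%E D = 1%E.
Proof.
have mfD : measurable_fun setT (EFin \o (\1_D : RT * RT -> R)).
  by apply/measurable_EFinP; exact: (@measurable_indic _ (RT * RT)%type R setT D mD).
transitivity (\int[mu \x P]_z (\1_D z)%:E)%E.
  by rewrite (@integral_indic _ _ R (mu \x P)%E setT measurableT D mD) setIT.
rewrite (fubini_tonelli2 (EFin \o \1_D))/=; last 2 first.
- exact: mfD.
- by move=> z; rewrite lee_fin.
rewrite -sg_int; apply: eq_integral => t _; rewrite /fubini_G.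
have [t01|t01] := boolP (0 <= t < 1); last first.
  rewrite integral0_eq; last first.
    move=> s _ /=; rewrite indicE memNset// => /and4P[/= _ _ t0 t1].
    by move: t01; rewrite t0 t1.
  by rewrite /sg patchE memNset// /= in_itv/=; exact/negP.
under eq_integral => s _.
  rewrite /= (_ : \1_D (s, t) = \1_(`[0%R, sg t]%classic : set RT) s); last first.
    by apply: eq_indic; rewrite /D/= in_itv/= t01 andbT.
  over.
rewrite (integral_indic mu measurableT); last exact: measurable_itv.
by rewrite setIT; exact: leb0.
Qed.

Let nu_setT : spectral_measure setT = 1%:E.
Proof. by rewrite /spectral_measure preimage_setT setTI prodD. Qed.

HB.instance Definition _ := @Measure_isProbability.Build _ RT R spectral_measure nu_setT.

Let nu01 : spectral_measure `[0%R, 1%R[%classic = 1%E.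
Proof.
rewrite /spectral_measure (_ : _ `&` D = D) ?prodD//.
apply/setIidr => -[s t] /and4P[/= s0 st t0 t1].
rewrite /phi/= in_itv/= g_ge0/=.
have t01 : 0 <= t < 1 by rewrite t0.
rewrite sgE// in st.
by apply: le_lt_trans t1; apply/g_le.
Qed.

Let m : Pspace R := exist _ (spectral_measure : probability RT R) nu01.

(** On the part of D where g s <= t, the factor (1 - g s)^-1 cancels the mass 1 - g s of the section
    at height s. What remains is the length of the set of those s, namely [[0, sigma t]]. *)
Lemma Tmap_surj : exists m : Pspace R, {ae P, forall t, Tmap m t = sigma t}.
Proof.
exists m; apply: aeS (ae_unif01_ge0 R) => t /[dup] t01 /andP[t0 t1].
pose h (a : RT) : \bar R := ((1 - a)^-1)%:E.
pose I : set RT := `[0, t]%classic.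
have mI : measurable I by exact: measurable_itv.
pose E := phi @^-1` I; have mE : measurable E by exact: mphiB.
have mh : measurable_fun setT h by apply/measurable_EFinP; exact: measurable_inv_onem.
have h0 a : I a -> (0 <= h a)%E.
  rewrite /I/= in_itv/= => /andP[_ at_]; rewrite lee_fin invr_ge0 subr_ge0.
  by rewrite (le_trans at_)// ltW.
have mhphi : measurable_fun setT (h \o phi) by exact: (measurableT_comp mh).
suff H : (\int[spectral_measure]_(a in I) h a = (sigma t)%:E)%E.
  by rewrite /Tmap /Rintegral /=; rewrite H.
transitivity (\int[pushforward (mrestr (mu \x P)%E mD) phi]_(a in I) h a)%E.
  by apply: eq_measure_integral.
rewrite ge0_integral_pushforward//; last 2 first.
- exact: measurable_funTS.
- by move=> a; rewrite inE; exact: h0.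
have mDc : measurable (~` D) by exact: measurableC.
(* The complement of D is null for the restricted measure, so the domain shrinks to E and D, where
   that measure is the product measure. *)
rewrite (@ge0_negligible_integral _ _ R (mrestr (mu \x P)%E mD) E (~` D) (h \o phi) mDc mE); last 3 first.
- exact: measurable_funTS.
- by move=> z; exact: h0.
- by rewrite /= /mrestr setICl measure0.
rewrite setDE setCK.
have mED : measurable (E `&` D) by exact: measurableI.
rewrite (@eq_measure_integral _ _ _ _ (mu \x P)%E); last first.
  by move=> A mA AE; rewrite /= /mrestr; congr (product_measure1 _ _ _); apply/setIidl => z /AE [].
rewrite integral_mkcond (fubini_tonelli1 ((h \o phi) \_ (E `&` D))); last 2 first.
- by apply/(measurable_restrictT _ mED); exact: measurable_funTS.
- by move=> z; rewrite patchE; case: ifPn => //; rewrite inE => -[Ez _]; exact: h0.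
transitivity (\int[mu]_s (\1_(`[0%R, sigma t]%classic : set RT) s)%:E)%E; last first.
  rewrite (integral_indic mu measurableT); last exact: measurable_itv.
  by rewrite setIT -sgE//; exact: leb0.
apply: eq_integral => s _; rewrite /fubini_F.
have [sI|sI] := pselect (`[0%R, sigma t]%classic s); last first.
  rewrite indicE memNset// integral0_eq// => u _; rewrite patchE memNset// => -[].
  rewrite /E/I/= in_itv/= => /andP[_ /(g_le _ t01) st] /and4P[/= s0 _ _ _].
  by apply: sI; rewrite /= in_itv/= s0.
rewrite indicE mem_set//.
move: (sI); rewrite /= in_itv/= => /andP[s0 st].
have gt : g s <= t by apply/g_le.
have g01 : 0 <= g s <= 1 by rewrite g_ge0 (le_trans gt)// ltW.
transitivity (\int[P]_u ((1 - g s)^-1%:E * (\1_(`[g s, +oo[%classic : set RT) u)%:E))%E.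
  apply: ae_eq_integral => //.
  - have H : measurable_fun setT ((h \o phi) \_ (E `&` D)).
      by apply/(measurable_restrictT _ mED); exact: measurable_funTS.
    by apply: (measurableT_comp H); exact: measurable_pair1.
  - by apply: measurable_funeM; apply/measurable_EFinP/measurable_indic; exact: measurable_itv.
  apply: aeS (ae_unif01_ge0 R) => u u01 _; rewrite patchE indicE.
  have key : (E `&` D) (s, u) <-> `[g s, +oo[%classic u.
    rewrite /E/I/D/phi/= !in_itv/= andbT; split.
      by move=> [_ /and4P[_ + _ _]]; rewrite sgE// => su; exact: (g_le s u01).2.
    move=> gu; have su : s <= sigma u by exact: (g_le s u01).1 gu.
    by split; [rewrite g_ge0 gt|rewrite s0 sgE// su].

  have [k|k] := pselect (`[g s, +oo[%classic u).
    rewrite (mem_set k) mem_set; last exact/key.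
    by rewrite mule1.
  rewrite (memNset k) memNset; first by rewrite mule0.
  by move=> /key.
have mgi : measurable (`[g s, +oo[%classic : set RT) by exact: measurable_itv.
have Pg : P (`[g s, +oo[%classic : set RT) = (1 - g s)%:E.
  have -> : (`[g s, +oo[%classic : set RT) = ~` (`]-oo, g s[%classic : set RT).
    by apply/seteqP; split => z; rewrite /= !in_itv/= andbT leNgt => /negP.
  by rewrite probability_setC ?unif01_itvNyo// ?EFinB//; exact: measurable_itv.
rewrite integralZl//; last exact: integrable_indic.
rewrite (integral_indic P measurableT)// setIT.
transitivity (((1 - g s)^-1)%:E * (1 - g s)%:E)%E; first by congr (_ * _)%E.
by rewrite -EFinM mulVf// subr_eq0 gt_eqF// (le_lt_trans gt).
Qed.

End spectral_measure.

(** * Exposed points of the dual set *)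

Section weighted_sum.
Context (R : realType).
Implicit Types (c d : nat -> R) (M : R).

(** The weights sum to 1, so bounds on the terms pass to the sum; they are all positive, so a
    weighted sum of squares vanishes only if every term does. Applied to moments, this gives a
    scalar product on the dual set. *)
Definition wsum c : R := limn (series (fun k => 2^-1 ^+ k.+1 * c k)).

Let partial c n : series (fun k => 2^-1 ^+ k.+1 * c k) n = \sum_(i < n) 2^-1 ^+ i.+1 * c i.
Proof. by rewrite /series/= big_mkord. Qed.

(** The weights with indices from n to n + j - 1 add up to 2^-n - 2^-(n + j). *)
Let partial_le c M n j : (forall k, `|c k| <= M) ->
  `|\sum_(i < (n + j)%N) 2^-1 ^+ i.+1 * c i - \sum_(i < n) 2^-1 ^+ i.+1 * c i| <=
  M * (2^-1 ^+ n - 2^-1 ^+ (n + j)).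
Proof.
move=> cM; elim: j => [|j IH]; first by rewrite addn0 !subrr normr0 mulr0.
rewrite addnS big_ord_recr /= -addrA (addrC (_ * c _)) addrA.
apply: (le_trans (ler_normD _ _)).
have -> : M * (2^-1 ^+ n - 2^-1 ^+ (n + j).+1) =
    M * (2^-1 ^+ n - 2^-1 ^+ (n + j)) + 2^-1 ^+ (n + j).+1 * M.
  by rewrite exprS; field.
apply: lerD => //; rewrite normrM ger0_norm ?exprn_ge0 ?invr_ge0//.
by rewrite ler_pM2l// exprn_gt0// invr_gt0.
Qed.

Lemma cvg_wsum c M : (forall k, `|c k| <= M) ->
  \sum_(i < n) 2^-1 ^+ i.+1 * c i @[n --> \oo] --> wsum c.
Proof.
move=> cM; rewrite (_ : (fun n => _) = series (fun k => 2^-1 ^+ k.+1 * c k)); last first.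
  by apply/funext => n; rewrite partial.
suff : cvgn (series (fun k => 2^-1 ^+ k.+1 * c k)) by [].
apply: normed_cvg.
have M0 : 0 <= M by apply: le_trans (cM 0%N).
apply: (@series_le_cvg _ _ (fun k => M * 2^-1 ^+ k)).
- by move=> n; rewrite normr_ge0.
- by move=> n; rewrite mulr_ge0// exprn_ge0// invr_ge0.
- move=> n /=; rewrite normrM ger0_norm ?exprn_ge0 ?invr_ge0//.
  rewrite mulrC; apply: ler_pM; [by []|by rewrite exprn_ge0// invr_ge0|exact: cM|].
  by rewrite exprS ler_piMl ?exprn_ge0 ?invr_ge0// invf_le1 ?ler1n.
- apply: is_cvg_geometric_series.
  by rewrite ger0_norm ?invr_ge0// invf_lt1 ?ltr1n.
Qed.

Lemma wsum_approx c M n : (forall k, `|c k| <= M) ->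
  `|wsum c - \sum_(i < n) 2^-1 ^+ i.+1 * c i| <= M * 2^-1 ^+ n.
Proof.
move=> cM.
have H : `|\sum_(i < m) 2^-1 ^+ i.+1 * c i - \sum_(i < n) 2^-1 ^+ i.+1 * c i| @[m --> \oo] -->
    `|wsum c - \sum_(i < n) 2^-1 ^+ i.+1 * c i|.
  by apply: cvg_norm; apply: cvgB; [exact: cvg_wsum cM|exact: cvg_cst].
apply: (cvgr_to_le H); exists n => // m /= nm.
rewrite -(subnKC nm); apply: (le_trans (partial_le _ _ cM)).
apply: ler_wpM2l; first by apply: le_trans (cM 0%N).
by rewrite gerBl exprn_ge0// invr_ge0.
Qed.

Lemma wsum_le c M : (forall k, `|c k| <= M) -> `|wsum c| <= M.
Proof. by move=> cM; have := wsum_approx 0 cM; rewrite big_ord0 subr0 expr0 mulr1. Qed.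

Lemma wsumD c d M N (a b : R) : (forall k, `|c k| <= M) -> (forall k, `|d k| <= N) ->
  wsum (fun k => a * c k + b * d k) = a * wsum c + b * wsum d.
Proof.
move=> cM dN.
have bd k : `|a * c k + b * d k| <= `|a| * M + `|b| * N.
  by apply: (le_trans (ler_normD _ _)); rewrite !normrM lerD// ler_wpM2l.
suff H : \sum_(i < n) 2^-1 ^+ i.+1 * (a * c i + b * d i) @[n --> \oo] -->
    a * wsum c + b * wsum d.
  exact: (cvg_unique _ (cvg_wsum bd) H).
have -> : (fun n => \sum_(i < n) 2^-1 ^+ i.+1 * (a * c i + b * d i)) =
    (fun n => a * \sum_(i < n) 2^-1 ^+ i.+1 * c i + b * \sum_(i < n) 2^-1 ^+ i.+1 * d i).
  apply/funext => n; rewrite !mulr_sumr -big_split/=; apply: eq_bigr => i _.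
  by rewrite mulrDr !mulrA ![_ * a]mulrC ![_ * b]mulrC.
by apply: cvgD; apply: cvgMr; [exact: cvg_wsum cM|exact: cvg_wsum dN].
Qed.

Lemma wsum_ge_term c M k : (forall k, `|c k| <= M) -> (forall k, 0 <= c k) ->
  2^-1 ^+ k.+1 * c k <= wsum c.
Proof.
move=> cM c0; apply: (cvgr_to_ge (cvg_wsum cM)); exists k.+1 => // n /= kn.
rewrite (bigD1 (Ordinal kn))//= lerDl; apply: sumr_ge0 => i _.
by rewrite mulr_ge0// exprn_ge0// invr_ge0.
Qed.

(** The tails are at most M 2^-n uniformly along the filter, which leaves a finite sum. A general
    filter is allowed because the weak* topology is handled without sequences. *)
Lemma cvg_wsum_ptws (T : Type) (F : set_system T) {FF : Filter F}
    (u : T -> nat -> R) (l : nat -> R) M :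
  (\forall x \near F, forall k, `|u x k| <= M) -> (forall k, `|l k| <= M) ->
  (forall k, u x k @[x --> F] --> l k) -> wsum (u x) @[x --> F] --> wsum l.
Proof.
move=> uM lM ul; apply/cvgrPdist_le => e e0.
have M0 : 0 <= M by apply: le_trans (lM 0%N).
have [n ne] : exists n, M * 2^-1 ^+ n <= e / 3.
  have H : M * 2^-1 ^+ n @[n --> \oo] --> 0.
    apply: cvg_geometric; by rewrite ger0_norm ?invr_ge0// invf_lt1 ?ltr1n.
  have e3 : 0 < e / 3 by rewrite divr_gt0.
  have [n _ /(_ n)] := cvgr_le _ H (e / 3) e3.
  by move=> /(_ (leqnn n)) ?; exists n.
have /cvgrPdist_le/(_ (e / 3)) := @cvg_sum_ord R T F FF (fun i => 2^-1 ^+ i.+1) n u l ul.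
rewrite divr_gt0// => /(_ isT) uln.
near=> x.
have xM : forall k, `|u x k| <= M by near: x.
have xn : `|\sum_(i < n) 2^-1 ^+ i.+1 * l i - \sum_(i < n) 2^-1 ^+ i.+1 * u x i| <= e / 3.
  by near: x.
have h1 := le_trans (wsum_approx n lM) ne.
have h2 := le_trans (wsum_approx n xM) ne.
move: h1 h2 xn; rewrite !ler_norml => /andP[? ?] /andP[? ?] /andP[? ?].
by apply/andP; split; lra.
Unshelve. all: by end_near. Qed.

End weighted_sum.

(** * Moments of elements of the dual *)

Section moments.
Context (R : realType) (p : R) (p1 : (1 <= p%:E)%E).
Local Notation P := (unif01 R).
Local Notation RT := (measurableTypeR R).
Implicit Types (X Y W : Zspace p1) (z : Zdual p1).

Lemma pairing_bound z X (K : R) : density z -> {ae P, forall t, `|X t| <= K} ->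
  `|pairing z X| <= K.
Proof.
move=> dz XK; have iz := integrable_Zdual z.
have KzE : \int[P]_t (K * z t) = K by rewrite RintegralZl// density_int// mulr1.
have iKz : P.-integrable setT (EFin \o (fun t => K * z t)).
  rewrite (_ : _ \o _ = (fun t => K%:E * (z t)%:E)%E); last by apply/funext => t /=; rewrite EFinM.
  exact: integrableZl.
have H : {ae P, forall t, `|z t * X t| <= K * z t}.
  apply: aeS (aeI (density_ge0 dz) XK) => t [z0 Xt].
  by rewrite normrM (ger0_norm z0) mulrC ler_wpM2r.
rewrite ler_norml pairingE; apply/andP; split.
  rewrite lerNl -KzE -mulN1r -RintegralZl//; last exact: integrable_pairing.
  apply: ae_le_Rintegral => //.
    rewrite (_ : _ \o _ = (fun t => (-1)%:E * (z t * X t)%:E)%E); last first.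
      by apply/funext => t /=; rewrite -EFinM.
    by apply: integrableZl => //; exact: integrable_pairing.
  by apply: aeS H => t; rewrite ler_norml mulN1r lerNl => /andP[].
rewrite -KzE; apply: ae_le_Rintegral => //; first exact: integrable_pairing.
by apply: aeS H => t; rewrite ler_norml => /andP[].
Qed.

Lemma exists_Zspace_monomial k : exists X, {ae P, forall t, X t = t ^+ k}.
Proof.
apply: (@exists_Zspace_bounded _ _ _ _ 1); first exact: measurable_funX.
apply: aeS (ae_unif01_ge0 R) => t /andP[t0 t1].
by rewrite ger0_norm ?exprn_ge0// exprn_ile1// ltW.
Qed.

Definition Zmonomial k : Zspace p1 := projT1 (cid (exists_Zspace_monomial k)).

Lemma ae_Zmonomial k : {ae P, forall t, Zmonomial k t = t ^+ k}.
Proof. exact: projT2 (cid (exists_Zspace_monomial k)). Qed.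

Definition Zmoment z k : R := pairing z (Zmonomial k).

Lemma ZmomentE z k : Zmoment z k = \int[P]_t (z t * t ^+ k).
Proof.
apply: pairing_ae; [exact: measurable_Zdual|exact: measurable_funX|exact: aeT|exact: ae_Zmonomial].
Qed.

Lemma Zmoment_le1 z k : density z -> `|Zmoment z k| <= 1.
Proof.
move=> dz; apply: pairing_bound => //.
apply: aeS (aeI (ae_Zmonomial k) (ae_unif01_ge0 R)) => t [-> /andP[t0 t1]].
by rewrite ger0_norm ?exprn_ge0// exprn_ile1// ltW.
Qed.

Lemma Zmoment_inj z z' : (forall k, Zmoment z k = Zmoment z' k) -> z = z'.
Proof.
move=> H; apply: Zdual_ae_eq.
have [w wE] := exists_Zdual_lin z z' 1 (-1).
have w0 : {ae P, forall t, w t = 0}.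
  apply: moments_eq0; first exact: integrable_Zdual.
  by move=> k; rewrite -ZmomentE /Zmoment (pairing_linl _ wE) -!/(Zmoment _ _) H; ring.
by apply: aeS (aeI wE w0) => t [-> /eqP]; rewrite mul1r mulN1r subr_eq0 => /eqP.
Qed.

Lemma continuous_Zmoment k : continuous (fun z => Zmoment z k).
Proof. exact: continuous_pairing. Qed.

(** The moments are continuous and separate points. This makes the compact set A closed. *)
Lemma Zdual_hausdorff : hausdorff_space (Zdual p1).
Proof.
move=> z z' zz'; apply: Zmoment_inj => k; apply: (@Rhausdorff R) => B C Bz Cz'.
have [w [Bw Cw]] := zz' _ _ (@continuous_Zmoment k z B Bz) (@continuous_Zmoment k z' C Cz').
by exists (Zmoment w k).
Qed.

Let exists_Zpoly (c : nat -> R) n : exists W,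
  {ae P, forall t, W t = \sum_(i < n) c i * t ^+ i} /\
  forall z, pairing z W = \sum_(i < n) c i * Zmoment z i.
Proof.
elim: n => [|n [W [WE pW]]].
  have [W WE] := exists_Zspace_lin (Zmonomial 0) (Zmonomial 0) 0 0.
  exists W; split.
    by apply: aeS WE => t ->; rewrite big_ord0 !mul0r addr0.
  by move=> z; rewrite (pairing_linr _ WE) big_ord0 !mul0r addr0.
have [W' WE'] := exists_Zspace_lin W (Zmonomial n) 1 (c n).
exists W'; split.
  apply: aeS (aeI WE' (aeI WE (ae_Zmonomial n))) => t [-> [-> ->]].
  by rewrite big_ord_recr/= mul1r.
by move=> z; rewrite (pairing_linr _ WE') big_ord_recr/= mul1r pW.
Qed.

(** Truncations of the power series are polynomials within M 2^-n of it on [0, 1), and pairing with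
    a density does not increase a uniform bound; hence the pairing may be computed term by term. *)
Lemma exists_Zseries (a : nat -> R) (M : R) : (forall k, `|a k| <= M) -> exists Y,
  {ae P, forall t, Y t = wsum (fun k => a k * t ^+ k)} /\
  forall z, density z -> pairing z Y = wsum (fun k => a k * Zmoment z k).
Proof.
move=> aM.
have M0 : 0 <= M by apply: le_trans (aM 0%N).
have at_le (t : R) : 0 <= t <= 1 -> forall k, `|a k * t ^+ k| <= M.
  move=> /andP[t0 t1] k; rewrite normrM -[leRHS]mulr1; apply: ler_pM => //.
  by rewrite ger0_norm ?exprn_ge0// exprn_ile1.
pose G : RT -> R := (fun t => wsum (fun k => a k * t ^+ k)) \_ `[0, 1].
have GE (t : R) : 0 <= t < 1 -> G t = wsum (fun k => a k * t ^+ k).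
  by move=> /andP[t0 t1]; rewrite /G patchE mem_set//= in_itv/= t0 ltW.
have mG : measurable_fun setT G.
  apply/(measurable_restrictT _ (measurable_itv _)).
  apply: (@measurable_fun_cvg _ RT R `[0, 1]%classic
    (fun n (t : RT) => \sum_(i < n) 2^-1 ^+ i.+1 * (a i * t ^+ i))).
    move=> n; apply: measurable_funTS; apply: measurable_sum => i.
    by apply: measurable_funM => //; apply: measurable_funM => //; exact: measurable_funX.
  by move=> t /=; rewrite in_itv/= => /at_le/cvg_wsum.
have [Y YE] : exists Y, {ae P, forall t, Y t = G t}.
  apply: (@exists_Zspace_bounded _ _ _ _ M) => //.
  apply: aeS (ae_unif01_ge0 R) => t /[dup] t01 /andP[t0 t1].
  by rewrite GE//; apply/wsum_le/at_le; rewrite t0 ltW.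
have YE' : {ae P, forall t, Y t = wsum (fun k => a k * t ^+ k)}.
  by apply: aeS (aeI YE (ae_unif01_ge0 R)) => t [-> /GE].
exists Y; split=> // z dz; apply/eqP; rewrite -subr_eq0 -normr_le0.
have az k : `|a k * Zmoment z k| <= M.
  by rewrite normrM -[leRHS]mulr1; apply: ler_pM => //; exact: Zmoment_le1.
have key n : `|pairing z Y - wsum (fun k => a k * Zmoment z k)| <= (M + M) * 2^-1 ^+ n.
  have [W [WE pW]] := exists_Zpoly (fun i => 2^-1 ^+ i.+1 * a i) n.
  have [D DE] := exists_Zspace_lin Y W 1 (-1).
  have h1 : `|pairing z D| <= M * 2^-1 ^+ n.
    apply: pairing_bound => //.
    apply: aeS (aeI (aeI DE YE') (aeI WE (ae_unif01_ge0 R))) => t [[-> ->] [-> /andP[t0 t1]]].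
    rewrite mul1r mulN1r; under eq_bigr do rewrite -mulrA.
    by apply/wsum_approx/at_le; rewrite t0 ltW.
  have h2 := wsum_approx n az.
  move: h1; rewrite (pairing_linr _ DE) pW mul1r mulN1r.
  under eq_bigr do rewrite -mulrA.
  move: h2; rewrite !ler_norml mulrDl => /andP[? ?] /andP[? ?].
  by apply/andP; split; lra.
have H : (M + M) * 2^-1 ^+ n @[n --> \oo] --> 0.
  by apply: cvg_geometric; rewrite ger0_norm ?invr_ge0// invf_lt1 ?ltr1n.
by apply: (cvgr_to_ge H); exists 0%N => // n _; exact: key.
Qed.

End moments.

(** * The dual set: maximisers, separation, exposed points *)

Section dual_set_lemmas.
Context (R : realType) (p : R) (p1 : (1 <= p%:E)%E).
Context (rho : Zspace p1 -> R) (A : set (Zdual p1)).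
Hypothesis dualA : dual_set rho A.
Local Notation P := (unif01 R).
Local Notation RT := (measurableTypeR R).
Implicit Types (X Y W : Zspace p1) (z : Zdual p1).

Lemma dual_density z : A z -> density z.
Proof. by have [_ _ + _] := dualA; apply. Qed.

Lemma dual_le z X : A z -> pairing z X <= rho X.
Proof.
move=> Az; rewrite -lee_fin; have [_ _ _ ->] := dualA.
by apply: ereal_sup_ubound; exists z.
Qed.

Lemma dual_nonempty : A !=set0.
Proof.
have [X _] := exists_Zspace_monomial p1 0.
apply/set0P/negP => /eqP A0; have [_ _ _ /(_ X)] := dualA.
by rewrite A0 image_set0 ereal_sup0.
Qed.

Lemma dual_pairing_max X (B : set (Zdual p1)) : B !=set0 -> compact B ->
  exists2 z, B z & forall z', B z' -> pairing z' X <= pairing z X.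
Proof.
move=> B0 cB.
have [|z zB zmax] := @compact_EVT_max _ R (fun z => pairing z X) B B0 cB.
  by apply: continuous_subspaceT; exact: continuous_pairing.
by exists z => [|z' ?]; [exact: set_mem|apply: zmax; exact: mem_set].
Qed.

Lemma dual_max X : exists2 z, A z & pairing z X = rho X.
Proof.
have [_ cA _ rhoE] := dualA.
have [z Az zmax] := dual_pairing_max X dual_nonempty cA.
exists z => //; apply/eqP; rewrite eq_le dual_le//= -lee_fin rhoE.
by apply: ub_ereal_sup => _ [z' Az' <-]; rewrite lee_fin zmax.
Qed.

Let normM_le (a b M N : R) : `|a| <= M -> `|b| <= N -> `|a * b| <= M * N.
Proof. by move=> aM bN; rewrite normrM ler_pM. Qed.

Let normB_le (a b : R) : `|a| <= 1 -> `|b| <= 1 -> `|a - b| <= 2.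
Proof. by move=> aM bN; rewrite (le_trans (ler_normB _ _))// -[2]/(1 + 1) lerD. Qed.

Let wsum_sqr0 (c : nat -> R) M : (forall k, `|c k| <= M) ->
  wsum (fun k => c k * c k) <= 0 -> forall k, c k = 0.
Proof.
move=> cM c0 k; have cM2 j : `|c j * c j| <= M * M by exact: normM_le.
have := le_trans (wsum_ge_term k cM2 (fun j => sqr_ge0 (c j))) c0.
rewrite pmulr_rle0; last by rewrite exprn_gt0// invr_gt0.
by move=> H; apply/eqP; rewrite -sqrf_eq0 eq_le H sqr_ge0.
Qed.

Let continuous_wsum (u : Zdual p1 -> nat -> R) M :
  (forall z, A z -> forall k, `|u z k| <= M) -> (forall k, continuous (u ^~ k)) ->
  {within A, continuous (fun z => wsum (u z))}.
Proof.
move=> uM cu; apply/subspace_continuousP => z Az.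
apply: (@cvg_wsum_ptws _ _ _ _ u (u z) M); last 2 first.
- exact: uM.
- by move=> k; apply: cvg_within_filter; exact: cu.
by apply: filterS (withinT _ _) => x Ax; exact: uM.
Qed.

(* Replaces Hahn-Banach separation: the point of the compact set [A] closest to
   [zeta], in a distance built from the moments, provides the separating
   variable. *)
Lemma dual_mem zeta : density zeta -> (forall Y, pairing zeta Y <= rho Y) -> A zeta.
Proof.
move=> dzeta zetarho.
pose d z k := Zmoment z k - Zmoment zeta k.
have dle z k : A z -> `|d z k| <= 2.
  by move=> Az; apply: normB_le; apply: Zmoment_le1 => //; exact: dual_density.
have [cvA cA _ _] := dualA.
have [|z0 /set_mem Az0 z0min] :=
    @compact_EVT_min _ R (fun z => wsum (fun k => d z k * d z k)) A dual_nonempty cA.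
  apply: (@continuous_wsum (fun z k => d z k * d z k) (2 * 2)).
    by move=> z Az k; apply: normM_le; exact: dle.
  have cd k : continuous (fun z => d z k).
    move=> z; apply: (@continuousB R R^o (Zdual p1)); first exact: continuous_Zmoment.
    exact: cst_continuous.
  by move=> k z; apply: (@continuousM R (Zdual p1)); exact: cd.
have d0le k : `|d z0 k| <= 2 by exact: dle.
have m0le k : `|Zmoment z0 k| <= 1 by apply: Zmoment_le1; exact: dual_density.
have mzle k : `|Zmoment zeta k| <= 1 by exact: Zmoment_le1.
have d00le k : `|d z0 k * d z0 k| <= 2 * 2 by exact: normM_le.
(* Variational inequality at the closest point: were b negative, a small step from z0 towards z,
   which stays in A by convexity, would decrease the distance to zeta. *)
have var z : A z -> 0 <= wsum (fun k => d z0 k * (Zmoment z k - Zmoment z0 k)).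
  move=> Az; set b := wsum _.
  pose e k := Zmoment z k - Zmoment z0 k.
  have ele k : `|e k| <= 2 by apply: normB_le; apply: Zmoment_le1; exact: dual_density.
  have dele k : `|d z0 k * e k| <= 2 * 2 by exact: normM_le.
  have eele k : `|e k * e k| <= 2 * 2 by exact: normM_le.
  pose c := wsum (fun k => e k * e k).
  have c0 : 0 <= c.
    have := wsum_ge_term 0 eele (fun k => sqr_ge0 (e k)).
    by apply: le_trans; rewrite mulr_ge0 ?sqr_ge0// exprn_ge0// invr_ge0.
  have quad t : 0 <= t <= 1 -> 0 <= 2 * t * b + t ^+ 2 * c.
    move=> t01; have [zt ztE] := exists_Zdual_lin z z0 t (1 - t).
    have Azt : A zt by exact: cvA Az Az0 t01 ztE.
    have := z0min zt (mem_set Azt).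
    have -> : (fun k => d zt k * d zt k) =
        (fun k => 1 * (1 * (d z0 k * d z0 k) + 2 * t * (d z0 k * e k)) + t ^+ 2 * (e k * e k)).
      by apply/funext => k; rewrite /d /e /Zmoment (pairing_linl _ ztE); ring.
    rewrite (@wsumD _ _ _ (2 * 2 + `|2 * t| * (2 * 2)) (2 * 2))//; last first.
      move=> k; rewrite (le_trans (ler_normD _ _))// lerD//; first by rewrite mul1r.
      by rewrite normrM ler_wpM2l.
    rewrite (wsumD 1 (2 * t) d00le dele) !mul1r -/c -/b.
    by move=> H; move: H; rewrite -addrA lerDl.
  rewrite leNgt; apply/negP => b0.
  have cb : 0 < c - b by rewrite subr_gt0 (lt_le_trans b0).
  (* This t lies in ]0, 1] and satisfies t c = t b - b, so that 2 b + t c = b + t b is negative,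
     against [quad]. The denominator is positive even when c = 0. *)
  pose t := - b / (c - b).
  have t0 : 0 < t by rewrite divr_gt0// oppr_gt0.
  have t1 : t <= 1 by rewrite ler_pdivrMr// mul1r addrC lerDl.
  have := quad t; rewrite (ltW t0) t1 => /(_ isT).
  have -> : 2 * t * b + t ^+ 2 * c = t * (2 * b + t * c) by ring.
  rewrite pmulr_rge0//.
  have tc : t * (c - b) = - b by rewrite /t divfK// gt_eqF.
  have tb : t * b <= 0 by rewrite pmulr_rle0// ltW.
  by move: tc; rewrite mulrBr; lra.
(* Y points from z0 towards zeta. Its maximiser z1 over A satisfies <z1, Y> <= <z0, Y> by [var],
   while <zeta, Y> <= rho Y = <z1, Y>; so <zeta - z0, Y>, the squared distance from z0 to zeta, is
   at most 0. *)
have [Y [_ YE]] : exists Y, {ae P, forall t, Y t = wsum (fun k => - d z0 k * t ^+ k)} /\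
    forall z, density z -> pairing z Y = wsum (fun k => - d z0 k * Zmoment z k).
  by apply: (@exists_Zseries _ _ _ _ 2) => k; rewrite normrN.
have wsumN z : density z ->
    wsum (fun k => - d z0 k * Zmoment z k) = - wsum (fun k => d z0 k * Zmoment z k).
  move=> dz; have le k : `|d z0 k * Zmoment z k| <= 2 * 1.
    by apply: normM_le => //; exact: Zmoment_le1.
  transitivity (wsum (fun k => - 1 * (d z0 k * Zmoment z k) + 0 * (d z0 k * Zmoment z k))).
    by congr wsum; apply/funext => k; ring.
  by rewrite (wsumD _ _ le le) mulN1r mul0r addr0.
have [z1 Az1 z1E] := dual_max Y.
have h := zetarho Y.
rewrite -z1E !YE ?wsumN// in h; [|exact: dual_density..].
have diff z : density z -> forall z', density z' ->
    wsum (fun k => d z0 k * (Zmoment z k - Zmoment z' k)) =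
    wsum (fun k => d z0 k * Zmoment z k) - wsum (fun k => d z0 k * Zmoment z' k).
  move=> dz z' dz'.
  have le k : `|d z0 k * Zmoment z k| <= 2 * 1 by apply: normM_le => //; exact: Zmoment_le1.
  have le' k : `|d z0 k * Zmoment z' k| <= 2 * 1 by apply: normM_le => //; exact: Zmoment_le1.
  transitivity (wsum (fun k => 1 * (d z0 k * Zmoment z k) + -1 * (d z0 k * Zmoment z' k))).
    by congr wsum; apply/funext => k; ring.
  by rewrite (wsumD _ _ le le') mul1r mulN1r.
have v1 := var z1 Az1; rewrite diff in v1; [|exact: dual_density..].
have : wsum (fun k => d z0 k * d z0 k) <= 0.
  rewrite [X in wsum X](_ : _ = (fun k => d z0 k * (Zmoment z0 k - Zmoment zeta k)))//.
  rewrite diff//; last exact: dual_density.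
  by rewrite subr_le0; rewrite subr_ge0 in v1; rewrite lerN2 in h; exact: le_trans v1 h.
move=> /(wsum_sqr0 d0le) d0; rewrite -(_ : z0 = zeta)//.
by apply: Zmoment_inj => k; apply/eqP; rewrite -subr_eq0 -/(d z0 k) d0.
Qed.

(* Straszewicz-type density of exposed points: a maximiser of the strictly
   convex perturbation [N <z, X> + 1/2 sum 2^-(k+1) m_k(z)^2] is exposed by its
   gradient [W], which is nondecreasing whenever [X] is. *)
Lemma dual_perturbed_max X (N : R) : exists z0 W, [/\ A z0,
  {ae P, forall t, W t = N * X t + wsum (fun k => Zmoment z0 k * t ^+ k)},
  forall z, A z -> pairing z W <= pairing z0 W,
  forall z, A z -> pairing z W = pairing z0 W -> z = z0 &
  N * rho X <= N * pairing z0 X + 2^-1].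
Proof.
have [_ cA _ _] := dualA.
have mle z k : A z -> `|Zmoment z k| <= 1.
  by move=> Az; apply: Zmoment_le1; exact: dual_density.
have mmle z z' k : A z -> A z' -> `|Zmoment z k * Zmoment z' k| <= 1 * 1.
  by move=> Az Az'; apply: normM_le; exact: mle.
have [|z0 /set_mem Az0 z0max] := @compact_EVT_max _ R
    (fun z => N * pairing z X + 2^-1 * wsum (fun k => Zmoment z k * Zmoment z k))
    A dual_nonempty cA.
  move=> z; apply: cvgD.
    apply: cvgMr; move: z; apply: continuous_subspaceT; exact: continuous_pairing.
  apply: cvgMr; move: z.
  apply: (@continuous_wsum (fun z k => Zmoment z k * Zmoment z k) (1 * 1)).
    by move=> z Az k; exact: mmle.
  by move=> k z; apply: (@continuousM R (Zdual p1)); exact: continuous_Zmoment.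
have [Y [YE pY]] := exists_Zseries p1 (mle z0 ^~ Az0).
have [W WE] := exists_Zspace_lin X Y N 1.
(* With |.| the norm on moment sequences, |m(z)|^2 = |m(z) - m(z0)|^2 + 2 <m(z0), m(z)> - |m(z0)|^2,
   so maximality of z0 for the convex functional turns into maximality for the linear form W, with a
   quadratic margin. *)
have gap z : A z -> pairing z W + 2^-1 * wsum (fun k =>
    (Zmoment z k - Zmoment z0 k) * (Zmoment z k - Zmoment z0 k)) <= pairing z0 W.
  move=> Az; have := z0max z (mem_set Az).
  rewrite !(pairing_linr _ WE) !pY; [|exact: dual_density..].
  have -> : (fun k => (Zmoment z k - Zmoment z0 k) * (Zmoment z k - Zmoment z0 k)) =
      (fun k => 1 * (1 * (Zmoment z k * Zmoment z k) + -2 * (Zmoment z0 k * Zmoment z k))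
                + 1 * (Zmoment z0 k * Zmoment z0 k)).
    by apply/funext => k; ring.
  rewrite (@wsumD _ _ _ (1 * 1 + `|-2| * (1 * 1)) (1 * 1))//; last 2 first.
  - move=> k; rewrite (le_trans (ler_normD _ _))// lerD//; first by rewrite mul1r mmle.
    by rewrite normrM ler_wpM2l// mmle.
  - by move=> k; exact: mmle.
  rewrite (wsumD _ _ (fun k => mmle z z k Az Az) (fun k => mmle z0 z k Az0 Az)).
  by move: (wsum _) (wsum _) (wsum _) (pairing z X) (pairing z0 X) => *; lra.
exists z0, W; split=> //.
- by apply: aeS (aeI WE YE) => t [-> ->]; rewrite mul1r.
- move=> z Az; apply: le_trans (gap z Az); rewrite lerDl mulr_ge0//.
  have le k : `|(Zmoment z k - Zmoment z0 k) * (Zmoment z k - Zmoment z0 k)| <= 2 * 2.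
    by apply: normM_le; apply: normB_le; exact: mle.
  have := wsum_ge_term 0 le (fun k => sqr_ge0 _).
  by apply: le_trans; rewrite mulr_ge0 ?sqr_ge0// exprn_ge0// invr_ge0.
- move=> z Az zE; have := gap z Az; rewrite zE gerDl pmulr_rle0 ?invr_gt0//.
  have le k : `|Zmoment z k - Zmoment z0 k| <= 2 by apply: normB_le; exact: mle.
  move=> /(wsum_sqr0 le) H; apply: Zmoment_inj => k.
  by apply/eqP; rewrite -subr_eq0 H.
(* Half the weighted sum of squared moments lies between 0 and 1/2, so ignoring it costs at most
   1/2. *)
- have [z Az <-] := dual_max X.
  have := z0max z (mem_set Az).
  have h0 := wsum_le (fun k => mmle z0 z0 k Az0 Az0).
  have h1 := wsum_ge_term 0 (fun k => mmle z z k Az Az) (fun k => sqr_ge0 (Zmoment z k)).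
  have h2 : 0 <= wsum (fun k => Zmoment z k * Zmoment z k).
    by apply: le_trans h1; rewrite mulr_ge0 ?sqr_ge0// exprn_ge0// invr_ge0.
  move: h0; rewrite ler_norml => /andP[_ {}h0].
  clear h1; move: h0 h2; move: (wsum _) (wsum _) (pairing z X) (pairing z0 X) => *; lra.
Qed.

End dual_set_lemmas.

(** * Rearranged classes and spectral functions *)

Section rearranged_classes.
Context (R : realType) (p : R) (p1 : (1 <= p%:E)%E).
Local Notation P := (unif01 R).
Local Notation RT := (measurableTypeR R).
Implicit Types (X Y W : Zspace p1) (z : Zdual p1) (f g r : RT -> R).

Lemma exists_Zspace_same_law X f : measurable_fun setT f -> same_law (X : RT -> R) f ->
  exists Y, {ae P, forall t, Y t = f t}.
Proof.
move=> mf Xf; apply: exists_Zspace => //.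
exact: (finite_norm_same_law p1 (measurable_Zspace X) mf Xf (finite_norm_Zspace X)).
Qed.

Lemma exists_Zdual_same_law z f : measurable_fun setT f -> same_law (z : RT -> R) f ->
  exists z', {ae P, forall t, z' t = f t}.
Proof.
move=> mf zf; apply: exists_Zdual => //.
exact: (finite_norm_same_law (hoelder_conj_ge1 p1) (measurable_Zdual z) mf zf
  (finite_norm_Zdual z)).
Qed.

Lemma same_law_comp_uniform f r : measurable_fun setT f -> same_law r id ->
  same_law f (f \o r).
Proof.
move=> mf ru B mB; exact: (esym (same_law_comp mf ru mB)).
Qed.

Lemma pairing_comp z X f g r : measurable_fun setT f -> measurable_fun setT g ->
  measurable_fun setT (r : RT -> RT) -> same_law r id ->
  {ae P, forall t, z t = f (r t)} -> {ae P, forall t, X t = g (r t)} ->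
  pairing z X = \int[P]_t (f t * g t).
Proof.
move=> mf mg mr ru zE XE.
rewrite (pairing_ae (measurableT_comp mf mr) (measurableT_comp mg mr) zE XE).
by apply: (@Rintegral_same_law _ r id (fun t => f t * g t)) => //; exact: measurable_funM.
Qed.

Lemma integrable_rearr_pairing z X :
  P.-integrable setT (fun t => (rearr z t * rearr X t)%:E).
Proof.
have mz := measurable_Zdual z; have mX := measurable_Zspace X.
apply: (integrable_conj p1); try exact: measurable_rearr.
- exact: (finite_norm_same_law (hoelder_conj_ge1 p1) mz (measurable_rearr mz)
    (same_law_rearr mz) (finite_norm_Zdual z)).
- exact: (finite_norm_same_law p1 mX (measurable_rearr mX)
    (same_law_rearr mX) (finite_norm_Zspace X)).
Qed.

Lemma pairing_le_rearr z X : {ae P, forall t, 0 <= z t} ->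
  pairing z X <= \int[P]_t (rearr z t * rearr X t).
Proof.
move=> z0; rewrite pairingE; apply: hardy_littlewood => //.
- exact: measurable_Zdual.
- exact: measurable_Zspace.
- exact: integrable_Zspace.
- exact: integrable_pairing.
- exact: integrable_rearr_pairing.
Qed.

Lemma eq_nondecreasing_rearr (f g : RT -> R) : measurable_fun setT f ->
  {ae P, forall t, f t = g t} -> {in `]0, 1[ &, {homo g : x y / x <= y}} ->
  {ae P, forall t, f t = rearr f t}.
Proof.
move=> mf fg nd.
pose g1 : RT -> R := g \_ `]0, 1[.
have mg1 : measurable_fun setT g1.
  apply/(measurable_restrictT _ (measurable_itv _)).
  exact: (measurable_fun_nondecreasing_in nd).
have fg1 : {ae P, forall t, f t = g1 t}.
  by apply: aeS (aeI fg (ae_unif01_itv R)) => t [-> t01]; rewrite /g1 patchE mem_set.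
rewrite (eq_rearr (ae_eq_same_law mf mg1 fg1)).
have H : {in `]0, 1[ &, {homo g1 : x y / x <= y}}.
  by move=> x y x01 y01 xy; rewrite /g1 !patchE !mem_set// nd.
by apply: aeS (aeI fg1 (nondecreasing_rearr mg1 H)) => t [->].
Qed.

Lemma spectral_classes_rearr z : spectral_classes p1 z -> {ae P, forall t, z t = rearr z t}.
Proof.
move=> [sigma [_ nd _ _] zE]; apply: (@eq_nondecreasing_rearr _ sigma) => //.
  exact: measurable_Zdual.
move=> x y; rewrite !in_itv/= => /andP[/ltW x0 x1] /andP[/ltW y0 y1].
by apply: nd; rewrite in_itv/= ?x0 ?y0.
Qed.

(** The spectral representative is [qsup z] rather than [rearr z], which is set to 0 at 0. Upper
    quantiles are right-continuous, and z >= 0 makes the quantile at level 0 well defined and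
    nonnegative. *)
Lemma rearr_spectral_classes z : density z -> {ae P, forall t, z t = rearr z t} ->
  spectral_classes p1 z.
Proof.
move=> dz zE; have mz := measurable_Zdual z.
have zr t : t \in `]0, 1[ -> rearr z t = qsup z t by exact: rearrE.
have cdf0 (c : R) : c < 0 -> rcdf (z : RT -> R) c = 0.
  move=> c0; apply/EFin_inj; rewrite rcdfE//; apply/eqP; rewrite eq_le measure_ge0 andbT.
  suff : (P [set t | (z t <= c)%R] <= P set0)%E by rewrite measure0.
  apply: ae_le_measure => //; first exact: measurable_le_cst.
  by apply: aeS (density_ge0 dz) => t z0 /= zt; move: c0; rewrite ltNge (le_trans z0).
(* Nonemptiness holds even at t = 0, as the distribution function vanishes at -1; an upper bound is
   borrowed from the level (t + 1) / 2. *)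
have hs t : 0 <= t < 1 -> has_sup [set r | rcdf (z : RT -> R) r <= t].
  move=> /andP[t0 t1]; split.
    by exists (-1) => /=; rewrite cdf0 ?oppr_lt0.
  have t2 : (t + 1) / 2 \in `]0, 1[ by rewrite in_itv/=; apply/andP; split; lra.
  have [_ [M Mub]] := in_itv01_has_sup mz t2.
  exists M => r /= rt; apply: Mub => /=; lra.
pose sigma : R -> R := qsup z.
have nd s t : 0 <= s -> s <= t -> t < 1 -> sigma s <= sigma t.
  move=> s0 st t1; apply: le_qsup2 => //; apply: hs.
    by rewrite s0 (le_lt_trans st).
  by rewrite t1 (le_trans s0).
have zs : {ae P, forall t, z t = sigma t}.
  by apply: aeS (aeI zE (ae_unif01_itv R)) => t [-> /zr].
exists sigma => //; split.
- move=> t; rewrite in_itv/= => /[dup] t01 /andP[t0 t1].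
  apply/cvgrPdist_le => e e0.
  (* The strict inequality leaves room to the right of t: sigma x <= sigma t + e for every x in [t,
     F(sigma t + e)[. *)
  have H : t < rcdf z (sigma t + e).
    apply: (qsup_lt (hs _ t01)); rewrite -/(sigma t); lra.
  near=> x.
  have tx : t < x by near: x; exact: nbhs_right_gt.
  have x1 : x < 1 by near: x; exact: nbhs_right_lt.
  have xc : x < rcdf z (sigma t + e) by near: x; exact: nbhs_right_lt.
  have x01 : 0 <= x < 1 by rewrite x1 (le_trans t0)// ltW.
  have h1 := nd t x t0 (ltW tx) x1.
  have h2 : sigma x <= sigma t + e by apply: qsup_le => //; exact: hs.
  by rewrite ler_norml; apply/andP; split; lra.
- move=> s t; rewrite !in_itv/= => /andP[s0 _] /andP[_ t1] st; exact: nd.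
- move=> t; rewrite in_itv/= => /[dup] t01 /andP[t0 t1].
  rewrite leNgt; apply/negP => st.
  have s2 : sigma t < sigma t / 2 by lra.
  by have := qsup_lt (hs _ t01) s2; rewrite cdf0; [rewrite ltNge t0|lra].
- have msg : measurable_fun setT (sigma \_ `[0, 1[ : RT -> R).
    apply/(measurable_restrictT _ (measurable_itv _)).
    apply: measurable_fun_nondecreasing_in => s t.
    by rewrite !in_itv/= => /andP[s0 _] /andP[_ t1] st; exact: nd.
  have -> : (1 = \int[P]_t (sigma \_ `[0, 1[ t)%:E)%E.
    have [_ <-] := dz; rewrite -(integral_unif01 (f := EFin \o z)); last exact/measurable_EFinP.
    apply: ae_eq_integral => //; [exact/measurable_EFinP|exact/measurable_EFinP|].
    apply: aeS (aeI zs (ae_unif01_ge0 R)) => t [/= -> t01] _.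
    by rewrite patchE mem_set//= in_itv.
  rewrite (integral_unif01 (f := EFin \o (sigma \_ `[0, 1[))); last exact/measurable_EFinP.
  rewrite integral_mkcond [RHS]integral_mkcond; apply: eq_integral => t _.
  rewrite !patchE/= patchE; case: (boolP (t \in `[0%R, 1%R]%classic)) => h1.
    by case: ifPn.
  case: ifPn => //; rewrite inE/= in_itv/= => /andP[t0 t1].
  by move: h1; rewrite notin_setE/= in_itv/= t0 (ltW t1).
Unshelve. all: by end_near. Qed.

End rearranged_classes.

(** * Law invariance *)

Section law_invariant_lemmas.
Context (R : realType) (p : R) (p1 : (1 <= p%:E)%E).
Context (rho : Zspace p1 -> R) (A : set (Zdual p1)).
Hypothesis law : law_invariant rho.
Hypothesis dualA : dual_set rho A.
Local Notation P := (unif01 R).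
Local Notation RT := (measurableTypeR R).
Implicit Types (X Y W : Zspace p1) (z : Zdual p1).

Lemma rho_same_law X Y : same_law (X : RT -> R) (Y : RT -> R) -> rho X = rho Y.
Proof.
move=> XY; apply: law => r; rewrite /Zcdf.
have H : measurable (`]-oo, r]%classic : set RT) by exact: measurable_itv.
have /= := XY _ H.
have E (f : RT -> R) : f @^-1` `]-oo, r] = [set w | f w <= r].
  by apply/seteqP; split => w /=; rewrite in_itv.
by rewrite !E.
Qed.

Lemma rho_rearr X Y : {ae P, forall t, Y t = rearr X t} -> rho Y = rho X.
Proof.
move=> YE; have mX := measurable_Zspace X; apply: rho_same_law => B mB.
rewrite (ae_eq_same_law (measurable_Zspace Y) (measurable_rearr mX) YE mB).
by rewrite (same_law_rearr mX mB).
Qed.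

(** Given Y, let Y' be [rearr Y] composed with the ranking of z; it has the law of Y. Then <zeta, Y>
    is at most the integral of [rearr zeta * rearr Y], which is that of [rearr z * rearr Y], namely
    <z, Y'>, at most rho Y' = rho Y; [dual_mem] concludes. *)
Lemma dual_mem_law z (zeta : Zdual p1) : A z -> same_law (z : RT -> R) (zeta : RT -> R) -> A zeta.
Proof.
move=> Az zz; have dz := dual_density dualA Az.
have mz := measurable_Zdual z; have mzeta := measurable_Zdual zeta.
have zeta0 : {ae P, forall t, 0 <= zeta t}.
  apply: (ae_same_law (Q := [set x | 0 <= x]) mz mzeta zz); last exact: density_ge0.
  have H : measurable (`[0, +oo[%classic : set RT) by exact: measurable_itv.
  rewrite (_ : [set x | 0 <= x] = `[0, +oo[%classic)//.
  by apply/seteqP; split => x /=; rewrite in_itv/= andbT.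
apply: (dual_mem dualA) => [|Y].
  apply: densityP => //.
  by rewrite -(Rintegral_same_law (h := id) mz mzeta zz)//; exact: density_int.
have mY := measurable_Zspace Y; pose r := ranking (z : RT -> R).
have mr : measurable_fun setT (r : RT -> RT) by exact: measurable_ranking.
have ru : same_law r id by exact: same_law_ranking.
have mrY := measurable_rearr mY.
have YrY : same_law (Y : RT -> R) (rearr Y \o r).
  move=> B mB; rewrite (same_law_rearr mY mB); exact: same_law_comp_uniform.
have mrYr : measurable_fun setT (rearr Y \o r) by exact: (measurableT_comp mrY mr).
have [Y' Y'E] := exists_Zspace_same_law mrYr YrY.
have -> : rho Y = rho Y'.
  apply: rho_same_law => B mB; rewrite (YrY _ mB).
  by rewrite (ae_eq_same_law (measurable_Zspace Y') mrYr Y'E mB).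
apply: le_trans (dual_le dualA Y' Az); apply: (le_trans (pairing_le_rearr Y zeta0)).
rewrite -(eq_rearr zz) (pairing_comp (measurable_rearr mz) mrY mr ru (rearr_ranking mz) Y'E).
by [].
Qed.

Lemma exists_dual_rearr z : A z -> exists2 z', A z' & {ae P, forall t, z' t = rearr z t}.
Proof.
move=> Az; have mz := measurable_Zdual z.
have [z' zE] := exists_Zdual_same_law (measurable_rearr mz) (same_law_rearr mz).
exists z' => //; apply: (dual_mem_law Az) => B mB.
rewrite (same_law_rearr mz mB).
by rewrite (ae_eq_same_law (measurable_Zdual z') (measurable_rearr mz) zE mB).
Qed.

Lemma exists_dual_ranking z X : A z ->
  exists2 z', A z' & {ae P, forall t, z' t = z (ranking X t)}.
Proof.
move=> Az; have mz := measurable_Zdual z; have mX := measurable_Zspace X.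
have mr : measurable_fun setT (ranking X : RT -> RT) by exact: measurable_ranking.
have zr : same_law (z : RT -> R) ((z : RT -> R) \o ranking X).
  by apply: same_law_comp_uniform => //; exact: same_law_ranking.
have mzr : measurable_fun setT ((z : RT -> R) \o ranking X) by exact: (measurableT_comp mz mr).
have [z' zE] := exists_Zdual_same_law mzr zr.
exists z' => //; apply: (dual_mem_law Az) => B mB.
by rewrite (zr _ mB) (ae_eq_same_law (measurable_Zdual z') mzr zE mB).
Qed.

(** The rearrangement of z belongs to A and pairs with the nondecreasing Y at least as well as z, so
    by uniqueness it is z. *)
Lemma exposed_rearr_spectral z Y : A z -> {ae P, forall t, Y t = rearr Y t} ->
  (forall z', A z' -> pairing z' Y <= pairing z Y) ->
  (forall z', A z' -> pairing z' Y = pairing z Y -> z' = z) ->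
  spectral_classes p1 z.
Proof.
move=> Az YE zmax zuniq; have dz := dual_density dualA Az.
apply: (rearr_spectral_classes dz).
have [z' Az' z'E] := exists_dual_rearr Az.
have mz := measurable_Zdual z; have mY := measurable_Zspace Y.
suff z'z : z' = z by apply: aeS z'E => t; rewrite z'z.
apply: zuniq => //; apply/eqP; rewrite eq_le zmax//=.
apply: (le_trans (pairing_le_rearr Y (density_ge0 dz))).
by rewrite (pairing_ae (measurable_rearr mz) (measurable_rearr mY) z'E YE).
Qed.

(** If w in A attains rho X on Y, then w composed with the ranking of X lies in A and attains rho X
    on X, hence is z. Applied to z' and to z itself, which attains the value on Y because it is
    spectral, this shows that z' and z agree after composition with the ranking. *)
Lemma exposed_by_rearr z X Y : A z -> spectral_classes p1 z ->
  (forall z', A z' -> pairing z' X <= pairing z X) ->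
  (forall z', A z' -> pairing z' X = pairing z X -> z' = z) ->
  {ae P, forall t, Y t = rearr X t} ->
  pairing z Y = rho X /\ forall z', A z' -> pairing z' Y = rho X -> z' = z.
Proof.
move=> Az sz zmax zuniq YE.
have mz := measurable_Zdual z; have mX := measurable_Zspace X.
have zX : pairing z X = rho X.
  apply/eqP; rewrite eq_le (dual_le dualA)//=.
  by have [z' Az' <-] := dual_max dualA X; exact: zmax.
have zY : pairing z Y = rho X.
  apply/eqP; rewrite eq_le -{1}(rho_rearr YE) (dual_le dualA)//= -zX.
  apply: (le_trans (pairing_le_rearr X (density_ge0 (dual_density dualA Az)))).
  by rewrite (pairing_ae (measurable_rearr mz) (measurable_rearr mX)
    (spectral_classes_rearr sz) YE).
split=> // z' Az' z'Y; have mz' := measurable_Zdual z'.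
have mr : measurable_fun setT (ranking X : RT -> RT) by exact: measurable_ranking.
have ru : same_law (ranking X) id by exact: same_law_ranking.
have transfer w : A w -> pairing w Y = rho X -> {ae P, forall t, z t = w (ranking X t)}.
  move=> Aw wY; have [w' Aw' w'E] := exists_dual_ranking X Aw.
  suff w'z : w' = z by apply: aeS w'E => t; rewrite w'z.
  apply: (zuniq w' Aw'); rewrite zX -wY.
  rewrite (pairing_comp (measurable_Zdual w) (measurable_rearr mX) mr ru w'E (rearr_ranking mX)).
  symmetry; apply: pairing_ae => //; [exact: measurable_Zdual|exact: measurable_rearr|exact: aeT].
apply: Zdual_ae_eq.
(* The ranking is uniform, so an a.e. property of its values is an a.e. property on [0, 1]. *)
have H := aeI (transfer _ Az' z'Y) (transfer _ Az zY).
apply: (ae_same_law (Q := [set t | z' t = z t]) mr (@measurable_id _ RT setT) ru).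
  have := measurable_fun_eqr mz' mz measurableT (Y := [set true]) I.
  by rewrite setTI; congr measurable; apply/seteqP; split => t /= /eqP.
by apply: aeS H => t [h1 h2]; rewrite /= -h1 -h2.
Qed.

End law_invariant_lemmas.

Lemma cluster_continuous (T : topologicalType) (R : realType) (S : Type)
    (F : set_system S) (h : S -> T) (f : T -> R) (z : T) (l : R) : Filter F ->
  cluster (h @ F) z -> continuous f -> f (h s) @[s --> F] --> l -> f z = l.
Proof.
move=> FF hz cf fl; apply: (@Rhausdorff R) => B C Bz Cl.
have Fl : (h @ F) (f @^-1` C) by exact: fl.
have [w [Cw Bw]] := hz _ _ Fl (cf z B Bz).
by exists (f w).
Qed.

Lemma wsum_ler (R : realType) (c d : nat -> R) (M N : R) : (forall k, `|c k| <= M) ->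
  (forall k, `|d k| <= N) -> (forall k, c k <= d k) -> wsum c <= wsum d.
Proof.
move=> cM dN cd.
have e k : `|1 * d k + -1 * c k| <= N + M.
  by rewrite mul1r mulN1r (le_trans (ler_normB _ _))// lerD.
have E := wsumD 1 (-1) dN cM; rewrite mul1r mulN1r in E.
have e0 k : 0 <= 1 * d k + -1 * c k by rewrite mul1r mulN1r subr_ge0.
rewrite -subr_ge0 -E; apply: le_trans (wsum_ge_term 0 e e0).
by rewrite mulr_ge0// exprn_ge0// invr_ge0.
Qed.

(** * Moments as continuous coordinates on measures and on the dual *)

Section spectral_exposed_points.
Context (R : realType) (p : R) (p1 : (1 <= p%:E)%E).
Local Notation P := (unif01 R).
Local Notation RT := (measurableTypeR R).
Implicit Types (X Y W : Zspace p1) (z : Zdual p1) (m : Pspace R).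

Lemma Zmoment_ge0 z k : density z -> 0 <= Zmoment z k.
Proof.
move=> dz.
have -> : 0 = \int[P]_t (cst 0 t) :> R by rewrite /Rintegral integral0_eq.
rewrite ZmomentE; apply: ae_le_Rintegral.
- exact: integrable0.
- apply: (integrable_mul_bounded (M := 1)); [exact: measurable_funX| |exact: integrable_Zdual].
  apply: aeS (ae_unif01_ge0 R) => t /andP[t0 t1].
  by rewrite ger0_norm ?exprn_ge0// exprn_ile1// ltW.
- apply: aeS (aeI (density_ge0 dz) (ae_unif01_ge0 R)) => t [z0 /andP[t0 _]].
  by rewrite mulr_ge0// exprn_ge0.
Qed.

Lemma continuous_moment k : continuous (fun m => moment m k).
Proof.
have cf : {within `[0, 1], continuous (fun x : R => x ^+ k)}.
  by apply: continuous_subspaceT; exact: exprn_continuous.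
have -> : (fun m => moment m k) = (fun m => Pintegral m (exist _ _ cf)).
  apply/funext => m.
  have := @Pintegral_approx _ m (exist _ _ cf) 'X^k 0.
  rewrite -moment_horner => H.
  have {H} : `|Pintegral m (exist _ _ cf) - \int[sval m]_a ('X^k).[a]| <= 0.
    by apply: H => x _; rewrite /= hornerXn subrr normr0.
  rewrite normr_le0 subr_eq0 => /eqP ->.
  by rewrite /moment; under [RHS]eq_Rintegral do rewrite hornerXn.
exact: (@initial_ptws_continuous R (Pspace R) (C01 R) (@Pintegral R)).
Qed.

Lemma exists_Zspace_horner (q : {poly R}) : exists X, {ae P, forall t, X t = q.[t]}.
Proof.
apply: (@exists_Zspace_bounded _ _ _ _ (\sum_(i < size q) `|q`_i|)).
  by apply: continuous_measurable_fun; exact: continuous_horner.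
by apply: aeS (ae_unif01_ge0 R) => t /andP[t0 t1]; rewrite horner_le// t0 ltW.
Qed.

Definition Zmomentpoly k : Zspace p1 := projT1 (cid (exists_Zspace_horner (momentpoly R k))).

Lemma ae_Zmomentpoly k : {ae P, forall t, Zmomentpoly k t = (momentpoly R k).[t]}.
Proof. exact: projT2 (cid (exists_Zspace_horner (momentpoly R k))). Qed.

Lemma moment_pairing m z k : {ae P, forall t, z t = Tmap m t} ->
  moment m k = pairing z (Zmomentpoly k).
Proof.
move=> zE; rewrite moment_Tmap; symmetry; apply: pairing_ae.
- exact: measurable_Tmap01.
- exact: measurable_horner.
- by apply: aeS (aeI zE (ae_Tmap01 m)) => t [-> ->].
- exact: ae_Zmomentpoly.
Qed.

Lemma pairing_moment m z : (forall k, pairing z (Zmomentpoly k) = moment m k) ->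
  {ae P, forall t, z t = Tmap m t}.
Proof.
move=> H; have mz := measurable_Zdual z; have mT := measurable_Tmap01 m.
have [iT _] := Tmap01_int m; have iz := integrable_Zdual z.
have iw : P.-integrable setT (EFin \o (fun t => z t - Tmap01 m t)).
  rewrite (_ : _ \o _ = ((fun t => (z t)%:E) \- (EFin \o Tmap01 m))%E)//.
  exact: integrableB.
have w0 : {ae P, forall t, z t - Tmap01 m t = 0}.
  apply: momentpoly_eq0 => // k.
  have mq := measurable_horner (momentpoly R k).
  have bq : {ae P, forall t : RT,
      `|(momentpoly R k).[t]| <= \sum_(i < size (momentpoly R k)) `|(momentpoly R k)`_i|}.
    by apply: aeS (ae_unif01_ge0 R) => t /andP[t0 t1]; rewrite horner_le// t0 ltW.
  transitivity (\int[P]_t (z t * (momentpoly R k).[t]) -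
                \int[P]_t (Tmap01 m t * (momentpoly R k).[t])).
    rewrite -RintegralB//; last 2 first.
    - exact: (integrable_mul_bounded mq bq).
    - exact: (integrable_mul_bounded mq bq).
    by apply: eq_Rintegral => t _; rewrite mulrBl.
  rewrite -moment_Tmap -H (pairing_ae mz mq (aeT _ (fun=> erefl)) (ae_Zmomentpoly k)).
  by rewrite subrr.
by apply: aeS (aeI w0 (ae_Tmap01 m)) => t [/eqP + <-]; rewrite subr_eq0 => /eqP.
Qed.

End spectral_exposed_points.

(** * Kusuoka sets *)

Section kusuoka_spectral.
Context (R : realType) (p : R) (p1 : (1 <= p%:E)%E).
Context (rho : Zspace p1 -> R) (A : set (Zdual p1)).
Hypothesis law : law_invariant rho.
Hypothesis dualA : dual_set rho A.
Local Notation P := (unif01 R).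
Local Notation RT := (measurableTypeR R).
Local Notation U := (spectral_classes p1 `&` exposed_points A).
Local Notation M := (Tpreimage U).
Implicit Types (X Y W : Zspace p1) (z : Zdual p1) (m : Pspace R).

(** Perturbation with N = 1 / e, whose loss e / 2 is within e, applied to the rearrangement Y so
    that the exposed point is spectral. *)
Lemma exists_near_optimal X Y e : 0 < e -> {ae P, forall t, Y t = rearr X t} ->
  exists2 z, U z & rho X <= pairing z Y + e.
Proof.
move=> e0 YE.
have [z [W [Az WE zmax zuniq opt]]] := dual_perturbed_max dualA Y (e^-1).
have dz := dual_density dualA Az; have mX := measurable_Zspace X.
have mW := measurable_Zspace W.
exists z; last first.
  rewrite -(rho_rearr law YE) -(ler_pM2l (_ : 0 < e^-1)) ?invr_gt0// mulrDr mulVf ?gt_eqF//.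
  by apply: (le_trans opt); rewrite lerD2l invf_le1// ler1n.
split; last by split=> //; exists W.
apply: (exposed_rearr_spectral law dualA Az _ zmax zuniq).
(* A nondecreasing representative of W: the moments of z are nonnegative, so the power series is
   nondecreasing on []0, 1[]. *)
pose F t := e^-1 * rearr X t + wsum (fun k => Zmoment z k * t ^+ k).
apply: (@eq_nondecreasing_rearr _ _ F) => //.
  by apply: aeS (aeI WE YE) => t [-> ->].
move=> s t s01 t01 st; rewrite lerD//.
  by rewrite ler_pM2l ?invr_gt0//; exact: rearr_nd.
have b (x : R) : x \in `]0, 1[ -> forall k, `|Zmoment z k * x ^+ k| <= 1.
  rewrite in_itv/= => /andP[x0 x1] k; rewrite normrM mulr_ile1// ?Zmoment_le1//.
  by rewrite ger0_norm; [rewrite exprn_ile1// ltW|rewrite exprn_ge0// ltW].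
apply: (wsum_ler (b _ s01) (b _ t01)) => k; rewrite ler_wpM2l ?Zmoment_ge0//.
by rewrite lerXn2r// ?nnegrE; move: s01 t01; rewrite !in_itv/= => /andP[/ltW ? _] /andP[/ltW ? _].
Qed.

(** Stated for an intermediate set so as to serve both [M] and its closure. Elements of [M] give the
    lower bound through near-optimal exposed points; domination by [rho] on A gives the upper
    bound. *)
Lemma kusuoka_between (N : set (Pspace R)) : M `<=` N -> N `<=` Tpreimage A ->
  kusuoka_set rho N.
Proof.
move=> MN NA X; have [Y YE] := exists_Zspace_rearr X.
apply/eqP; rewrite eq_le; apply/andP; split.
- apply/lee_addgt0Pr => e e0.
  have [z Uz ze] := exists_near_optimal e0 YE.
  have [[sigma sp zs] _] := Uz.
  have [m mE] := Tmap_surj sp.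
  have zm : {ae P, forall t, z t = Tmap m t} by apply: aeS (aeI zs mE) => t [-> ->].
  have H : ((rho X)%:E <= (pairing z Y)%:E + e%:E)%E by rewrite -EFinD lee_fin.
  apply: (le_trans H); rewrite leeD2r// -(integral_AVaR zm YE).
  by apply: ereal_sup_ubound; exists m => //; apply: MN; exists z.
- apply: ub_ereal_sup => _ [m /NA[z Az zm] <-].
  by rewrite (integral_AVaR zm YE) lee_fin -(rho_rearr law YE) (dual_le dualA).
Qed.

Lemma closure_U_sub : closure U `<=` A.
Proof.
have [_ cA _ _] := dualA.
have /closure_id clA := compact_closed (@Zdual_hausdorff _ _ p1) cA.
by rewrite [X in _ `<=` X]clA; apply: closureS => z [_ []].
Qed.

(** The trace on [U] of the neighbourhoods of z is carried to measures by a choice g of preimages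
    under T, with default m off [U]. The moments of g u are pairings with u, so they tend to those
    of m. *)
Lemma Tpreimage_closure_sub : Tpreimage (closure U) `<=` closure M.
Proof.
move=> m [z clz zm].
have /choice[g gE] : forall u, exists n : Pspace R,
    U u -> {ae P, forall t, u t = Tmap n t}.
  move=> u; have [[[sigma sp us] _]|nU] := pselect (U u).
    have [n nE] := Tmap_surj sp; exists n => _.
    by apply: aeS (aeI us nE) => t [-> ->].
  by exists m.
have FF : ProperFilter (within U (nbhs z)) by exact: within_nbhs_proper.
have gm : g u @[u --> within U (nbhs z)] --> m.
  apply: cvg_Pspace_moments => k.
  rewrite (moment_pairing k zm).
  have H : pairing u (Zmomentpoly p1 k) @[u --> within U (nbhs z)] -->
      pairing z (Zmomentpoly p1 k).
    by apply: cvg_within_filter; exact: continuous_pairing.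
  apply: cvg_trans H.
  apply: (near_eq_cvg (f := fun u => pairing u (Zmomentpoly p1 k)) (g := fun u => moment (g u) k)).
  near=> u; have Uu : U u by near: u; exact: withinT.
  by rewrite (moment_pairing k (gE u Uu)).
move=> B Bm.
have H1 : within U (nbhs z) (g @^-1` B) by exact: gm.
have [u [Bu Uu]] := filter_ex (filterI H1 (withinT U _)).
by exists (g u); split=> //; exists u => //; exact: gE.
Unshelve. all: by end_near. Qed.

(** The images T n of measures n in [M] lie in the compact set A, so they have a cluster point z as
    n tends to m. Its pairings with the moment polynomials are the moments of m, which identifies z
    with T m. *)
Lemma closure_sub_Tpreimage : closure M `<=` Tpreimage (closure U).
Proof.
move=> m clm; have [_ cA _ _] := dualA.
have [z0 Az0] := dual_nonempty dualA.
have /choice[h hE] : forall n : Pspace R, exists z,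
    M n -> U z /\ {ae P, forall t, z t = Tmap n t}.
  move=> n; have [[z Uz zn]|nM] := pselect (M n); last by exists z0.
  by exists z.
have FF : ProperFilter (within M (nbhs m)) by exact: within_nbhs_proper.
have hU : (h @ within M (nbhs m)) U.
  by apply: (filterS _ (withinT M _)) => n /hE[].
have hA : (h @ within M (nbhs m)) A.
  by apply: filterS hU => z [_ []].
have [z [Az clz]] := cA _ _ hA.
exists z; first by move=> B Bz; exact: clz.
apply: pairing_moment => k.
apply: (cluster_continuous (f := fun z => pairing z (Zmomentpoly p1 k)) _ clz).
  exact: continuous_pairing.
have H : moment n k @[n --> within M (nbhs m)] --> moment m k.
  by apply: cvg_within_filter; exact: continuous_moment.
apply: cvg_trans H.
apply: (near_eq_cvg (f := fun n => moment n k) (g := fun n => pairing (h n) (Zmomentpoly p1 k))).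
near=> n; have /hE[_ zn] : M n by near: n; exact: withinT.
by rewrite (moment_pairing k zn).
Unshelve. all: by end_near. Qed.

Lemma closure_Tpreimage : closure M = Tpreimage (closure U).
Proof.
by apply/seteqP; split; [exact: closure_sub_Tpreimage|exact: Tpreimage_closure_sub].
Qed.

End kusuoka_spectral.

(** The lower bound controls the negative part, and the bound on the integral then controls the
    positive part. *)
Lemma integrable_bounded_below d (T : measurableType d) (R : realType)
    (Q : probability T R) (g : T -> R) (C r : R) : measurable_fun setT g ->
  (forall t, C <= g t) -> (\int[Q]_t (g t)%:E <= r%:E)%E ->
  Q.-integrable setT (EFin \o g).
Proof.
move=> mg gC gr; have mg' : measurable_fun setT (EFin \o g) by exact/measurable_EFinP.
have mp := measurable_funepos mg'; have mn := measurable_funeneg mg'.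
have neg : (\int[Q]_t ((EFin \o g)^\- t) <= `|C|%:E)%E.
  apply: (@le_trans _ _ (\int[Q]_t (cst `|C|%:E t))%E).
    apply: ge0_le_integral => //.
    move=> t _; rewrite funenegE /= -EFin_max lee_fin ge_max normr_ge0 andbT lerNl.
    by rewrite (le_trans _ (gC t))// lerNl ler_normr lexx orbT.
  by rewrite integral_cst//= (probability_setT Q) mule1.
have neg_fin : (\int[Q]_t ((EFin \o g)^\- t) \is a fin_num)%E.
  by rewrite ge0_fin_numE ?(le_lt_trans neg) ?ltry//; apply: integral_ge0.
apply/integrableP; split => //.
have -> : (fun t => `|(EFin \o g) t|)%E = ((EFin \o g)^\+ \+ (EFin \o g)^\-)%E.
  by rewrite -fune_abse.
rewrite ge0_integralD//; apply: lte_add_pinfty; last first.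
  by rewrite (le_lt_trans neg) ?ltry.
have : (\int[Q]_t (EFin \o g)^\+ t - \int[Q]_t (EFin \o g)^\- t <= r%:E)%E.
  by rewrite -integralE.
rewrite (leeBlDr _ _ neg_fin) => /le_lt_trans; apply.
by rewrite lte_add_pinfty ?ltry// (le_lt_trans neg) ?ltry.
Qed.

(** * Monotonicity and integrability of averages *)

Section average_monotone.
Context (R : realType).
Local Notation P := (unif01 R).
Local Notation RT := (measurableTypeR R).
Implicit Types (f g : RT -> R) (m : Pspace R).

Lemma unif01_itvcy (a : R) : 0 <= a <= 1 -> P `[a, +oo[%classic = (1 - a)%:E.
Proof.
move=> a01.
have -> : (`[a, +oo[%classic : set RT) = ~` (`]-oo, a[%classic : set RT).
  by apply/seteqP; split => z; rewrite /= !in_itv/= andbT leNgt => /negP.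
by rewrite probability_setC ?unif01_itvNyo// ?EFinB//; exact: measurable_itv.
Qed.

Lemma Rintegral_indic_lin (E : set RT) f g (a b : R) : measurable E ->
  P.-integrable setT (EFin \o f) -> P.-integrable setT (EFin \o g) ->
  \int[P]_t (\1_E t * (a * f t + b * g t)) =
  a * (\int[P]_t (\1_E t * f t)) + b * \int[P]_t (\1_E t * g t).
Proof.
move=> mE fi gi; have fE := integrable_indicM mE fi; have gE := integrable_indicM mE gi.
rewrite -!RintegralZl// -RintegralD//.
- by apply: eq_Rintegral => t _; ring.
- rewrite (_ : _ \o _ = (fun t => a%:E * (\1_E t * f t)%:E)%E); last by apply/funext => t.
  exact: integrableZl.
- rewrite (_ : _ \o _ = (fun t => b%:E * (\1_E t * g t)%:E)%E); last by apply/funext => t.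
  exact: integrableZl.
Qed.

Lemma avar_lin f g a b c : P.-integrable setT (EFin \o f) -> P.-integrable setT (EFin \o g) ->
  avar (fun t => a * f t + b * g t) c = a * avar f c + b * avar g c.
Proof.
move=> fi gi; have mI : measurable (`[c, +oo[%classic : set RT) by exact: measurable_itv.
by rewrite /avar (Rintegral_indic_lin a b mI fi gi); ring.
Qed.

(** For a < b, subtract f(b): the difference is nonpositive before b and nonnegative after it.
    Cross-multiplying the averages by (1 - a) (1 - b) then leaves a pointwise comparison. *)
Lemma avar_nd f : {in `]0, 1[ &, {homo f : x y / x <= y}} ->
  P.-integrable setT (EFin \o f) ->
  {in `[0, 1[ &, {homo avar f : x y / x <= y}}.
Proof.
move=> nd fi a b; rewrite !in_itv/= => /andP[a0 a1] /andP[b0 b1].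
rewrite le_eqVlt => /predU1P[->//|ab].
have b0' : 0 < b by exact: le_lt_trans ab.
have mI (x : R) : measurable (`[x, +oo[%classic : set RT) by exact: measurable_itv.
have i1 : P.-integrable setT (EFin \o (cst 1 : RT -> R)).
  by apply: (integrable_bounded (M := 1)) => //; apply: aeT => t; rewrite normr1.
have I1 (x : R) : 0 <= x <= 1 ->
    \int[P]_t (\1_(`[x, +oo[%classic : set RT) t * cst 1 t) = 1 - x.
  move=> x01; apply/EFin_inj; rewrite -(unif01_itvcy x01) -Rintegral_indic//.
  by congr EFin; apply: eq_Rintegral => t _; rewrite mulr1.
have ig (x : R) : P.-integrable setT (fun t =>
    (\1_(`[x, +oo[%classic : set RT) t * (1 * f t + - f b * cst 1 t))%:E).
  apply: integrable_indicM => //.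
  rewrite (_ : _ \o _ = (EFin \o f) \+ (fun=> (- f b)%:E))%E; last first.
    by apply/funext => t /=; rewrite mul1r mulr1.
  apply: integrableD => //.
  by apply: (integrable_bounded (f := fun=> - f b) (M := `|- f b|)) => //; exact: aeT.
have key : (1 - b) * \int[P]_t (\1_(`[a, +oo[%classic : set RT) t * (1 * f t + - f b * cst 1 t)) <=
    (1 - a) * \int[P]_t (\1_(`[b, +oo[%classic : set RT) t * (1 * f t + - f b * cst 1 t)).
  rewrite -!RintegralZl//; [|exact: ig|exact: ig].
  apply: ae_le_Rintegral.
  - rewrite (_ : _ \o _ = (fun t => (1 - b)%:E *
        (\1_(`[a, +oo[%classic : set RT) t * (1 * f t + - f b * cst 1 t))%:E)%E)//.
    exact: integrableZl.
  - rewrite (_ : _ \o _ = (fun t => (1 - a)%:E *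
        (\1_(`[b, +oo[%classic : set RT) t * (1 * f t + - f b * cst 1 t))%:E)%E)//.
    exact: integrableZl.
  apply: aeS (ae_unif01_itv R) => t t01.
  have b01 : b \in `]0, 1[ by rewrite in_itv/= b0'.
  rewrite mul1r mulr1 !indicE.
  have [bt|tb] := leP b t.
    have fbt := nd b t b01 t01 bt.
    rewrite !mem_set/= ?in_itv/= ?andbT ?bt ?(le_trans (ltW ab) bt)// !mul1r.
    by rewrite ler_wpM2r ?subr_ge0// lerD2l lerN2 ltW.
  have ftb := nd t b t01 b01 (ltW tb).
  rewrite (@memNset _ `[b, +oo[%classic)/= ?in_itv/= ?andbT; last by rewrite leNgt tb.
  rewrite mul0r mulr0; apply: mulr_ge0_le0; first by rewrite subr_ge0 ltW.
  by rewrite mulr_ge0_le0// subr_le0.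
have a01 : 0 <= a <= 1 by rewrite a0 ltW.
have b01 : 0 <= b <= 1 by rewrite b0 ltW.
move: key; rewrite (Rintegral_indic_lin 1 (- f b) (mI a) fi i1).
rewrite (Rintegral_indic_lin 1 (- f b) (mI b) fi i1) (I1 _ a01) (I1 _ b01).
rewrite !mul1r /avar; set I := Rintegral _ _ _; set J := Rintegral _ _ _ => key.
rewrite ler_pdivrMl ?subr_gt0// mulrCA ler_pdivlMl ?subr_gt0//.
by move: I J key => I J; lra.
Qed.

Definition avar01 f : RT -> R := avar f \_ `[0, 1[.

Lemma integral_avar01 m f : (\int[sval m]_(a in `[0%R, 1%R[) (avar f a)%:E =
  \int[sval m]_a (avar01 f a)%:E)%E.
Proof.
rewrite integral_mkcond; apply: eq_integral => a _.
by rewrite /avar01 !patchE; case: ifPn.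
Qed.

(** Averages of a nondecreasing function are bounded below by the average at level 0, so a bound on
    the integral gives integrability. This covers measures whose image under T is not known to lie
    in the dual. *)
Lemma integrable_avar01 m f (r : R) : {in `]0, 1[ &, {homo f : x y / x <= y}} ->
  P.-integrable setT (EFin \o f) ->
  (\int[sval m]_a (avar01 f a)%:E <= r%:E)%E ->
  (sval m).-integrable setT (EFin \o avar01 f).
Proof.
move=> nd fi; have and_ := avar_nd nd fi.
apply: (@integrable_bounded_below _ _ _ _ _ (Num.min 0 (avar f 0))).
  apply/(measurable_restrictT _ (measurable_itv _)).
  exact: (measurable_fun_nondecreasing_in and_).
move=> t; rewrite /avar01 patchE; case: ifPn; last by rewrite ge_min lexx.
rewrite inE => t01; rewrite ge_min; apply/orP; right; apply: and_ => //.
  by rewrite in_itv/= lexx ltr01.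
by move: t01; rewrite /= in_itv/= => /andP[].
Qed.

End average_monotone.

Lemma le_Rintegral_lin d (T : measurableType d) (R : realType) (Q : probability T R)
    (f g h : T -> R) (s c r : R) : Q.-integrable setT (EFin \o f) ->
  Q.-integrable setT (EFin \o g) -> Q.-integrable setT (EFin \o h) ->
  c <= \int[Q]_t f t -> \int[Q]_t h t <= r ->
  {ae Q, forall t, f t + s * g t <= h t} -> c + s * \int[Q]_t g t <= r.
Proof.
move=> fi gi hi cf hr fgh.
have sgi : Q.-integrable setT (EFin \o (fun t => s * g t)).
  rewrite (_ : _ \o _ = (fun t => s%:E * (g t)%:E)%E)//; exact: integrableZl.
apply: le_trans hr; rewrite -RintegralZl//.
apply: (@le_trans _ _ (\int[Q]_t (f t + s * g t))); first by rewrite RintegralD// lerD2r.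
apply: ae_le_Rintegral => //.
rewrite (_ : _ \o _ = (fun t => (f t)%:E + (s * g t)%:E)%E)//.
exact: integrableD.
Qed.

(** * Minimality *)

Section minimality.
Context (R : realType) (p : R) (p1 : (1 <= p%:E)%E).
Local Notation P := (unif01 R).
Local Notation RT := (measurableTypeR R).
Implicit Types (X Y V W : Zspace p1) (z : Zdual p1) (m : Pspace R).

Lemma avar_ae (f g : RT -> R) a : measurable_fun setT f -> measurable_fun setT g ->
  {ae P, forall t, f t = g t} -> avar f a = avar g a.
Proof.
move=> mf mg fg; rewrite /avar; congr (_ * _).
have mI : measurable_fun setT (\1_(`[a, +oo[%classic : set RT) : RT -> R).
  by apply: measurable_indic; exact: measurable_itv.
apply: ae_eq_Rintegral; [exact: measurable_funM|exact: measurable_funM|].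
by apply: aeS fg => t ->.
Qed.

Lemma avar01E (f : RT -> R) a : a \in `[0, 1[ -> avar01 f a = avar f a.
Proof. by move=> a01; rewrite /avar01 patchE mem_set. Qed.

Lemma avar_le_rearr X a : 0 <= a < 1 -> avar X a <= avar (rearr X) a.
Proof.
move=> /andP[a0 a1]; rewrite /avar ler_pM2l ?invr_gt0 ?subr_gt0//.
apply: indic_le_rearr; [exact: measurable_itv|by rewrite a0 ltW| |exact: integrable_Zspace].
by apply: unif01_itvcy; rewrite a0 ltW.
Qed.

Lemma integral_AVaR01 m X : (\int[sval m]_(a in `[0%R, 1%R[) AVaR a X =
  \int[sval m]_a (avar01 (rearr X) a)%:E)%E.
Proof. by rewrite integral_AVaR_avar integral_avar01. Qed.

Lemma avar01_momentpoly m k :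
  (sval m).-integrable setT (EFin \o avar01 (fun t => (momentpoly R k).[t])) /\
  \int[sval m]_a avar01 (fun t => (momentpoly R k).[t]) a = moment m k.
Proof.
have E : {ae sval m, forall a, avar01 (fun t => (momentpoly R k).[t]) a = a ^+ k}.
  apply: aeS (Pspace_ae m) => a a01; rewrite /avar01 patchE mem_set//.
  by rewrite avar_momentpoly//; move: a01; rewrite in_itv.
have mE : measurable_fun setT (avar01 (fun t => (momentpoly R k).[t])).
  have -> : avar01 (fun t => (momentpoly R k).[t]) = ((fun a : R => a ^+ k) : R -> R) \_ `[0, 1[.
    apply/funext => a; rewrite /avar01 !patchE; case: ifPn => //.
    by rewrite inE/= in_itv/= => a01; rewrite avar_momentpoly.
  apply/(measurable_restrictT _ (measurable_itv _)); apply: measurable_funTS.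
  exact: measurable_funX.
split; last by apply: ae_eq_Rintegral => //; exact: measurable_funX.
apply: (integrable_bounded (M := 1)) => //.
apply: aeS (aeI E (Pspace_ae01 m)) => a [-> /andP[a0 a1]].
by rewrite ger0_norm ?exprn_ge0// exprn_ile1.
Qed.

(** [avar] is linear and takes the moment polynomial to a^k. The perturbed W need not be
    nondecreasing, but its averages are at most those of [rearr W], that is AV@R of W, which is the
    direction required. *)
Lemma AVaR_perturbation m X W k (s c r r' : R) :
  {ae P, forall t, W t = 1 * rearr X t + s * (momentpoly R k).[t]} ->
  (c%:E <= \int[sval m]_(a in `[0%R, 1%R[) AVaR a X)%E ->
  (\int[sval m]_(a in `[0%R, 1%R[) AVaR a X <= r%:E)%E ->
  (\int[sval m]_(a in `[0%R, 1%R[) AVaR a W <= r'%:E)%E ->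
  c + s * moment m k <= r'.
Proof.
move=> WE; rewrite [X in (_ <= X)%E -> _](integral_AVaR01 m X) => cX.
rewrite [X in (X <= _)%E -> _](integral_AVaR01 m X) => Xr.
rewrite (integral_AVaR01 m W) => Wr'.
have mX := measurable_Zspace X; have mW := measurable_Zspace W.
have iX := integrable_avar01 (rearr_nd mX) (integrable_rearr X) Xr.
have iW := integrable_avar01 (rearr_nd mW) (integrable_rearr W) Wr'.
have [ik kE] := avar01_momentpoly m k.
have cX' : c <= \int[sval m]_a avar01 (rearr X) a.
  by rewrite -lee_fin (fineK (integrable_fin_num measurableT iX)).
have Wr : \int[sval m]_a avar01 (rearr W) a <= r'.
  by rewrite -lee_fin (fineK (integrable_fin_num measurableT iW)).
rewrite -kE; apply: (le_Rintegral_lin iX ik iW cX' Wr).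
apply: aeS (Pspace_ae m) => a a01.
rewrite (avar01E (rearr X) a01) (avar01E _ a01) (avar01E (rearr W) a01).
have {}a01 : 0 <= a < 1 by move: a01; rewrite in_itv.
apply: (fun H => le_trans H (avar_le_rearr W a01)).
rewrite (avar_ae _ mW _ WE).
  by rewrite avar_lin ?mul1r//; [exact: integrable_rearr|exact: integrable_horner].
apply: measurable_funD; apply: measurable_funM => //.
  exact: measurable_rearr.
exact: measurable_horner.
Qed.

Context (rho : Zspace p1 -> R) (A : set (Zdual p1)).
Hypothesis law : law_invariant rho.
Hypothesis dualA : dual_set rho A.

(* First-order expansion at [t = 0+] of the support function
   [rho (Y + t V) <= <z0, Y> + t <z0, V> + o(t)] when [z0] is exposed by [Y]. *)
Lemma exposed_perturbation z0 Y V (K e : R) : A z0 ->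
  (forall z, A z -> pairing z Y <= pairing z0 Y) ->
  (forall z, A z -> pairing z Y = pairing z0 Y -> z = z0) ->
  {ae P, forall t, `|V t| <= K} -> 0 < e ->
  exists2 t, 0 < t & forall z, A z ->
    pairing z Y + t * pairing z V <= pairing z0 Y + t * (pairing z0 V + e).
Proof.
move=> Az0 z0max z0uniq VK e0; have [_ cA _ _] := dualA.
(* The points of A that gain at least e on V. This set is compact and omits z0, so if nonempty it
   stays at a positive distance below the maximum of <., Y>; outside it any t > 0 works. *)
pose B := A `&` [set z | pairing z0 V + e <= pairing z V].
have cB : compact B.
  apply: compact_closedI => //.
  apply: (@preimage_closed _ _ (fun z => pairing z V) [set x | pairing z0 V + e <= x]).
    by move=> z _; exact: continuous_pairing.
  exact: closed_ge.
have bd z : A z -> `|pairing z V| <= K.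
  by move=> Az; apply: pairing_bound => //; exact: dual_density dualA _ Az.
have [B0|/set0P B0] := eqVneq B set0.
  exists 1 => // z Az; rewrite !mul1r lerD ?z0max//.
  rewrite leNgt; apply/negP => h; have : B z by split=> //=; exact: ltW.
  by rewrite B0.
have [z1 [Az1 Bz1] z1max] := dual_pairing_max Y B0 cB.
have d0 : 0 < pairing z0 Y - pairing z1 Y.
  rewrite subr_gt0 lt_neqAle z0max// andbT; apply/negP => /eqP /(z0uniq _ Az1) z10.
  by move: Bz1; rewrite /= z10 gerDl leNgt e0.
have K0 : 0 <= K by apply: le_trans (bd _ Az0).
(* On [B] the gain on V is at most 2 K, so for this t the loss on Y outweighs it; the 1 keeps the
   denominator positive. *)
pose t := (pairing z0 Y - pairing z1 Y) / (2 * K + 1).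
have t0 : 0 < t by rewrite divr_gt0//; lra.
exists t => // z Az.
have [zB|zB] := leP (pairing z0 V + e) (pairing z V); last first.
  by rewrite lerD ?z0max// ler_pM2l// ltW.
have h1 : pairing z Y <= pairing z1 Y by apply: z1max.
have h2 : t * (2 * K + 1) = pairing z0 Y - pairing z1 Y by rewrite /t divfK// gt_eqF//; lra.
have h3 : t * (pairing z V - pairing z0 V - e) <= t * (2 * K + 1).
  rewrite ler_pM2l//; have := bd _ Az; have := bd _ Az0.
  by rewrite !ler_norml => /andP[? ?] /andP[? ?]; lra.
move: h1 h2 h3; move: (pairing z Y) (pairing z V) (pairing z0 Y) (pairing z0 V) (pairing z1 Y).
by move=> *; lra.
Qed.

(** The perturbation is along V = s times the moment polynomial; taking s = 1 and s = -1 later gives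
    a two-sided bound on the moment. *)
Lemma kusuoka_moment_le (N : set (Pspace R)) z0 X Y k (s e : R) : kusuoka_set rho N ->
  {ae P, forall t, Y t = rearr X t} -> A z0 -> pairing z0 Y = rho X ->
  (forall z, A z -> pairing z Y = rho X -> z = z0) -> 0 < e ->
  exists2 d, 0 < d & forall m, N m ->
    ((rho X - d)%:E <= \int[sval m]_(a in `[0%R, 1%R[) AVaR a X)%E ->
    s * moment m k <= s * pairing z0 (Zmomentpoly p1 k) + e.
Proof.
move=> kN YE Az0 z0Y z0uniq e0.
have J_le m Z : N m -> (\int[sval m]_(a in `[0%R, 1%R[) AVaR a Z <= (rho Z)%:E)%E.
  by move=> Nm; rewrite kN; apply: ereal_sup_ubound; exists m.
have [V VE] := exists_Zspace_lin (Zmomentpoly p1 k) (Zmomentpoly p1 k) s 0.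
pose K := `|s| * \sum_(i < size (momentpoly R k)) `|(momentpoly R k)`_i|.
have VK : {ae P, forall t, `|V t| <= K}.
  apply: aeS (aeI VE (aeI (ae_Zmomentpoly p1 k) (ae_unif01_ge0 R))) => t [-> [-> /andP[t0 t1]]].
  by rewrite mul0r addr0 normrM ler_wpM2l// horner_le// t0 ltW.
have e2 : 0 < e / 2 by rewrite divr_gt0.
have z0max z : A z -> pairing z Y <= pairing z0 Y.
  by move=> Az; rewrite z0Y -(rho_rearr law YE) (dual_le dualA).
have z0uniq' z : A z -> pairing z Y = pairing z0 Y -> z = z0.
  by move=> Az; rewrite z0Y; exact: z0uniq.
have [t t0 tle] := exposed_perturbation Az0 z0max z0uniq' VK e2.
(* Dividing by t turns the defect of near-optimality into e / 2; the other e / 2 is the error of the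
   first-order expansion. *)
exists (t * (e / 2)) => [|m Nm cJ]; first exact: mulr_gt0.
have [W WE] := exists_Zspace_lin Y (Zmomentpoly p1 k) 1 (t * s).
have WE' : {ae P, forall x, W x = 1 * rearr X x + t * s * (momentpoly R k).[x]}.
  by apply: aeS (aeI WE (aeI YE (ae_Zmomentpoly p1 k))) => x [-> [-> ->]].
have := AVaR_perturbation WE' cJ (J_le m X Nm) (J_le m W Nm).
have [z Az <-] := dual_max dualA W.
have := tle z Az.
rewrite (pairing_linr _ WE) !(pairing_linr _ VE) z0Y !mul0r !addr0 mul1r.
move: (pairing z Y) (pairing z _) (pairing z0 _) (moment m k) (rho X) => a b c d r h1 h2.
rewrite -(ler_pM2l t0); move: h1 h2; lra.
Qed.

(** Measures of N chosen optimal for X within 1 / (n + 1) converge in moments to the given measure,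
    which thus belongs to the closed set N. *)
Lemma Tpreimage_sub_kusuoka (N : set (Pspace R)) : kusuoka_set rho N -> closed N ->
  Tpreimage (spectral_classes p1 `&` exposed_points A) `<=` N.
Proof.
move=> kN clN m0 [z0 [sz0 [Az0 [X [z0max z0uniq]]]] z0m].
have [Y YE] := exists_Zspace_rearr X.
have [z0Y Yuniq] := exposed_by_rearr law dualA Az0 sz0 z0max z0uniq YE.
have /choice[g gP] : forall n : nat, exists m, N m /\
    ((rho X - n.+1%:R^-1)%:E <= \int[sval m]_(a in `[0%R, 1%R[) AVaR a X)%E.
  move=> n; have : ((rho X - n.+1%:R^-1)%:E < (rho X)%:E)%E.
    by rewrite lte_fin gtrBl invr_gt0.
  rewrite [X in (_ < X)%E](kN X) => /ereal_sup_gt[_ [m Nm <-] h].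
  by exists m; split=> //; exact: ltW.
suff gm : g n @[n --> \oo] --> m0.
  by apply: (closed_cvg _ clN _ _ gm); exists 0%N => // n _; have [] := gP n.
apply: cvg_Pspace_moments => k; rewrite (moment_pairing k z0m).
change (moment (g n) k @[n --> \oo] --> pairing z0 (Zmomentpoly p1 k)).
apply/cvgrPdist_le => e e0.
have [d1 d10 H1] := kusuoka_moment_le k 1 kN YE Az0 z0Y Yuniq e0.
have [d2 d20 H2] := kusuoka_moment_le k (-1) kN YE Az0 z0Y Yuniq e0.
near=> n; have [Nm gn] := gP n.
have small d : n.+1%:R^-1 <= d ->
    ((rho X - d)%:E <= \int[sval (g n)]_(a in `[0%R, 1%R[) AVaR a X)%E.
  by move=> nd; apply: le_trans gn; rewrite lee_fin lerD2l lerN2.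
have n1 : n.+1%:R^-1 <= d1 by apply: ltW; near: n; exact: (near_infty_natSinv_lt (PosNum d10)).
have n2 : n.+1%:R^-1 <= d2 by apply: ltW; near: n; exact: (near_infty_natSinv_lt (PosNum d20)).
have := H1 _ Nm (small _ n1); have := H2 _ Nm (small _ n2).
rewrite !mulN1r !mul1r => ? ?.
by rewrite ler_norml; apply/andP; split; lra.
Unshelve. all: by end_near. Qed.

End minimality.

Theorem theorem2p2 (R : realType) (p : R) (p1 : (1 <= p%:E)%E)
    (rho : Zspace p1 -> R) (A : set (Zdual p1)) :
  coherent rho -> law_invariant rho -> dual_set rho A ->
  let U : set (Zdual p1) := spectral_classes p1 `&` exposed_points A in
  let M : set (Pspace R) := Tpreimage U in
  [/\ kusuoka_set rho M,
      closure M = Tpreimage (closure U) &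
      minimal_kusuoka_set rho (closure M)].
Proof.
move=> _ law dualA U M.
have clE : closure M = Tpreimage (closure U) by exact: (closure_Tpreimage dualA).
have UA : U `<=` A by move=> z [_ []].
split=> //.
  by apply: (kusuoka_between law dualA) => // m [z Uz zm]; exists z => //; exact: UA.
split.
- apply: (kusuoka_between law dualA); first exact: subset_closure.
  by rewrite clE => m [z Uz zm]; exists z => //; exact: (closure_U_sub dualA).
- exact: closed_closure.
- move=> N kN clN; have /closure_id -> := clN.
  by apply: closureS; exact: (Tpreimage_sub_kusuoka law dualA).
Qed.
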